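(* Let $H$ be a complex Hilbert space. Every $J^*$-algebra $\mathcal{A}\subseteq\mathcal{L}(H)$ with identity which is closed in the weak operator topology has the removable singularity property.
   Context: $\mathcal{L}(H)$ is the Banach space of bounded linear operators on $H$ with the operator norm. A power algebra is a closed complex subspace $\mathcal{A}$ of $\mathcal{L}(H)$ containing the identity operator $I$ on $H$ and the squares of each of its elements. A $J^*$-algebra with identity is a power algebra which contains the adjoints of each of its elements. $G_I(\mathcal{A})$ is the connected component containing $I$ of $\{Z\in\mathcal{A}: Z^{-1}\text{ exists}\}$ (inverse in $\mathcal{L}(H)$), and $\mathcal{A}_0=\{Z\in\mathcal{A}:\|Z\|<1\}$. A power algebra $\mathcal{A}$ has the removable singularity property if, for any complex Banach space $\mathcal{X}$, every bounded holomorphic function $h:G_I(\mathcal{A})\cap\mathcal{A}_0\to\mathcal{X}$ extends to a holomorphic function on $\mathcal{A}_0$. Holomorphic means complex Fréchet differentiable on an open set. *)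

(* Defs.v *)
From HB Require Import structures.
From mathcomp Require Import all_boot all_order all_algebra.
From mathcomp Require Import all_classical all_reals all_analysis.
From mathcomp Require Import complex.

Set Implicit Arguments.
Unset Strict Implicit.
Unset Printing Implicit Defensive.

Import Order.TTheory GRing.Theory Num.Theory.
Import numFieldNormedType.Exports.

Local Open Scope classical_set_scope.
Local Open Scope ring_scope.
Local Open Scope complex_scope.

(* The form is linear in its first argument and conjugate-linear in the
   second one. *)
Record hilbertType (R : realType) := HilbertType {
  hilbert_sort :> completeNormedModType R[i];
  hdot : {dot hilbert_sort for (@Num.conj R[i])};
  hdotxx : forall x : hilbert_sort, hdot x x = `|x| ^+ 2
}.

Section BoundedOperators.
Context {R : realType} (V : normedModType R[i]).

Definition bounded_linear : {pred V -> V} := fun f =>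
  `[< linear f /\ exists M : R[i], forall x, `|f x| <= M * `|x| >].

Fact bounded_linear_submod_closed : subsemimod_closed bounded_linear.
Proof.
apply: GRing.submod_closed_semi; split.
  apply/asboolP; split; first by move=> a x y; rewrite /= scaler0 addr0.
  by exists 0 => x; rewrite normr0 mul0r.
move=> a f g /asboolP[flin [M fM]] /asboolP[glin [N gN]]; apply/asboolP.
split.
  move=> b x y; change (a *: f (b *: x + y) + g (b *: x + y) =
    b *: (a *: f x + g x) + (a *: f y + g y)).
  rewrite flin glin !scalerDr !scalerA (mulrC a b).
  by rewrite -!addrA; congr (_ + _); rewrite addrCA.
exists (`|a| * M + N) => x.
change (`|a *: f x + g x| <= (`|a| * M + N) * `|x|).
rewrite (le_trans (ler_normD _ _))// normrZ mulrDl -mulrA lerD//.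
by rewrite ler_wpM2l.
Qed.

HB.instance Definition _ :=
  GRing.isSubmodClosed.Build R[i] (V -> V) bounded_linear
    bounded_linear_submod_closed.

Record boundedOp := BoundedOp {
  boundedOp_fun :> V -> V;
  _ : boundedOp_fun \in bounded_linear
}.

HB.instance Definition _ := [isSub for boundedOp_fun].
HB.instance Definition _ := [Choice of boundedOp by <:].
HB.instance Definition _ := [SubChoice_isSubLmodule of boundedOp by <:].

Implicit Types S T : boundedOp.

Lemma boundedOp_linear T : linear T.
Proof. by case: T => f /= /asboolP[]. Qed.

Lemma boundedOp_bounded T : exists M : R[i], forall x, `|T x| <= M * `|x|.
Proof. by case: T => f /= /asboolP[]. Qed.

Lemma boundedOpP S T : S =1 T -> S = T.
Proof. by move=> ST; apply/val_inj/funext. Qed.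

(* Norms take their values in R[i]; the supremum is that of their real
   parts. *)
Definition opnorm T : R[i] :=
  (sup [set complex.Re `|T x| | x in [set x : V | `|x| <= 1]])%:C.

Let normRe (x : V) : (complex.Re `|x|)%:C = `|x|.
Proof. by apply/RRe_real/ger0_real. Qed.

Lemma boundedOp0 T : T 0 = 0.
Proof.
by have := boundedOp_linear T (-1) 0 0; rewrite scaler0 addr0 scaleN1r addNr.
Qed.

Lemma boundedOpZ T a x : T (a *: x) = a *: T x.
Proof.
by have := boundedOp_linear T a x 0; rewrite !addr0 boundedOp0 addr0.
Qed.

Let image_has_sup T :
  has_sup [set complex.Re `|T x| | x in [set x : V | `|x| <= 1]].
Proof.
split; first by exists (complex.Re `|T 0|), 0 => //=; rewrite normr0 ler01.
have [M TM] := boundedOp_bounded T.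
exists (complex.Re `|M|) => _ [x /= x1 <-].
rewrite -lecR !normRe (_ : `|T x| = `| `|T x| |) ?normr_id//.
have M0 : 0 <= M * `|x| by exact: le_trans (TM x).
rewrite (@le_trans _ _ (M * `|x|)) ?normr_id//.
by rewrite -(ger0_norm M0) normrM normr_id ler_piMr.
Qed.

Lemma opnorm_ub T x : `|x| <= 1 -> `|T x| <= opnorm T.
Proof.
move=> x1; rewrite -normRe lecR; apply: ub_le_sup; last by exists x.
by case: (image_has_sup T).
Qed.

Lemma opnorm_le T (M : R[i]) :
  (forall x, `|x| <= 1 -> `|T x| <= M) -> opnorm T <= M.
Proof.
move=> TM; have M0 : 0 <= M.
  by apply: le_trans (TM 0 _); rewrite ?normr0 ?ler01.
rewrite -(RRe_real (ger0_real M0)) lecR; apply: ge_sup.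
  by case: (image_has_sup T).
move=> _ [x /= x1 <-].
by rewrite -lecR normRe RRe_real ?ger0_real// TM.
Qed.

Lemma opnorm_ge0 T : 0 <= opnorm T.
Proof.
by apply: le_trans (normr_ge0 (T 0)) _; apply: opnorm_ub; rewrite normr0 ler01.
Qed.

Fact ler_opnormD S T : opnorm (S + T) <= opnorm S + opnorm T.
Proof.
apply: opnorm_le => x x1; apply: le_trans (ler_normD (S x) (T x)) _.
by rewrite lerD// opnorm_ub.
Qed.

Fact opnorm0_eq0 T : opnorm T = 0 -> T = 0.
Proof.
move=> T0; apply: boundedOpP => x; apply/eqP; rewrite -normr_le0.
have [->|x0] := eqVneq x 0; first by rewrite boundedOp0 normr0.
have nx0 : `|x| != 0 by rewrite normr_eq0.
have : `|T (`|x|^-1 *: x)| <= opnorm T.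
  by apply: opnorm_ub; rewrite normrZ normfV normr_id mulVf.
rewrite T0 boundedOpZ normrZ normfV normr_id pmulr_rle0//.
by rewrite invr_gt0 normr_gt0.
Qed.

Fact opnormZ (a : R[i]) T : opnorm (a *: T) = `|a| * opnorm T.
Proof.
have le_opnormZ (b : R[i]) S : opnorm (b *: S) <= `|b| * opnorm S.
  apply: opnorm_le => x x1; rewrite [leLHS](normrZ b (S x)).
  by rewrite ler_wpM2l// opnorm_ub.
apply/le_anti; rewrite le_opnormZ /=.
have [->|a0] := eqVneq a 0; first by rewrite normr0 mul0r opnorm_ge0.
rewrite -ler_pdivlMl ?normr_gt0// -normfV.
by rewrite -[in leLHS](scalerK a0 T) le_opnormZ.
Qed.

HB.instance Definition _ := Lmodule_isNormed.Build R[i] boundedOp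
  ler_opnormD opnormZ opnorm0_eq0.

Fact idfun_bounded_linear : (idfun : V -> V) \in bounded_linear.
Proof. by apply/asboolP; split => //; exists 1 => x; rewrite mul1r. Qed.

Definition idop : boundedOp := BoundedOp idfun_bounded_linear.

Fact comp_bounded_linear S T : S \o T \in bounded_linear.
Proof.
apply/asboolP; split=> [a x y|] /=; first by rewrite !boundedOp_linear.
exists (opnorm S * opnorm T).
have lipschitz (U : boundedOp) x : `|U x| <= opnorm U * `|x|.
  have [->|x0] := eqVneq x 0; first by rewrite boundedOp0 normr0 mulr0.
  have nx0 : `|x| != 0 by rewrite normr_eq0.
  have : `|U (`|x|^-1 *: x)| <= opnorm U.
    by apply: opnorm_ub; rewrite normrZ normfV normr_id mulVf.
  by rewrite boundedOpZ normrZ normfV normr_id ler_pdivrMl ?normr_gt0// mulrC.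
by move=> x; rewrite (le_trans (lipschitz _ _))// -mulrA ler_wpM2l ?opnorm_ge0.
Qed.

Definition compop S T : boundedOp := BoundedOp (comp_bounded_linear S T).

Definition invertible T := exists S, compop T S = idop /\ compop S T = idop.

End BoundedOperators.

Notation "''L' ( H )" := (boundedOp H) (format "''L' ( H )").

Section PowerAlgebras.
Context {R : realType} (H : hilbertType R).

Definition is_adjoint (T S : 'L(H)) :=
  forall x y, hdot H (T x) y = hdot H x (S y).

(* Initial topology for the maps T |-> <T x, y>, with x, y in H. *)
Definition weak_operator_topology : topologicalType :=
  initial_topology
    ((fun T p => hdot H (T p.1) p.2) : 'L(H) -> {ptws H * H -> R[i]^o}).

Record powerAlgebra := PowerAlgebra {
  pa_set : set 'L(H);
  pa_submod : submod_closed [pred T | `[< pa_set T >]];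
  pa_closed : closed pa_set;
  pa_id : pa_set (idop H);
  pa_sqr : forall T, pa_set T -> pa_set (compop T T)
}.

(* [is_adjoint T S] determines S, since the form is definite. *)
Definition jstar_algebra (A : powerAlgebra) :=
  forall T, pa_set A T -> exists2 S, pa_set A S & is_adjoint T S.

Definition wot_closed (A : powerAlgebra) :=
  closed (pa_set A : set weak_operator_topology).

Section Elements.
Variable A : powerAlgebra.

Definition pa_mem : {pred 'L(H)} := fun T => `[< pa_set A T >].

HB.instance Definition _ :=
  GRing.isSubmodClosed.Build R[i] 'L(H) pa_mem
    (GRing.submod_closed_semi (pa_submod A)).

Record pa_elt := PaElt { pa_val :> 'L(H); _ : pa_val \in pa_mem }.

HB.instance Definition _ := [isSub for pa_val].
HB.instance Definition _ := [Choice of pa_elt by <:].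
HB.instance Definition _ := [SubChoice_isSubLmodule of pa_elt by <:].

Fact ler_paD (x y : pa_elt) :
  `|pa_val (x + y)| <= `|pa_val x| + `|pa_val y|.
Proof. exact: ler_normD. Qed.

Fact pa_normZ (a : R[i]) (x : pa_elt) : `|pa_val (a *: x)| = `|a| * `|pa_val x|.
Proof. exact: normrZ. Qed.

Fact pa_norm0_eq0 (x : pa_elt) : `|pa_val x| = 0 -> x = 0.
Proof. by move/normr0_eq0 => x0; apply/val_inj. Qed.

HB.instance Definition _ := Lmodule_isNormed.Build R[i] pa_elt
  ler_paD pa_normZ pa_norm0_eq0.

Fact pa_id_subproof : idop H \in pa_mem.
Proof. by apply/asboolP; exact: pa_id. Qed.

Definition pa_one : pa_elt := PaElt pa_id_subproof.

Definition G_I : set pa_elt :=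
  connected_component [set Z | invertible (pa_val Z)] pa_one.

Definition open_unit_ball : set pa_elt := [set Z | `|Z| < 1].

End Elements.

End PowerAlgebras.

Arguments G_I {R H} A.
Arguments open_unit_ball {R H} A.

Section RemovableSingularities.
Context {R : realType}.

(* A function on an open subset U is represented by a total function whose
   values outside of U are irrelevant. [differentiable] is Frechet
   differentiability over the scalar field R[i]. *)
Definition holomorphic (V W : normedModType R[i]) (U : set V) (f : V -> W) :=
  forall x, U x -> differentiable f x.

Definition removable_singularity_property (H : hilbertType R)
    (A : powerAlgebra H) :=
  forall (X : completeNormedModType R[i]) (h : pa_elt A -> X),
    holomorphic (G_I A `&` open_unit_ball A) h ->
    [bounded h Z | Z in G_I A `&` open_unit_ball A] ->
    exists2 g : pa_elt A -> X, holomorphic (open_unit_ball A) g &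
      forall Z, (G_I A `&` open_unit_ball A) Z -> g Z = h Z.

End RemovableSingularities.

(* Main.v *)
From HB Require Import structures.
Require Import Defs.
From mathcomp Require Import all_boot all_order all_algebra.
From mathcomp Require Import all_classical all_reals all_analysis.
From mathcomp Require Import complex.
From mathcomp Require Import ring lra.

Set Implicit Arguments.
Unset Strict Implicit.
Unset Printing Implicit Defensive.

Import Order.TTheory GRing.Theory Num.Theory.
Import numFieldNormedType.Exports.

Local Open Scope classical_set_scope.
Local Open Scope ring_scope.
Local Open Scope complex_scope.

(** Write [G] for the component of the identity and [B] for the open unit ball
    of the algebra. The extension of [h], bounded by [M] on [G] and [B], is
    rebuilt from its homogeneous parts.

    For [Z] in [G] every nonzero multiple of [Z] is in [G], so [h (m *: Z)] is a
    bounded holomorphic function of the complex number [m] near [0], outside of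
    [0]. The singularity is removable; let [hcoef n Z] be the [n]-th Taylor
    coefficient. It is holomorphic on [G], homogeneous of degree [n] in [Z], and
    the Cauchy estimate gives [nm (hcoef n Z) <= M * nm Z ^+ n].

    Each [hcoef n] is the restriction to [G] of a polynomial [hpoly n] of degree
    [n] on the whole algebra. Let [dcoef n k W] be the [k]-th Taylor coefficient
    at [0] of [hcoef n (1 + m *: W)] in [m]. If [1 + m *: W] is in [G] for all
    [m] outside of a finite set, then that function of [m] extends to an entire
    function of growth at most [nm m ^+ n], hence [dcoef n k W = 0] for [k > n].
    Such [W] are dense among the self-adjoint elements ([spectral_approx]), so
    by continuity [dcoef n k] vanishes on these, and then on all [S + 'i *: T]
    with [S] and [T] self-adjoint, because it vanishes on [S + x *: T] for real
    [x] and is holomorphic in [x]. The sum of the [dcoef n k (Z - 1)] over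
    [k <= n] is therefore equal to [hcoef n Z] near the identity, hence on [G],
    which is connected.

    Möbius transformations bound [hpoly n] off [G]. If [nm Z < 1], then
    with [Z'] the adjoint of [Z],
    [T m = Z + m *: ((1 - Z Z')^(1/2) (1 + m Z')^-1 (1 - Z' Z)^(1/2))]
    is a holomorphic disc in the algebra with [T 0 = Z] whose boundary values are
    unitary and belong to [G] ([moebius_family]). The maximum principle along
    this disc extends the bound [M * q ^+ n] to all [Z] with [nm Z < q]. So the
    series of the [hpoly n] converges locally uniformly on [B]; its sum is
    holomorphic there, and equal to [h] on [G].

    The density statement depends on closedness in the weak operator topology:
    thanks to it the algebra contains the strong limits that define square roots
    and the symmetry [J] of the polar decomposition [S * J = |S|]. For a
    self-adjoint contraction [S] the operator [2 S - J] is again a contraction,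
    and iterating [S |-> 2 S - J] yields the binary expansion of [S] in commuting
    symmetries, whose partial sums have finite real spectrum.

    Functions of one complex variable with values in a Banach space are treated
    from the ground up: Goursat's theorem gives primitives, the primitives have
    second order expansions, and these suffice for the maximum principle
    ([max_jet2]), from which everything else is deduced. *)

(** * Linear identities in modules *)

Section ModuleIdentities.
Variables (K : comNzRingType) (V : lmodType K).

Inductive lincomb : Type :=
  | LAtom of nat | LZero | LAdd of lincomb & lincomb
  | LOpp of lincomb | LScale of K & lincomb.

Fixpoint lc_eval (s : seq V) (t : lincomb) : V :=
  match t with
  | LAtom i => nth 0 s i
  | LZero => 0
  | LAdd a b => lc_eval s a + lc_eval s b
  | LOpp a => - lc_eval s a
  | LScale c a => c *: lc_eval s a
  end.

Fixpoint lc_coef (t : lincomb) (i : nat) : K :=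
  match t with
  | LAtom j => if eqn i j then 1 else 0
  | LZero => 0
  | LAdd a b => lc_coef a i + lc_coef b i
  | LOpp a => - lc_coef a i
  | LScale c a => c * lc_coef a i
  end.

Lemma lc_evalE s t :
  lc_eval s t = \sum_(i < size s) lc_coef t i *: nth 0 s i.
Proof.
elim: t => [j| |a iha b ihb|a iha|c a iha] /=.
- have coefE (i : nat) : (if eqn i j then 1 else 0) = (i == j)%:R :> K.
    by rewrite eqnE; case: eqP.
  case: (ltnP j (size s)) => js; last first.
    rewrite nth_default// big1// => i _.
    rewrite coefE (_ : (i == j :> nat) = false) ?scale0r//.
    by apply/negbTE; rewrite neq_ltn (leq_trans (ltn_ord i) js).
  rewrite (bigD1 (Ordinal js))//= big1 => [|i ij].
    by rewrite coefE eqxx scale1r addr0.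
  rewrite coefE (_ : (i == j :> nat) = false) ?scale0r//.
  by apply/negbTE; apply: contra ij => /eqP ij; apply/eqP/val_inj.
- by rewrite big1// => i _; rewrite scale0r.
- by rewrite iha ihb -big_split /=; apply: eq_bigr => i _; rewrite scalerDl.
- by rewrite iha -sumrN; apply: eq_bigr => i _; rewrite scaleNr.
- by rewrite iha scaler_sumr; apply: eq_bigr => i _; rewrite scalerA.
Qed.

Fixpoint lc_agree (n : nat) (t u : lincomb) : Prop :=
  if n is m.+1 then lc_coef t m = lc_coef u m /\ lc_agree m t u else True.

(** Two formal linear combinations of the same atoms are equal as soon as their
    coefficients are; this reduces an identity in a module to finitely many
    identities in the ring of scalars. *)
Lemma lc_eval_eq s t u :
  lc_agree (size s) t u -> lc_eval s t = lc_eval s u.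
Proof.
move=> tu; rewrite !lc_evalE; apply: eq_bigr => i _; congr (_ *: _).
case: i => i /=; elim: (size s) tu => //= n ih [e tu].
by rewrite ltnS leq_eqVlt => /predU1P[->//|]; apply: ih.
Qed.

End ModuleIdentities.

(* Products are compared factor by factor: two occurrences of the same product may
   carry ring structures that are convertible without being syntactically equal. *)
Ltac lc_same x y :=
  lazymatch constr:((x, y)) with
  | (?z, ?z) => constr:(true)
  | ((?a * ?b)%R, (?c * ?d)%R) =>
      let p := lc_same a c in
      lazymatch p with true => lc_same b d | false => constr:(false) end
  | (1%R, 1%R) => constr:(true)
  | _ => constr:(false)
  end.
Ltac lc_mem x s :=
  lazymatch s with
  | nil => constr:(false)
  | ?y :: ?s' =>
      let p := lc_same x y in
      lazymatch p with true => constr:(true) | false => lc_mem x s' end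
  end.
Ltac lc_idx x s :=
  lazymatch s with
  | ?y :: ?s' =>
      let p := lc_same x y in
      lazymatch p with
      | true => constr:(0%N)
      | false => let n := lc_idx x s' in constr:(S n)
      end
  end.
Ltac lc_atoms s t :=
  lazymatch t with
  | (?a + ?b)%R => let s' := lc_atoms s a in lc_atoms s' b
  | (- ?a)%R => lc_atoms s a
  | (_ *: ?a)%R => lc_atoms s a
  | 0%R => s
  | _ => let b := lc_mem t s in
         lazymatch b with true => s | false => constr:(t :: s) end
  end.
Ltac lc_reify K s t :=
  lazymatch t with
  | (?a + ?b)%R => let a' := lc_reify K s a in let b' := lc_reify K s b in
                   constr:(LAdd a' b')
  | (- ?a)%R => let a' := lc_reify K s a in constr:(LOpp a')
  | (?c *: ?a)%R => let a' := lc_reify K s a in constr:(LScale (c : K) a')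
  | 0%R => constr:(@LZero K)
  | _ => let i := lc_idx t s in constr:(@LAtom K i)
  end.
Ltac lincomb_with K V :=
  lazymatch goal with
  | |- ?l = ?r =>
      let s0 := lc_atoms (@nil V) l in
      let s := lc_atoms s0 r in
      let l' := lc_reify K s l in
      let r' := lc_reify K s r in
      refine (@lc_eval_eq K _ s l' r' _); cbn [size lc_agree lc_coef eqn]
  end.

(** * Real-valued norms and limits of sequences *)

Section RealNorm.
Variable R : realType.
Implicit Types V : normedZmodType R[i].

(** The norm of a normed module over [R[i]] is itself complex-valued; its real part
    gives access to the order of [R]. *)
Definition nm V (x : V) : R := complex.Re `|x|.

Lemma nmE V (x : V) : `|x| = (nm x)%:C.
Proof. by rewrite /nm RRe_real// ger0_real. Qed.

Lemma nm_ge0 V (x : V) : 0 <= nm x.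
Proof. by rewrite -lecR -nmE normr_ge0. Qed.

Lemma nm0 V : nm (0 : V) = 0.
Proof. by rewrite /nm normr0. Qed.

Lemma nm_eq0 V (x : V) : nm x = 0 -> x = 0.
Proof. by move=> x0; apply/eqP; rewrite -normr_eq0 nmE x0. Qed.

Lemma nm_gt0 V (x : V) : x != 0 -> 0 < nm x.
Proof.
move=> x0; rewrite lt_neqAle nm_ge0 andbT eq_sym.
by apply: contra x0 => /eqP/nm_eq0 ->.
Qed.

Lemma nmN V (x : V) : nm (- x) = nm x.
Proof. by rewrite /nm normrN. Qed.

Lemma nmD V (x y : V) : nm (x + y) <= nm x + nm y.
Proof. by rewrite -lecR rmorphD /= -!nmE ler_normD. Qed.

Lemma nmC V (x y : V) : nm (x - y) = nm (y - x).
Proof. by rewrite -nmN opprB. Qed.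

Lemma nmB V (y x z : V) : nm (x - z) <= nm (x - y) + nm (y - z).
Proof. by rewrite (le_trans _ (nmD _ _))// addrA subrK. Qed.

Lemma nmDB V (x y : V) : nm x <= nm y + nm (x - y).
Proof. by rewrite (le_trans _ (nmD _ _))// addrC subrK. Qed.

Lemma nm_sum V (I : Type) (r : seq I) (P : pred I) (F : I -> V) :
  nm (\sum_(i <- r | P i) F i) <= \sum_(i <- r | P i) nm (F i).
Proof.
elim/big_ind2 : _ => // [|x a y b xa yb]; first by rewrite nm0.
by rewrite (le_trans (nmD _ _))// lerD.
Qed.

Lemma nmM (a b : R[i]) : nm (a * b) = nm a * nm b.
Proof.
have /complexI : (nm (a * b))%:C = (nm a * nm b)%:C by
  rewrite -nmE normrM !nmE rmorphM.
by [].
Qed.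

Lemma nmZ (V : normedModType R[i]) (a : R[i]) (x : V) :
  nm (a *: x) = nm a * nm x.
Proof.
have /complexI : (nm (a *: x))%:C = (nm a * nm x)%:C by
  rewrite -nmE normrZ !nmE rmorphM.
by [].
Qed.

Lemma nm1 : nm (1 : R[i]) = 1.
Proof. by rewrite /nm normr1. Qed.

Lemma nmX (a : R[i]) n : nm (a ^+ n) = nm a ^+ n.
Proof. by elim: n => [|n ih]; rewrite ?nm1// !exprS nmM ih. Qed.

Lemma nmV (a : R[i]) : nm a^-1 = (nm a)^-1.
Proof.
have [->|a0] := eqVneq a 0; first by rewrite invr0 nm0 invr0.
have n0 : nm a != 0 by rewrite gt_eqF// nm_gt0.
by apply: (mulfI n0); rewrite -nmM !divff// nm1.
Qed.

Lemma nmR (t : R) : nm t%:C = `|t|.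
Proof. by rewrite /nm normc_def /= expr0n /= addr0 sqrtr_sqr. Qed.

Lemma nm_nat n : nm (n%:R : R[i]) = n%:R.
Proof. by rewrite -(rmorph_nat (real_complex R)) nmR ger0_norm. Qed.

Lemma nm_sqr (z : R[i]) : nm z ^+ 2 = complex.Re z ^+ 2 + complex.Im z ^+ 2.
Proof.
case: z => a b; rewrite /nm normc_def /= sqr_sqrtr//.
by rewrite addr_ge0// sqr_ge0.
Qed.

Lemma nm_i : nm ('i : R[i]) = 1.
Proof.
have := nm_sqr ('i : R[i]); rewrite /= expr0n expr1n /= add0r => /eqP.
by rewrite sqrp_eq1 ?nm_ge0// => /eqP.
Qed.

Lemma Re_le_nm (z : R[i]) : `|complex.Re z| <= nm z.
Proof.
rewrite -(ler_pXn2r (n := 2))// ?nnegrE ?nm_ge0//.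
by rewrite nm_sqr real_normK ?num_real// lerDl sqr_ge0.
Qed.

Lemma Im_le_nm (z : R[i]) : `|complex.Im z| <= nm z.
Proof.
rewrite -(ler_pXn2r (n := 2))// ?nnegrE ?nm_ge0//.
by rewrite nm_sqr real_normK ?num_real// lerDr sqr_ge0.
Qed.

Lemma nm_le_ReIm (z : R[i]) : nm z <= `|complex.Re z| + `|complex.Im z|.
Proof.
rewrite -(ler_pXn2r (n := 2))// ?nnegrE ?nm_ge0 ?addr_ge0//.
rewrite nm_sqr sqrrD -!(real_normK (num_real (complex.Re z))) -(real_normK (num_real (complex.Im z))).
by rewrite addrAC lerDl mulrn_wge0// mulr_ge0.
Qed.

Definition slim V (u : nat -> V) (l : V) :=
  forall e : R, 0 < e -> exists N, forall n, (N <= n)%N -> nm (u n - l) < e.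

Lemma slim_uniq V (u : nat -> V) l l' : slim u l -> slim u l' -> l = l'.
Proof.
move=> ul ul'; apply/eqP; rewrite -subr_eq0; apply/negPn/negP => /nm_gt0 d0.
have [|N uN] := ul (nm (l - l') / 2); first by lra.
have [|N' uN'] := ul' (nm (l - l') / 2); first by lra.
have := uN _ (leq_maxl N N'); have := uN' _ (leq_maxr N N').
have := nmB (u (maxn N N')) l l'; rewrite (nmC l (u _)); lra.
Qed.

Lemma slim_le V (u : nat -> V) l y (c : R) N :
  slim u l -> (forall n, (N <= n)%N -> nm (u n - y) <= c) -> nm (l - y) <= c.
Proof.
move=> ul uc; apply/ler_addgt0Pr => e e0; have [M uM] := ul _ e0.
have := uM _ (leq_maxr N M); have := uc _ (leq_maxl N M).
have := nmB (u (maxn N M)) l y; rewrite (nmC l (u _)); lra.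
Qed.

Lemma slim_cst V (l : V) : slim (fun=> l) l.
Proof. by move=> e e0; exists 0%N => n _; rewrite subrr nm0. Qed.

Lemma slimD V (u v : nat -> V) l k :
  slim u l -> slim v k -> slim (fun n => u n + v n) (l + k).
Proof.
move=> ul vk e e0; have [|N uN] := ul (e / 2); first lra.
have [|M vM] := vk (e / 2); first lra.
exists (maxn N M) => n; rewrite geq_max => /andP[/uN h1 /vM h2].
have -> : u n + v n - (l + k) = (u n - l) + (v n - k) by rewrite opprD addrACA.
have := nmD (u n - l) (v n - k); lra.
Qed.

Lemma slimZ (V : normedModType R[i]) (a : R[i]) (u : nat -> V) l :
  slim u l -> slim (fun n => a *: u n) (a *: l).
Proof.
move=> ul e e0; have a0 := nm_ge0 a.
have [|N uN] := ul (e / (nm a + 1)); first by rewrite divr_gt0// ltr_wpDl.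
exists N => n /uN; rewrite -scalerBr nmZ ltr_pdivlMr ?ltr_wpDl//.
by have := nm_ge0 (u n - l); nra.
Qed.

Lemma slimN V (u : nat -> V) l : slim u l -> slim (fun n => - u n) (- l).
Proof. by move=> ul e /ul[N uN]; exists N => n /uN; rewrite -opprD nmN. Qed.

Lemma slim_shift V (u : nat -> V) l : slim u l -> slim (fun n => u n.+1) l.
Proof. by move=> ul e /ul[N uN]; exists N => n Nn; apply: uN; rewrite leqW. Qed.

Lemma cauchy_slim (X : completeNormedModType R[i]) (u : nat -> X) :
  (forall e : R, 0 < e -> exists N, forall m n, (N <= m)%N -> (N <= n)%N ->
    nm (u m - u n) < e) -> exists l, slim u l.
Proof.
move=> cu.
have : cauchy (u n @[n --> \oo]).
  apply/cauchyP => e e0; have /[dup] e0' : 0 < complex.Re e.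
    by move: e0; case: e => a b; rewrite ltcE /= => /andP[].
  move=> /cu[N uN]; exists (u N); exists N => //= n /= Nn.
  rewrite -ball_normE /= nmE.
  have -> : e = (complex.Re e)%:C by rewrite RRe_real// gtr0_real.
  by rewrite ltcR; apply: uN.
move=> /cauchy_cvgP cvu; exists (lim (u n @[n --> \oo])) => e e0.
have /cvgrPdist_lt/(_ e%:C) := cvu.
rewrite ltcR => /(_ e0)[N _ uN]; exists N => n Nn.
by have := uN n Nn; rewrite nmE ltcR nmC.
Qed.

(** Bolzano-Weierstrass: a disc is contained in a product of two segments. *)
Lemma disc_cluster (r : R) (u : nat -> R[i]) : (forall n, nm (u n) <= r) ->
  exists2 z : R[i], nm z <= r &
    forall (e : R) N, 0 < e -> exists2 n, (N <= n)%N & nm (u n - z) < e.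
Proof.
move=> ur.
have cK : compact (`[- r, r]%classic `*` `[- r, r]%classic : set (R * R)).
  by apply: compact_setX; apply: segment_compact.
pose v n := (complex.Re (u n), complex.Im (u n)).
have [] := cK (v n @[n --> \oo]).
  exists 0%N => // n _; split => /=; rewrite in_itv /= -ler_norml.
    exact: le_trans (Re_le_nm _) (ur n).
  exact: le_trans (Im_le_nm _) (ur n).
move=> [a b] [_ clu].
have clz e N : 0 < e -> exists2 n, (N <= n)%N & nm (u n - (a +i* b)) < e.
  move=> e0; have e2 : 0 < e / 2 by lra.
  have [] := clu [set v n | n in [set n | (N <= n)%N]] (ball (a, b) (e / 2)).
  - by exists N => // n /= Nn; exists n.
  - exact: nbhsx_ballx.
  move=> _ [[n /= Nn <-] [/=]].
  rewrite -!ball_normE /= => h1 h2; exists n => //.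
  apply: (le_lt_trans (nm_le_ReIm _)).
  move: h1 h2; rewrite /v; case: (u n) => x y /=.
  rewrite (distrC a) (distrC b); lra.
exists (a +i* b) => //; apply/ler_addgt0Pr => e e0.
have [n _] := clz e 0%N e0; have := nmDB (a +i* b) (u n); rewrite nmC.
have := ur n; lra.
Qed.

End RealNorm.

(** * Complex differentiation *)

Section Holomorphic.
Variables (R : realType) (X : normedModType R[i]).
Local Notation C := R[i].
Implicit Types f g : C -> X.

Ltac lmod := lincomb_with R[i] X.

(** The derivative [d] is a parameter, so that no choice is needed to state
    differentiability and uniqueness is a lemma. *)
Definition dif f (z : C) (d : X) := forall e : R, 0 < e -> exists2 t : R, 0 < t &
  forall h : C, nm h < t -> nm (f (z + h) - f z - h *: d) <= e * nm h.

Definition hol f (r : R) := forall z : C, nm z < r -> exists d, dif f z d.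

Definition ccont f (z : C) := forall e : R, 0 < e -> exists2 t : R, 0 < t &
  forall w : C, nm (w - z) < t -> nm (f w - f z) < e.

Definition ucont f (r : R) := forall e : R, 0 < e -> exists2 t : R, 0 < t &
  forall z w : C, nm z <= r -> nm w <= r -> nm (z - w) < t -> nm (f z - f w) < e.

Lemma dif_ccont f z d : dif f z d -> ccont f z.
Proof.
move=> fd e e0; have [t t0 ft] := fd 1 ltr01.
have d0 : 0 < nm d + 2 by rewrite ltr_wpDl// nm_ge0.
exists (Num.min t (e / (nm d + 2))).
  by rewrite lt_min t0 divr_gt0.
move=> w; rewrite lt_min => /andP[wt]; rewrite ltr_pdivlMr// => we.
have := ft (w - z) wt; rewrite mul1r addrCA subrr addr0 => h.
have := nmDB (f w - f z) ((w - z) *: d); rewrite nmZ.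
have := nm_ge0 (w - z); have := nm_ge0 d; nra.
Qed.

Lemma dif_uniq f z d d' : dif f z d -> dif f z d' -> d = d'.
Proof.
move=> fd fd'; apply/eqP; rewrite -subr_eq0; apply/negPn/negP => /nm_gt0 n0.
have [|t t0 ft] := fd (nm (d - d') / 4); first lra.
have [|t' t0' ft'] := fd' (nm (d - d') / 4); first lra.
pose s : R := Num.min t t' / 2.
have s0 : 0 < s by rewrite divr_gt0// lt_min t0.
have sm : s < Num.min t t' by rewrite /s; have : 0 < Num.min t t' by [rewrite lt_min t0]; lra.
move: sm; rewrite lt_min => /andP[st st'].
have ns : nm (s%:C) = s by rewrite nmR gtr0_norm.
have := ft s%:C; rewrite ns => /(_ st) h1.
have := ft' s%:C; rewrite ns => /(_ st') h2.
have := nmB (f (z + s%:C) - f z) (s%:C *: d) (s%:C *: d').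
rewrite -scalerBr nmZ ns (nmC (s%:C *: d)) => h3.
have : s * nm (d - d') <= s * (nm (d - d') / 2) by lra.
by rewrite ler_pM2l//; lra.
Qed.

Lemma dif_shift f z d : dif f z d -> dif (fun h => f (z + h)) 0 d.
Proof.
move=> fd e /fd[t t0 ft]; exists t => // h ht.
by rewrite add0r addr0; apply: ft.
Qed.

Lemma dif_unshift f z d : dif (fun h => f (z + h)) 0 d -> dif f z d.
Proof.
move=> fd e /fd[t t0 ft]; exists t => // h /ft.
by rewrite add0r addr0.
Qed.

Lemma dif_local f g z d : (exists2 t : R, 0 < t & forall w : C, nm (w - z) < t -> f w = g w) ->
  dif f z d -> dif g z d.
Proof.
move=> [s s0 fg] fd e /fd[t t0 ft]; exists (Num.min t s); first by rewrite lt_min t0.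
move=> h; rewrite lt_min => /andP[ht hs].
rewrite -!fg; [exact: ft|by rewrite subrr nm0|].
by rewrite addrC addKr.
Qed.

Lemma dif_cst (c : X) z : dif (fun=> c) z 0.
Proof.
move=> e e0; exists 1 => // h _.
by rewrite scaler0 subr0 subrr nm0 mulr_ge0// ?nm_ge0// ltW.
Qed.

Lemma difD f g z d k : dif f z d -> dif g z k -> dif (fun w => f w + g w) z (d + k).
Proof.
move=> fd gk e e0.
have [|t t0 ft] := fd (e / 2); first lra.
have [|s s0 gs] := gk (e / 2); first lra.
exists (Num.min t s); first by rewrite lt_min t0.
move=> h; rewrite lt_min => /andP[/ft h1 /gs h2].
have -> : f (z + h) + g (z + h) - (f z + g z) - h *: (d + k) =
  (f (z + h) - f z - h *: d) + (g (z + h) - g z - h *: k).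
  by lmod; do ?split; ring.
have := nmD (f (z + h) - f z - h *: d) (g (z + h) - g z - h *: k); lra.
Qed.

(** [dif] for scalar functions: the increment [h] multiplies the derivative in the
    field instead of acting on a module. *)
Definition sdif (a : C -> C) (z b : C) := forall e : R, 0 < e -> exists2 t : R, 0 < t &
  forall h : C, nm h < t -> nm (a (z + h) - a z - h * b) <= e * nm h.

Lemma difM a f z b d : sdif a z b -> dif f z d ->
  dif (fun w => a w *: f w) z (a z *: d + b *: f z).
Proof.
move=> ab fd e e0.
have fc := dif_ccont fd.
pose K := nm (a z) + nm b + nm (f z) + 2.
have az := nm_ge0 (a z); have bz := nm_ge0 b; have fz := nm_ge0 (f z).
have K0 : 0 < K by rewrite /K; lra.
pose e' := Num.min 1 (e / (3 * K)).
have e'0 : 0 < e' by rewrite lt_min ltr01 divr_gt0// mulr_gt0.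
have e'1 : e' <= 1 by rewrite ge_min lexx.
have e'K : e' * (3 * K) <= e by rewrite -ler_pdivlMr ?mulr_gt0// ge_min lexx orbT.
have [t t0 ft] := fd _ e'0; have [s s0 as_] := ab _ e'0.
have [u u0 fu] := fc _ e'0.
exists (Num.min t (Num.min s u)); first by rewrite !lt_min t0 s0.
move=> h; rewrite !lt_min => /and3P[/ft h1 /as_ h2 hu].
have {hu fu} h3 : nm (f (z + h) - f z) < e'.
  by apply: fu; rewrite addrC addKr.
have -> : a (z + h) *: f (z + h) - a z *: f z - h *: (a z *: d + b *: f z) =
  a z *: (f (z + h) - f z - h *: d) + (a (z + h) - a z - h * b) *: f (z + h)
  + (h * b) *: (f (z + h) - f z).
  by lmod; do ?split; ring.
have h4 := nmDB (f (z + h)) (f z).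
have hh := nm_ge0 h.
set p := f (z + h) - f z - h *: d in h1 *.
set q := a (z + h) - a z - h * b in h2 *.
set r := f (z + h) - f z in h3 h4 *.
have H := nmD (a z *: p + q *: f (z + h)) ((h * b) *: r).
have H' := nmD (a z *: p) (q *: f (z + h)).
move: H H'; rewrite !nmZ nmM => H H'.
have p1 : nm (a z) * nm p <= nm (a z) * (e' * nm h) by rewrite ler_wpM2l.
have p2 : nm q * nm (f (z + h)) <= e' * nm h * (nm (f z) + 1).
  by rewrite ler_pM ?nm_ge0//; lra.
have p3 : nm h * nm b * nm r <= nm h * nm b * e'.
  by rewrite ler_wpM2l ?mulr_ge0// ltW.
have p4 : e' * (3 * K) * nm h <= e * nm h by rewrite ler_wpM2r.
have p5 : 0 <= e' * nm h by rewrite mulr_ge0// ltW.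
have p6 : e' * nm h * (nm (a z) + nm b + nm (f z) + 1) <= e' * nm h * (3 * K).
  by rewrite ler_wpM2l// /K; lra.
have : e' * nm h * (nm (a z) + nm b + nm (f z) + 1) = 
  nm (a z) * (e' * nm h) + e' * nm h * (nm (f z) + 1) + nm h * nm b * e' by ring.
lra.
Qed.

Lemma sdif_cst c z : sdif (fun=> c) z 0.
Proof.
move=> e e0; exists 1 => // h _.
by rewrite mulr0 subr0 subrr nm0 mulr_ge0// ?nm_ge0// ltW.
Qed.

Lemma sdif_inv z : z != 0 -> sdif (fun w => w^-1) z (- z^-2).
Proof.
move=> z0 e e0.
have nz := nm_gt0 z0.
have nz3 : 0 < nm z ^+ 3 by rewrite exprn_gt0.
exists (Num.min (nm z / 2) (e * nm z ^+ 3 / 2)).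
  by rewrite lt_min !divr_gt0// mulr_gt0.
move=> h; rewrite lt_min => /andP[hz he].
have zh : nm z / 2 <= nm (z + h).
  by have := nmDB z (z + h); rewrite opprD addrA subrr sub0r nmN; lra.
have zh0 : z + h != 0.
  by apply/negP => /eqP zh0; move: zh; rewrite zh0 nm0; lra.
have -> : (z + h)^-1 - z^-1 - h * - z^-2 = h * (h / (z ^+ 2 * (z + h))).
  by field; rewrite z0 zh0.
rewrite nmM mulrC ler_wpM2r ?nm_ge0// nmM nmV nmM nmX.
rewrite ler_pdivrMr ?mulr_gt0 ?exprn_gt0//; last lra.
apply: (le_trans (ltW he)).
have : e * nm z ^+ 2 * (nm z / 2) <= e * nm z ^+ 2 * nm (z + h).
  by rewrite ler_wpM2l// mulr_ge0// ltW// exprn_gt0.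
have -> : nm z ^+ 3 = nm z ^+ 2 * nm z by rewrite exprSr.
lra.
Qed.

Lemma sdif_id z : sdif id z 1.
Proof.
move=> e e0; exists 1 => // h _.
have -> : z + h - z - h * 1 = 0 by ring.
by rewrite nm0 mulr_ge0// ?nm_ge0// ltW.
Qed.

Lemma difZ (c : C) f z d : dif f z d -> dif (fun w => c *: f w) z (c *: d).
Proof.
move=> fd; have := difM (sdif_cst c z) fd; by rewrite scale0r addr0.
Qed.

Lemma dif_comp_affine f (p q : C) z d : dif f (p + q * z) d ->
  dif (fun w => f (p + q * w)) z (q *: d).
Proof.
move=> fd e e0; have q0 : 0 < nm q + 1 by rewrite ltr_wpDl// nm_ge0.
have [|t t0 ft] := fd (e / (nm q + 1)); first by rewrite divr_gt0.
exists (t / (nm q + 1)); first by rewrite divr_gt0.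
move=> h; rewrite ltr_pdivlMr// => ht.
have hq : nm (q * h) < t.
  by rewrite nmM; have := nm_ge0 h; nra.
have -> : p + q * (z + h) = p + q * z + q * h by ring.
have := ft _ hq; rewrite scalerA (mulrC h) => /le_trans; apply.
rewrite nmM mulrA ler_wpM2r ?nm_ge0// mulrAC ler_pdivrMr// ler_wpM2l ?ltW//.
lra.
Qed.

End Holomorphic.

Lemma sdifM (R : realType) (a a' : R[i] -> R[i]) z b b' : sdif a z b -> sdif a' z b' ->
  sdif (fun w => a w * a' w) z (a z * b' + b * a' z).
Proof. by move=> az a'z; apply: (@difM R R[i]^o a a' z b b' az a'z). Qed.

(** * Continuity on closed discs *)

Section Compactness.
Variables (R : realType) (X : normedModType R[i]).
Local Notation C := R[i].
Implicit Types f g : C -> X.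

Lemma inv_small (e : R) : 0 < e -> exists N, forall n, (N <= n)%N -> n.+1%:R^-1 < e.
Proof.
move=> e0; exists (Num.bound e^-1) => n Nn.
rewrite invf_plt ?posrE//.
have := archi_boundP (ltW (_ : 0 < e^-1)); rewrite invr_gt0 e0 => /(_ isT) h.
by rewrite (lt_le_trans h)// ler_nat leqW.
Qed.

(** Heine's theorem: otherwise there are pairs of arbitrarily close points with far
    apart images, and a cluster point of the first components contradicts
    continuity. *)
Lemma ccont_ucont f r : (forall z : C, nm z <= r -> ccont f z) -> ucont f r.
Proof.
move=> fc e e0; apply: contrapT => nuc.
have bad n : exists zw : C * C, [/\ nm zw.1 <= r, nm zw.2 <= r,
    nm (zw.1 - zw.2) < n.+1%:R^-1 & e <= nm (f zw.1 - f zw.2)].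
  apply: contrapT => nb; apply: nuc; exists n.+1%:R^-1; first by rewrite invr_gt0.
  move=> z w zr wr zw; rewrite ltNge; apply/negP => ef; apply: nb.
  by exists (z, w).
have [u uP] := choice bad.
have [|z zr zcl] := @disc_cluster R r (fun n => (u n).1).
  by move=> n; case: (uP n).
have [|t t0 ft] := fc z zr (e / 2); first lra.
have [|N uN] := @inv_small (t / 2); first lra.
have [|n Nn h] := zcl (t / 2) N; first lra.
have [_ _ h1 h2] := uP n; have h3 := uN n Nn.
move: (n.+1%:R^-1) h1 h3 => q h1 h3.
have h4 := ft (u n).1; have h5 := ft (u n).2.
have := nmB (u n).1 (u n).2 z; rewrite (nmC (u n).2 (u n).1) => h6.
have := h4 ltac:(lra); have := h5 ltac:(lra).
have := nmB (f z) (f (u n).1) (f (u n).2); rewrite (nmC (f z) (f (u n).2)).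
lra.
Qed.

(** Boundedness and attainment both follow by evaluating at a cluster point of a
    sequence along which [u] is too large, respectively close to its supremum. *)
Lemma disc_max (u : C -> R) (r : R) : 0 <= r ->
  (forall z : C, nm z <= r -> forall e : R, 0 < e -> exists2 t : R, 0 < t &
     forall w : C, nm w <= r -> nm (w - z) < t -> `|u w - u z| < e) ->
  exists2 z : C, nm z <= r & forall w : C, nm w <= r -> u w <= u z.
Proof.
move=> r0 uc; pose A := [set u z | z in [set z : C | nm z <= r]].
have A0 : A !=set0 by exists (u 0), 0 => //=; rewrite nm0.
have Aub : has_ubound A.
  apply: contrapT => nub.
  have big n : exists z : C, nm z <= r /\ n%:R < u z.
    apply: contrapT => nb; apply: nub; exists n%:R => _ [z /= zr <-].
    by rewrite leNgt; apply/negP => h; apply: nb; exists z.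
  have [v vP] := choice big.
  have [|z zr zcl] := @disc_cluster R r v; first by move=> n; case: (vP n).
  have [t t0 ut] := uc z zr 1 ltr01.
  have [n Nn h] := zcl t (Num.bound `|u z + 1|) t0.
  have [vr vn] := vP n.
  have /ltr_normlP[_] := ut _ vr h.
  have := archi_boundP (normr_ge0 (u z + 1)); have := ler_norm (u z + 1).
  have : (Num.bound `|u z + 1|)%:R <= n%:R :> R by rewrite ler_nat.
  lra.
have hs : has_sup A by [].
have near_ n : exists z : C, nm z <= r /\ sup A - n.+1%:R^-1 < u z.
  have [|_ [z /= zr <-] h] := @sup_adherent R A n.+1%:R^-1 _ hs; first by rewrite invr_gt0.
  by exists z.
have [v vP] := choice near_.
have [|z zr zcl] := @disc_cluster R r v; first by move=> n; case: (vP n).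
exists z => // w wr; apply: (@le_trans _ _ (sup A)).
  by apply: ub_le_sup => //; exists w.
apply/ler_addgt0Pr => e e0.
have [|t t0 ut] := uc z zr (e / 2); first lra.
have [|N uN] := @inv_small (e / 2); first lra.
have [n Nn h] := zcl t N t0; have [vr vn] := vP n.
have /ltr_normlP[_] := ut _ vr h; move: (uN n Nn) vn.
by move: (n.+1%:R^-1) => q; lra.
Qed.

Lemma hol_ucont f r r' : r < r' -> hol f r' -> ucont f r.
Proof.
move=> rr' fh; apply: ccont_ucont => z zr.
have [|d /dif_ccont//] := fh z; lra.
Qed.

Lemma hol_bounded f r r' : r < r' -> hol f r' ->
  exists2 M : R, 0 < M & forall z : C, nm z <= r -> nm (f z) <= M.
Proof.
move=> rr' fh; case: (lerP 0 r) => [r0|r0]; last first.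
  by exists 1 => // z; have := nm_ge0 z; lra.
have [|z zr zM] := @disc_max (fun z => nm (f z)) r r0.
  move=> z zr e e0; have [|d /dif_ccont fc] := fh z; first lra.
  have [t t0 ft] := fc e e0; exists t => // w _ /ft.
  have := nmDB (f w) (f z); have := nmDB (f z) (f w); rewrite (nmC (f z)).
  by move=> ? ? ?; apply/ltr_normlP; split; lra.
exists (nm (f z) + 1) => [|w /zM]; last lra.
by have := nm_ge0 (f z); lra.
Qed.

End Compactness.

(** * Integrals along segments *)

Section Integral.
Variables (R : realType) (X : completeNormedModType R[i]).
Local Notation C := R[i].
Implicit Types f g : C -> X.
Ltac lmod := lincomb_with R[i] X.

Definition mid (a b : C) : C := (a + b) / 2.

(** Left Riemann sums over the dyadic subdivisions of [[a, b]]. Their limit is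
    additive at midpoints by construction, and no other additivity is needed to
    quarter triangles. *)
Fixpoint dyadic_sum f (n : nat) (a b : C) : X :=
  if n is m.+1 then dyadic_sum f m a (mid a b) + dyadic_sum f m (mid a b) b
  else (b - a) *: f a.

Definition integral f a b : X := get [set l | slim (fun n => dyadic_sum f n a b) l].

Lemma two0 : 2 != 0 :> C. Proof. by rewrite pnatr_eq0. Qed.
Hint Resolve two0 : core.

Lemma nm_mid_l a b : nm (mid a b - a) = nm (b - a) / 2.
Proof.
have -> : mid a b - a = (b - a) / 2 by rewrite /mid; field.
by rewrite nmM nmV nm_nat.
Qed.

Lemma nm_mid_r a b : nm (b - mid a b) = nm (b - a) / 2.
Proof.
have -> : b - mid a b = (b - a) / 2 by rewrite /mid; field.
by rewrite nmM nmV nm_nat.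
Qed.

Lemma midC a b : mid a b = mid b a.
Proof. by rewrite /mid addrC. Qed.

(** The points of a dyadic subdivision of [[a, b]] are obtained from [a] and [b] by
    taking midpoints. *)
Definition midconvex (D : C -> Prop) := forall a b, D a -> D b -> D (mid a b).

Lemma midconvex_ball (c : C) r : midconvex (fun z : C => nm (z - c) <= r).
Proof.
move=> a b ar br.
have -> : mid a b - c = ((a - c) + (b - c)) / 2 by rewrite /mid; field.
rewrite nmM nmV nm_nat; have := nmD (a - c) (b - c); lra.
Qed.

Lemma midconvex_disc r : midconvex (fun z : C => nm z <= r).
Proof.
by move=> a b; have := @midconvex_ball 0 r a b; rewrite !subr0.
Qed.

Lemma dyadic_sum_near D f g w n a b : midconvex D -> D a -> D b ->
  (forall z : C, D z -> nm (f z - g z) <= w) ->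
  nm (dyadic_sum f n a b - dyadic_sum g n a b) <= nm (b - a) * w.
Proof.
move=> Dm Da Db fg; elim: n a b Da Db => [|n ih] a b Da Db /=.
  by rewrite -scalerBr nmZ ler_wpM2l ?nm_ge0// fg.
have h1 := ih _ _ Da (Dm _ _ Da Db); have h2 := ih _ _ (Dm _ _ Da Db) Db.
rewrite opprD addrACA (le_trans (nmD _ _))//.
move: h1 h2; rewrite nm_mid_l nm_mid_r; lra.
Qed.

Lemma dyadic_sum_cst c n a b : dyadic_sum (fun=> c) n a b = (b - a) *: c.
Proof.
elim: n a b => [//|n ih] a b /=; rewrite !ih -scalerDl; congr (_ *: _).
by rewrite addrC addrA subrK.
Qed.

(** On a piece of the coarse subdivision the coarse sum is the fine sum of a
    constant function. *)
Lemma dyadic_sum_refine (D : C -> Prop) f w n k a b : midconvex D -> D a -> D b ->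
  (forall z v : C, D z -> D v -> nm (z - v) <= nm (b - a) / 2 ^+ n ->
     nm (f z - f v) <= w) ->
  nm (dyadic_sum f (n + k) a b - dyadic_sum f n a b) <= nm (b - a) * w.
Proof.
move=> Dm; elim: n a b => [|n ih] a b Da Db fw /=.
  rewrite add0n -(dyadic_sum_cst (f a) k).
  apply: (@dyadic_sum_near (fun z => D z /\ nm (z - a) <= nm (b - a))).
  - by move=> z v [Dz za] [Dv va]; split; [exact: Dm|exact: midconvex_ball].
  - by split=> //; rewrite subrr nm0 nm_ge0.
  - by split.
  - by move=> z [Dz za]; apply: fw => //; rewrite expr0 divr1.
have Dc := Dm _ _ Da Db.
have e2 : nm (b - a) / 2 / 2 ^+ n = nm (b - a) / 2 ^+ n.+1.
  by rewrite exprS invfM mulrA.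
have h1 := ih _ _ Da Dc; have h2 := ih _ _ Dc Db.
rewrite opprD addrACA (le_trans (nmD _ _))//.
move: h1 h2; rewrite nm_mid_l nm_mid_r e2 => /(_ fw) h1 /(_ fw) h2; lra.
Qed.

Lemma dyadic_sum_rev (D : C -> Prop) f w n a b : midconvex D -> D a -> D b ->
  (forall z v : C, D z -> D v -> nm (z - v) <= nm (b - a) / 2 ^+ n ->
     nm (f z - f v) <= w) ->
  nm (dyadic_sum f n a b + dyadic_sum f n b a) <= nm (b - a) * w.
Proof.
move=> Dm; elim: n a b => [|n ih] a b Da Db fw /=.
  rewrite -(opprB b a) scaleNr -scalerBr nmZ ler_wpM2l ?nm_ge0// fw//.
  by rewrite expr0 divr1 nmC.
have Dc := Dm _ _ Da Db.
have e2 : nm (b - a) / 2 / 2 ^+ n = nm (b - a) / 2 ^+ n.+1.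
  by rewrite exprS invfM mulrA.
have h1 := ih _ _ Da Dc; have h2 := ih _ _ Dc Db.
rewrite (midC b a) (addrC (dyadic_sum f n b _)) addrACA (le_trans (nmD _ _))//.
move: h1 h2; rewrite nm_mid_l nm_mid_r e2 => /(_ fw) h1 /(_ fw) h2; lra.
Qed.

Lemma half_pow_small (c t : R) : 0 <= c -> 0 < t -> exists N, forall n, (N <= n)%N -> c / 2 ^+ n < t.
Proof.
move=> c0 t0; have [|N hN] := @inv_small R (t / (c + 1)); first by rewrite divr_gt0// ltr_wpDl.
exists N => n /hN; rewrite ltr_pdivlMr ?ltr_wpDl// => h.
have n2 : n.+1%:R <= 2 ^+ n :> R by rewrite -natrX ler_nat ltn_expl.
rewrite ltr_pdivrMr ?exprn_gt0//; move: h; rewrite mulrC ltr_pdivrMr ?ltr0n// => h.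
have : t * n.+1%:R <= t * 2 ^+ n by rewrite ler_wpM2l// ltW.
lra.
Qed.

Section Disc.
Variables (f : C -> X) (r : R).
Hypothesis fu : ucont f r.

Lemma ucont_scale (a b : C) e : 0 < e -> exists N, forall n, (N <= n)%N ->
  forall z v : C, nm z <= r -> nm v <= r -> nm (z - v) <= nm (b - a) / 2 ^+ n ->
  nm (f z - f v) <= e.
Proof.
move=> e0; have [t t0 ft] := fu e0.
have [N hN] := half_pow_small (nm_ge0 (b - a)) t0.
exists N => n /hN nt z v zr vr zv; apply/ltW/ft => //; exact: le_lt_trans nt.
Qed.

Lemma integral_lim (a b : C) : nm a <= r -> nm b <= r ->
  slim (fun n => dyadic_sum f n a b) (integral f a b).
Proof.
move=> ar br; rewrite /integral.
suff : exists l, slim (fun n => dyadic_sum f n a b) l by move=> [l /getI].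
apply: cauchy_slim => e e0; have c0 := nm_ge0 (b - a).
have [|N hN] := @ucont_scale a b (e / (4 * (nm (b - a) + 1))).
  by rewrite divr_gt0// mulr_gt0// ltr_wpDl.
exists N => m n Nm Nn.
have key k : (N <= k)%N -> nm (dyadic_sum f k a b - dyadic_sum f N a b) <= e / 4.
  move=> Nk; have := @dyadic_sum_refine (fun z : C => nm z <= r) f _ N (k - N) a b
    (@midconvex_disc r) ar br (hN N (leqnn N)).
  rewrite subnKC// => /le_trans; apply.
  rewrite invfM mulrA mulrA ler_pdivrMr ?ltr_wpDl//.
  by have := ltW e0; nra.
have := nmB (dyadic_sum f N a b) (dyadic_sum f m a b) (dyadic_sum f n a b).
have := key _ Nm; have := key _ Nn; rewrite (nmC (dyadic_sum f N a b)); lra.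
Qed.

Lemma integral_mid (a b : C) : nm a <= r -> nm b <= r ->
  integral f a b = integral f a (mid a b) + integral f (mid a b) b.
Proof.
move=> ar br; have cr := midconvex_disc ar br.
apply: slim_uniq (slim_shift (integral_lim ar br)) _.
exact: slimD (integral_lim ar cr) (integral_lim cr br).
Qed.

(** The sums from [a] to [b] use left endpoints and those from [b] to [a] right
    endpoints, so they cancel up to the oscillation of [f]. *)
Lemma integral_rev (a b : C) : nm a <= r -> nm b <= r ->
  integral f b a = - integral f a b.
Proof.
move=> ar br; apply/eqP; rewrite -addr_eq0 addrC; apply/eqP.
apply: slim_uniq (slimD (integral_lim ar br) (integral_lim br ar)) _.
move=> e e0; have c0 := nm_ge0 (b - a).
have [|N hN] := @ucont_scale a b (e / (2 * (nm (b - a) + 1))).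
  by rewrite divr_gt0// mulr_gt0// ltr_wpDl.
exists N => n Nn; rewrite subr0.
have := @dyadic_sum_rev (fun z : C => nm z <= r) f _ n a b
  (@midconvex_disc r) ar br (hN n Nn).
move=> /le_lt_trans; apply.
rewrite invfM mulrA mulrA ltr_pdivrMr ?ltr_wpDl//.
by nra.
Qed.

Lemma integral_near D g l w (a b : C) : nm a <= r -> nm b <= r ->
  midconvex D -> D a -> D b -> slim (fun n => dyadic_sum g n a b) l ->
  (forall z : C, D z -> nm (f z - g z) <= w) ->
  nm (integral f a b - l) <= nm (b - a) * w.
Proof.
move=> ar br Dm Da Db gl fg.
have := slimD (integral_lim ar br) (slimN gl).
move=> /(@slim_le _ _ _ _ 0 (nm (b - a) * w) 0%N); rewrite subr0; apply => n _.
by rewrite subr0; apply: (dyadic_sum_near _ Dm).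
Qed.

End Disc.

(** The error of left sums is explicit for affine functions; the limit is the
    difference of the values of a primitive, which telescopes along a triangle. *)
Lemma dyadic_sum_affine (c d : X) (p : C) n a b :
  dyadic_sum (fun z => c + (z - p) *: d) n a b =
  (b - a) *: c + ((b - p) ^+ 2 / 2 - (a - p) ^+ 2 / 2) *: d - ((b - a) ^+ 2 / 2 ^+ n.+1) *: d.
Proof.
have e2 k : 2 ^+ k != 0 :> C by rewrite expf_neq0.
elim: n a b => [|n ih] a b /=.
  by rewrite expr1; lmod; do ?split; field.
rewrite !ih /mid; have := e2 n; rewrite !exprS; set P := 2 ^+ n => P0.
by lmod; do ?split; field; rewrite P0.
Qed.

Lemma dyadic_sum_affine_lim (c d : X) (p : C) a b :
  slim (fun n => dyadic_sum (fun z => c + (z - p) *: d) n a b)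
  ((b - a) *: c + ((b - p) ^+ 2 / 2 - (a - p) ^+ 2 / 2) *: d).
Proof.
move=> e e0.
have [N hN] := half_pow_small (mulr_ge0 (sqr_ge0 (nm (b - a))) (nm_ge0 d)) e0.
exists N => n Nn; rewrite dyadic_sum_affine addrAC subrr add0r nmN nmZ nmM nmV !nmX nm_nat.
by have := hN n.+1 (leqW Nn); lra.
Qed.

End Integral.

(** * Goursat's theorem and primitives *)

Section Goursat.
Variables (R : realType) (X : completeNormedModType R[i]).
Local Notation C := R[i].
Implicit Types f g : C -> X.
Ltac lmod := lincomb_with R[i] X.

Definition triangle f a b c : X := integral f a b + integral f b c + integral f c a.

Lemma triangle_split f r (a b c : C) : ucont f r -> nm a <= r -> nm b <= r -> nm c <= r ->
  triangle f a b c =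
  triangle f a (mid a b) (mid c a) + triangle f (mid a b) b (mid b c)
  + triangle f (mid b c) c (mid c a) + triangle f (mid a b) (mid b c) (mid c a).
Proof.
move=> fu ar br cr.
have mr := midconvex_disc ar br; have nr := midconvex_disc br cr.
have pr := midconvex_disc cr ar.
rewrite /triangle (integral_mid fu ar br) (integral_mid fu br cr) (integral_mid fu cr ar).
rewrite (integral_rev fu mr nr) (integral_rev fu nr pr) (integral_rev fu pr mr).
by lmod; do ?split; ring.
Qed.

Definition tri_side (T : C * C * C) (s : R) :=
  [/\ nm (T.1.1 - T.1.2) <= s, nm (T.1.2 - T.2) <= s & nm (T.2 - T.1.1) <= s].

Definition tri_in (r : R) (T : C * C * C) :=
  [/\ nm T.1.1 <= r, nm T.1.2 <= r & nm T.2 <= r].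

Definition tri_int f (T : C * C * C) := nm (triangle f T.1.1 T.1.2 T.2).

Lemma nm_mid_mid (a b c : C) : nm (mid a b - mid b c) = nm (c - a) / 2.
Proof.
have -> : mid a b - mid b c = - ((c - a) / 2) by rewrite /mid; field.
by rewrite nmN nmM nmV nm_nat.
Qed.

(** One of the four triangles cut out by the midpoints carries at least a quarter of
    the integral. *)
Lemma triangle_descent f r T s : ucont f r -> tri_in r T -> tri_side T s ->
  exists T', [/\ tri_in r T', tri_side T' (s / 2), nm (T'.1.1 - T.1.1) <= s &
    tri_int f T <= 4 * tri_int f T'].
Proof.
case: T => [[a b] c] fu [/= ar br cr] [/= abs_ bcs cas].
have mr := midconvex_disc ar br; have nr := midconvex_disc br cr.
have pr := midconvex_disc cr ar.
have s0 : 0 <= s by apply: le_trans abs_; exact: nm_ge0.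
have e1 : nm (a - mid a b) = nm (a - b) / 2 by rewrite nmC nm_mid_l nmC.
have e2 : nm (mid a b - b) = nm (a - b) / 2 by rewrite nmC nm_mid_r nmC.
have e3 : nm (b - mid b c) = nm (b - c) / 2 by rewrite nmC nm_mid_l nmC.
have e4 : nm (mid b c - c) = nm (b - c) / 2 by rewrite nmC nm_mid_r nmC.
have e5 : nm (c - mid c a) = nm (c - a) / 2 by rewrite nmC nm_mid_l nmC.
have e6 : nm (mid c a - a) = nm (c - a) / 2 by rewrite nmC nm_mid_r nmC.
have e7 : nm (mid a b - mid c a) = nm (b - c) / 2 by rewrite nmC nm_mid_mid.
have e8 : nm (mid b c - mid a b) = nm (c - a) / 2 by rewrite nmC nm_mid_mid.
have e9 : nm (mid c a - mid b c) = nm (a - b) / 2.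
  by rewrite nmC nm_mid_mid.
have S := triangle_split fu ar br cr.
set t1 := triangle f a (mid a b) _ in S; set t2 := triangle f _ b (mid b c) in S.
set t3 := triangle f (mid b c) c _ in S; set t4 := triangle f (mid a b) _ _ in S.
have key : nm (triangle f a b c) <= nm t1 + nm t2 + nm t3 + nm t4.
  rewrite S (le_trans (nmD _ _))// lerD2r (le_trans (nmD _ _))// lerD2r.
  by rewrite (le_trans (nmD _ _)).
have [h1|h1] := lerP (nm (triangle f a b c)) (4 * nm t1).
  exists (a, mid a b, mid c a); split => //=.
    by split => /=; rewrite ?e1 ?e6 ?e7; clear -abs_ bcs cas s0; lra.
  by rewrite subrr nm0.
have [h2|h2] := lerP (nm (triangle f a b c)) (4 * nm t2).
  exists (mid a b, b, mid b c); split => //=.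
    by split => /=; rewrite ?e2 ?e3 ?e8; clear -abs_ bcs cas s0; lra.
  by rewrite nm_mid_l nmC; lra.
have [h3|h3] := lerP (nm (triangle f a b c)) (4 * nm t3).
  exists (mid b c, c, mid c a); split => //=.
    by split => /=; rewrite ?e4 ?e5 ?e9; clear -abs_ bcs cas s0; lra.
  by have := nmB (mid a b) (mid b c) a; rewrite e8 nm_mid_l (nmC b); lra.
exists (mid a b, mid b c, mid c a); split => //=.
- split => /=; first by rewrite nmC e8; clear -cas s0; lra.
    by rewrite nmC e9; clear -abs_ s0; lra.
  by rewrite nmC e7; clear -bcs s0; lra.
- by rewrite nm_mid_l nmC; lra.
- by rewrite /tri_int /= -/t4; lra.
Qed.

Lemma integral_affine_near f r p d e s (a b : C) : ucont f r -> nm a <= r -> nm b <= r ->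
  nm (a - p) <= s -> nm (b - p) <= s ->
  (forall w : C, nm (w - p) <= s -> nm (f w - f p - (w - p) *: d) <= e) ->
  nm (integral f a b - ((b - a) *: f p + ((b - p) ^+ 2 / 2 - (a - p) ^+ 2 / 2) *: d)) <= nm (b - a) * e.
Proof.
move=> fu ar br as_ bs h.
apply: (integral_near fu ar br (midconvex_ball (c := p) (r := s)) as_ bs (dyadic_sum_affine_lim (f p) d p a b)).
by move=> z /h; rewrite opprD addrA.
Qed.

(** The nested triangles of [triangle_descent] shrink to a point [p]. The integral of
    the first order expansion of [f] at [p] over a triangle vanishes, and the
    remainder on a triangle of side [s] contributes a small multiple of [s ^+ 2],
    which beats the factor [4] lost at each step. *)
Lemma goursat f r r' (a b c : C) : r < r' -> hol f r' -> nm a <= r -> nm b <= r -> nm c <= r ->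
  triangle f a b c = 0.
Proof.
move=> rr' fh ar br cr; have fu := hol_ucont rr' fh.
pose s0 := nm (a - b) + nm (b - c) + nm (c - a).
pose good (p : (C * C * C) * R) := tri_in r p.1 /\ tri_side p.1 p.2.
have step p : exists q, good p -> [/\ good q, q.2 = p.2 / 2,
    nm (q.1.1.1 - p.1.1.1) <= p.2 & tri_int f p.1 <= 4 * tri_int f q.1].
  have [[pr ps]|np] := pselect (good p); last by exists p.
  have [T [Tr Ts h1 h2]] := triangle_descent fu pr ps.
  by exists (T, p.2 / 2).
have [F FP] := choice step.
pose u n := iter n F ((a, b, c), s0).
have g0 : good (u 0%N).
  split => //; rewrite /u /s0 /=.
  have := nm_ge0 (a - b); have := nm_ge0 (b - c); have := nm_ge0 (c - a).
  by split => /=; lra.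
have gu n : good (u n) by elim: n => [//|n /FP[]].
have su n : (u n).2 = s0 / 2 ^+ n.
  elim: n => [|n ih]; first by rewrite expr0 divr1.
  by have [_ -> _ _] := FP _ (gu n); rewrite ih exprSr invfM mulrA.
have s0_ge0 : 0 <= s0 by rewrite /s0 !addr_ge0 ?nm_ge0.
have pow_gt0 n : 0 < 2 ^+ n :> R by rewrite exprn_gt0.
pose v n := (u n).1.1.1.
have vstep n k : nm (v (n + k)%N - v n) <= 2 * (s0 / 2 ^+ n) - 2 * (s0 / 2 ^+ (n + k)).
  elim: k => [|k ih]; first by rewrite addn0 !subrr nm0.
  have [_ _ h _] := FP _ (gu (n + k)%N).
  have := nmB (v (n + k)%N) (v (n + k.+1)%N) (v n).
  rewrite addnS /v /= in h ih *; rewrite su in h.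
  have -> : s0 / 2 ^+ (n + k).+1 = s0 / 2 ^+ (n + k) / 2 by rewrite exprSr invfM mulrA.
  by move: (s0 / 2 ^+ (n + k)) (s0 / 2 ^+ n) h ih => p q; lra.
have vN n k : (n <= k)%N -> nm (v k - v n) <= 2 * (s0 / 2 ^+ n).
  move=> nk; have := vstep n (k - n)%N; rewrite subnKC//.
  have : 0 <= s0 / 2 ^+ k by rewrite divr_ge0// ltW.
  lra.
have [|p pr clu] := @disc_cluster R r v; first by move=> k; case: (gu k) => -[].
have pv n : nm (v n - p) <= 2 * (s0 / 2 ^+ n).
  apply/ler_addgt0Pr => e e0; have [k nk h] := clu e n e0.
  have := nmB (v k) (v n) p; rewrite (nmC (v n) (v k)) (nmC (v n) p); have := vN _ _ nk.
  by move: (s0 / _) => q; lra.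
have tu n : tri_int f (a, b, c) <= 4 ^+ n * tri_int f (u n).1.
  elim: n => [|n ih]; first by rewrite expr0 mul1r.
  have [_ _ _ h] := FP _ (gu n).
  rewrite (le_trans ih)// exprSr -mulrA ler_wpM2l// exprn_ge0//.
have [|d fd] := fh p; first lra.
apply: nm_eq0; apply/eqP; rewrite eq_le nm_ge0 andbT.
apply/ler_addgt0Pr => e e0; rewrite add0r.
pose e' := e / (9 * (s0 ^+ 2 + 1)).
have e'0 : 0 < e' by rewrite divr_gt0// mulr_gt0// ltr_wpDl// sqr_ge0.
have [t t0 ft] := fd _ e'0.
have [|N hN] := @half_pow_small R (3 * s0) t _ t0; first by rewrite mulr_ge0.
have {hN} hN := hN N (leqnn N); rewrite -mulrA in hN.
have [[/= x1 x2 x3] [/= y1 y2 y3]] := gu N; have hp := pv N.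
have tN := tu N; rewrite /tri_int /= in tN.
apply: (le_trans tN); rewrite su in y1 y2 y3.
rewrite /v in hp; move: (u N).1 hp x1 x2 x3 y1 y2 y3 => [[a' b'] c'] /= hp x1 x2 x3 y1 y2 y3.
set S := s0 / 2 ^+ N in hN hp y1 y2 y3.
have S0 : 0 <= S by rewrite divr_ge0// ltW.
have aS : nm (a' - p) <= 3 * S by lra.
have bS : nm (b' - p) <= 3 * S by have := nmB a' b' p; rewrite (nmC b' a'); lra.
have cS : nm (c' - p) <= 3 * S by have := nmB a' c' p; lra.
have fe (w : C) : nm (w - p) <= 3 * S -> nm (f w - f p - (w - p) *: d) <= e' * (3 * S).
  move=> wS; have := ft (w - p) ltac:(lra).
  by rewrite addrCA subrr addr0 => /le_trans; apply; rewrite ler_wpM2l// ltW.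
have i1 := integral_affine_near fu x1 x2 aS bS fe.
have i2 := integral_affine_near fu x2 x3 bS cS fe.
have i3 := integral_affine_near fu x3 x1 cS aS fe.
set j1 := (_ *: _ + _) in i1; set j2 := (_ *: _ + _) in i2; set j3 := (_ *: _ + _) in i3.
have j0 : j1 + j2 + j3 = 0.
  by rewrite /j1 /j2 /j3; lmod; do ?split; field.
have eS : 0 <= e' * (3 * S) by rewrite mulr_ge0 ?(ltW e'0)//; lra.
have bnd : nm (triangle f a' b' c') <= 3 * S * (e' * (3 * S)).
  rewrite -[triangle _ _ _ _]subr0 -j0 /triangle.
  set k1 := integral f a' b' in i1 *; set k2 := integral f b' c' in i2 *.
  set k3 := integral f c' a' in i3 *.
  have -> : k1 + k2 + k3 - (j1 + j2 + j3) = (k1 - j1) + (k2 - j2) + (k3 - j3).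
    by lmod; do ?split; ring.
  have := nmD ((k1 - j1) + (k2 - j2)) (k3 - j3); have := nmD (k1 - j1) (k2 - j2).
  have z1 : nm (b' - a') * (e' * (3 * S)) <= S * (e' * (3 * S)).
    by rewrite ler_wpM2r// nmC.
  have z2 : nm (c' - b') * (e' * (3 * S)) <= S * (e' * (3 * S)).
    by rewrite ler_wpM2r// nmC.
  have z3 : nm (a' - c') * (e' * (3 * S)) <= S * (e' * (3 * S)).
    by rewrite ler_wpM2r// nmC.
  move: i1 i2 i3 z1 z2 z3; lra.
have p4 : (4 : R) ^+ N = 2 ^+ N * 2 ^+ N by rewrite -exprMn -natrM.
apply: (@le_trans _ _ (4 ^+ N * (3 * S * (e' * (3 * S))))).
  by rewrite ler_wpM2l// exprn_ge0.
have -> : 4 ^+ N * (3 * S * (e' * (3 * S))) = 9 * e' * s0 ^+ 2.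
  by rewrite p4 /S; field; rewrite gt_eqF.
have -> : 9 * e' * s0 ^+ 2 = e * (s0 ^+ 2 / (s0 ^+ 2 + 1)).
  by rewrite /e'; field; rewrite gt_eqF// ltr_wpDl// sqr_ge0.
rewrite ler_piMr ?(ltW e0)// ler_pdivrMr ?ltr_wpDl ?sqr_ge0//; lra.
Qed.

(** Second order expansions at a point. They are weaker than twice differentiability
    near the point, and they are what a primitive has at a point where the function
    is differentiable. *)
Definition jet2at f (z : C) (c1 c2 : X) := forall e : R, 0 < e -> exists2 t : R, 0 < t &
  forall h : C, nm h < t -> nm (f (z + h) - f z - h *: c1 - h ^+ 2 *: c2) <= e * nm h ^+ 2.

Definition jet2 f (z : C) := exists c1 c2, jet2at f z c1 c2.

Definition prim f (z : C) := integral f 0 z.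

Lemma primB f r r' (z h : C) : r < r' -> hol f r' -> nm z <= r -> nm (z + h) <= r ->
  prim f (z + h) - prim f z = integral f z (z + h).
Proof.
move=> rr' fh zr zhr; have fu := hol_ucont rr' fh.
have r0 : nm (0 : C) <= r by rewrite nm0 (le_trans (nm_ge0 _) zr).
have := goursat rr' fh r0 zr zhr.
rewrite /triangle (integral_rev fu r0 zhr) => h0; rewrite /prim.
apply/eqP; rewrite -subr_eq0 -oppr_eq0 -[X in _ == X]h0; apply/eqP.
by lmod; do ?split; ring.
Qed.

(** Integrate the first order expansion of [f] at [z] along the segment from [z] to
    [z + h]. *)
Lemma prim_jet2 f r z d : 0 < r -> hol f r -> nm z < r -> dif f z d ->
  jet2at (prim f) z (f z) (2^-1 *: d).
Proof.
move=> r0 fh zr fd e e0; have [t t0 ft] := fd e e0.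
pose r1 := (nm z + r) / 2.
have r1r : r1 < r by rewrite /r1; lra.
have zr1 : nm z < r1 by rewrite /r1; lra.
exists (Num.min t (r1 - nm z)); first by rewrite lt_min t0 subr_gt0.
move=> h; rewrite lt_min => /andP[ht hr].
have zhr : nm (z + h) <= r1 by have := nmD z h; lra.
rewrite (primB r1r fh (ltW zr1) zhr).
have := @integral_affine_near f r1 z d (e * nm h) (nm h) z (z + h) (hol_ucont r1r fh)
  (ltW zr1) zhr.
rewrite subrr nm0 (addrAC z) subrr add0r expr0n /= mul0r subr0 => /(_ (nm_ge0 _) (lexx _)).
move=> H; rewrite scalerA -addrA -opprD expr2 mulrCA -expr2; apply: H => w wh.
have := ft (w - z) (le_lt_trans wh ht); rewrite addrCA subrr addr0 => /le_trans; apply.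
by rewrite ler_wpM2l// ltW.
Qed.

Lemma jet2_dif f z c1 c2 : jet2at f z c1 c2 -> dif f z c1.
Proof.
move=> fj e e0; have [t t0 ft] := fj 1 ltr01.
have c0 : 0 < 1 + nm c2 by rewrite ltr_wpDr// nm_ge0.
exists (Num.min t (e / (1 + nm c2))); first by rewrite lt_min t0 divr_gt0.
move=> h; rewrite lt_min ltr_pdivlMr// => /andP[/ft]; rewrite mul1r => h1 h2.
have := nmDB (f (z + h) - f z - h *: c1) (h ^+ 2 *: c2); rewrite nmZ nmX.
have hh := nm_ge0 h.
have : nm h * (nm h * (1 + nm c2)) <= nm h * e by rewrite ler_wpM2l// ltW.
by rewrite expr2 in h1 *; lra.
Qed.

Lemma jet2D f g z c1 c2 k1 k2 : jet2at f z c1 c2 -> jet2at g z k1 k2 ->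
  jet2at (fun w => f w + g w) z (c1 + k1) (c2 + k2).
Proof.
move=> fj gj e e0.
have [|t t0 ft] := fj (e / 2); first lra.
have [|s s0 gs] := gj (e / 2); first lra.
exists (Num.min t s); first by rewrite lt_min t0.
move=> h; rewrite lt_min => /andP[/ft h1 /gs h2].
set a := f _ - _ - _ - _ in h1; set b := g _ - _ - _ - _ in h2.
have -> : f (z + h) + g (z + h) - (f z + g z) - h *: (c1 + k1) - h ^+ 2 *: (c2 + k2) = a + b.
  by rewrite /a /b; lmod; do ?split; ring.
have := nmD a b; lra.
Qed.

Lemma jet2Z c f z c1 c2 : jet2at f z c1 c2 ->
  jet2at (fun w => c *: f w) z (c *: c1) (c *: c2).
Proof.
move=> fj e e0.
have cc : 0 < nm c + 1 by rewrite ltr_wpDl// nm_ge0.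
have [|t t0 ft] := fj (e / (nm c + 1)); first by rewrite divr_gt0.
exists t => // h /ft.
set a := f _ - _ - _ - _ => h1.
have -> : c *: f (z + h) - c *: f z - h *: (c *: c1) - h ^+ 2 *: (c *: c2) = c *: a.
  by rewrite /a; lmod; do ?split; ring.
rewrite nmZ; have q0 : 0 <= e / (nm c + 1) * nm h ^+ 2.
  by rewrite mulr_ge0 ?sqr_ge0// divr_ge0// ltW.
apply: (@le_trans _ _ ((nm c + 1) * (e / (nm c + 1) * nm h ^+ 2))).
  by rewrite ler_pM ?nm_ge0//; lra.
have -> : (nm c + 1) * (e / (nm c + 1) * nm h ^+ 2) = e * nm h ^+ 2.
  by field; rewrite gt_eqF.
by [].
Qed.

Lemma jet2_shift f z k c1 c2 : jet2at f (z + k) c1 c2 ->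
  jet2at (fun w => f (w + k)) z c1 c2.
Proof.
move=> fj e /fj[t t0 ft]; exists t => // h /ft.
by rewrite (addrAC z k h).
Qed.

End Goursat.

(** * The maximum principle *)

Section MaximumPrinciple.
Variables (R : realType) (X : completeNormedModType R[i]).
Local Notation C := R[i].
Implicit Types f g : C -> X.
Ltac lmod := lincomb_with R[i] X.

Lemma sqr_i : ('i : C) ^+ 2 = -1.
Proof. by apply/eqP;
  rewrite eq_complex /= !(mul0r, mulr0, mul1r, mulr1, addr0, subr0, add0r, sub0r, oppr0) !eqxx. Qed.

Lemma nm_sq4 (z : C) (s : R) :
  nm (z + s%:C) ^+ 2 + nm (z - s%:C) ^+ 2 + nm (z + 'i * s%:C) ^+ 2 + nm (z - 'i * s%:C) ^+ 2
  = 4 * nm z ^+ 2 + 4 * s ^+ 2.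
Proof. by rewrite !nm_sqr; case: z => a b /=; ring. Qed.

(** If the bound fails, then [nm (f w) + eps * nm w ^+ 2] has an interior maximum for
    small [eps]. At the four points [z + s], [z - s], [z + 'i s], [z - 'i s] the terms
    of order one and two of [f] cancel in the mean, while the mean of [nm w ^+ 2]
    exceeds its value at [z] by [s ^+ 2]. *)
Lemma max_jet2 f r B : 0 < r -> (forall z : C, nm z <= r -> jet2 f z) ->
  (forall z : C, nm z = r -> nm (f z) <= B) ->
  forall z : C, nm z <= r -> nm (f z) <= B.
Proof.
move=> r0 fj fB z0 z0r; rewrite leNgt; apply/negP => Bz0.
pose eps := (nm (f z0) - B) / (2 * r ^+ 2).
have r20 : 0 < r ^+ 2 by rewrite exprn_gt0.
have eps0 : 0 < eps by rewrite divr_gt0 ?mulr_gt0// subr_gt0.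
have epsr : eps * r ^+ 2 = (nm (f z0) - B) / 2.
  by rewrite /eps; field; rewrite gt_eqF.
clearbody eps.
pose u (w : C) := nm (f w) + eps * nm w ^+ 2.
have [|z1 z1r z1M] := @disc_max R u r (ltW r0).
  move=> z zr e e0.
  have [c1 [c2 /jet2_dif/dif_ccont fc]] := fj z zr.
  have [|t t0 ft] := fc (e / 2); first lra.
  exists (Num.min t (e / (4 * eps * r))).
    by rewrite lt_min t0 divr_gt0// !mulr_gt0.
  move=> w wr; rewrite lt_min ltr_pdivlMr ?mulr_gt0// => /andP[/ft h1 h2].
  have h3 : `|nm (f w) - nm (f z)| < e / 2.
    apply/ltr_normlP; have := nmDB (f w) (f z); have := nmDB (f z) (f w).
    by rewrite (nmC (f z)); split; lra.
  have h4 : `|nm w - nm z| <= nm (w - z).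
    apply/ler_normlP; have := nmDB w z; have := nmDB z w.
    by rewrite (nmC z); split; lra.
  have -> : u w - u z = (nm (f w) - nm (f z)) + eps * ((nm w - nm z) * (nm w + nm z)).
    by rewrite /u; ring.
  apply: (le_lt_trans (ler_normD _ _)).
  rewrite [`|eps * _|]normrM (gtr0_norm eps0) normrM.
  rewrite (ger0_norm (addr_ge0 (nm_ge0 w) (nm_ge0 z))).
  have h5 : `|nm w - nm z| * (nm w + nm z) <= nm (w - z) * (2 * r).
    by rewrite ler_pM// ?addr_ge0 ?nm_ge0//; lra.
  have : eps * (`|nm w - nm z| * (nm w + nm z)) <= eps * (nm (w - z) * (2 * r)).
    by rewrite ler_wpM2l// ltW.
  lra.
have z1lt : nm z1 < r.
  rewrite lt_neqAle z1r andbT; apply/eqP => e1.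
  have := z1M z0 z0r; rewrite /u e1 epsr; have := fB _ e1.
  have : 0 <= eps * nm z0 ^+ 2 by rewrite mulr_ge0 ?sqr_ge0// ltW.
  lra.
have [c1 [c2 fj1]] := fj z1 z1r.
have [|t t0 ft] := fj1 (eps / 2); first lra.
pose s := Num.min t (r - nm z1) / 2.
have m0 : 0 < Num.min t (r - nm z1) by rewrite lt_min t0 subr_gt0.
have s0 : 0 < s by rewrite /s; lra.
have : s < Num.min t (r - nm z1) by rewrite /s; lra.
rewrite lt_min => /andP[st sr].
have ns : nm (s%:C : C) = s by rewrite nmR gtr0_norm.
have nsi : nm ('i * s%:C : C) = s by rewrite nmM nm_i mul1r.
have pt (h : C) : nm h = s -> nm (f (z1 + h)) <= u z1 - eps * nm (z1 + h) ^+ 2.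
  move=> hs; have : nm (z1 + h) <= r by have := nmD z1 h; lra.
  by move=> /z1M; rewrite /u; lra.
have jt (h : C) : nm h = s -> nm (f (z1 + h) - f z1 - h *: c1 - h ^+ 2 *: c2) <= eps / 2 * s ^+ 2.
  by move=> hs; have := ft h; rewrite hs => /(_ st).
have p1 := pt _ ns; have j1 := jt _ ns.
have p2 := pt (- s%:C) (etrans (nmN _) ns).
have j2 := jt (- s%:C) (etrans (nmN _) ns).
have p3 := pt _ nsi; have j3 := jt _ nsi.
have p4 := pt (- ('i * s%:C)) (etrans (nmN _) nsi).
have j4 := jt (- ('i * s%:C)) (etrans (nmN _) nsi).
rewrite sqrrN in j2; rewrite exprMn sqr_i mulN1r in j3; rewrite sqrrN exprMn sqr_i mulN1r in j4.
set a1 := f (z1 + s%:C) in p1 j1; set a2 := f (z1 - s%:C) in p2 j2.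
set a3 := f (z1 + 'i * s%:C) in p3 j3; set a4 := f (z1 - 'i * s%:C) in p4 j4.
set b1 := _ - _ in j1; set b2 := _ - _ in j2; set b3 := _ - _ in j3; set b4 := _ - _ in j4.
have E : 4 *: f z1 = a1 + a2 + a3 + a4 - (b1 + b2 + b3 + b4).
  by rewrite /b1 /b2 /b3 /b4; lmod; do ?split; ring.
have := nm_sq4 z1 s => S4.
have n4 : 4 * nm (f z1) <= nm a1 + nm a2 + nm a3 + nm a4 + (nm b1 + nm b2 + nm b3 + nm b4).
  have -> : 4 * nm (f z1) = nm (4 *: f z1) by rewrite nmZ nm_nat.
  rewrite E (le_trans (nmD _ _))// nmN.
  rewrite lerD// !(le_trans (nmD _ _))// ?lerD2r ?(le_trans (nmD _ _))// ?lerD2r ?nmD//.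
have s20 : 0 < eps * s ^+ 2 by rewrite mulr_gt0// exprn_gt0.
have Su : eps * (nm (z1 + s%:C) ^+ 2 + nm (z1 - s%:C) ^+ 2 + nm (z1 + 'i * s%:C) ^+ 2
   + nm (z1 - 'i * s%:C) ^+ 2) = eps * (4 * nm z1 ^+ 2 + 4 * s ^+ 2) by rewrite S4.
rewrite /u in p1 p2 p3 p4.
clear -j1 j2 j3 j4 p1 p2 p3 p4 n4 s20 Su; lra.
Qed.

(** Difference quotients of primitives of [f] have second order expansions and
    approximate [f] uniformly on smaller discs. *)
Definition dquot (G : C -> X) (h z : C) : X := h^-1 *: (G (z + h) - G z).

Lemma dquot_prim_near f r r' : 0 < r -> r < r' -> hol f r' -> forall e : R, 0 < e ->
  exists2 t : R, 0 < t & forall h : C, h != 0 -> nm h < t -> forall z : C, nm z <= r ->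
    nm (dquot (prim f) h z - f z) <= e.
Proof.
move=> r0 rr' fh e e0.
have r1r : (r + r') / 2 < r' by lra.
have fu := hol_ucont r1r fh.
have [t t0 ft] := fu _ e0.
exists (Num.min t ((r' - r) / 2)); first by rewrite lt_min t0; lra.
move=> h h0; rewrite lt_min => /andP[ht hr] z zr.
have zr1 : nm z <= (r + r') / 2 by lra.
have zhr1 : nm (z + h) <= (r + r') / 2 by have := nmD z h; lra.
rewrite /dquot (primB r1r fh zr1 zhr1).
have := @integral_near _ _ f _ fu (fun w => nm (w - z) <= nm h) (fun=> f z) (h *: f z) e z (z + h) zr1 zhr1
  (@midconvex_ball R z (nm h)).
rewrite subrr nm0 (addrAC z) subrr add0r => /(_ (nm_ge0 _) (lexx _)) H.
have {}H : nm (integral f z (z + h) - h *: f z) <= nm h * e.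
  apply: H => [|w wh].
    move=> k k0; exists 0%N => n _; rewrite dyadic_sum_cst (addrAC z) subrr add0r subrr nm0//.
  apply/ltW/ft => //; last by lra.
  by have := nmDB w z; lra.
have -> : h^-1 *: integral f z (z + h) - f z = h^-1 *: (integral f z (z + h) - h *: f z).
  by rewrite scalerBr scalerK.
by rewrite nmZ nmV ler_pdivrMl// nm_gt0.
Qed.

Lemma dquot_prim_jet2 f r (h z : C) d k : 0 < r -> hol f r -> nm z < r -> nm (z + h) < r ->
  dif f z d -> dif f (z + h) k ->
  jet2at (dquot (prim f) h) z (h^-1 *: (f (z + h) - f z)) (h^-1 *: (2^-1 *: k - 2^-1 *: d)).
Proof.
move=> r0 fh zr zhr fd fk; apply: jet2Z.
have j1 := jet2_shift (prim_jet2 r0 fh zhr fk).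
have j2 := jet2Z (-1) (prim_jet2 r0 fh zr fd).
have := jet2D j1 j2; rewrite !scaleN1r => H e /H[t t0 ft]; exists t => // w wt.
by have := ft w wt; rewrite !scaleN1r.
Qed.

Lemma max_hol f r r' B : 0 < r -> r < r' -> hol f r' ->
  (forall z : C, nm z = r -> nm (f z) <= B) ->
  forall z : C, nm z <= r -> nm (f z) <= B.
Proof.
move=> r0 rr' fh fB z zr; apply/ler_addgt0Pr => e e0.
have [|t t0 ft] := dquot_prim_near r0 rr' fh (e := e / 2); first lra.
pose s := Num.min t (r' - r) / 2.
have m0 : 0 < Num.min t (r' - r) by rewrite lt_min t0 subr_gt0.
have s0 : 0 < s by rewrite /s; lra.
have : s < Num.min t (r' - r) by rewrite /s; lra.
rewrite lt_min => /andP[st sr].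
have ns : nm (s%:C : C) = s by rewrite nmR gtr0_norm.
have sC0 : s%:C != 0 :> C by apply/eqP => e1; rewrite e1 nm0 in ns; lra.
have st' : nm (s%:C : C) < t by rewrite ns.
have near_ := ft _ sC0 st'.
have : nm (dquot (prim f) s%:C z) <= B + e / 2.
  apply: (max_jet2 r0 _ _ zr) => w wr.
    have [|d fd] := fh w; first lra.
    have [|k fk] := fh (w + s%:C); first by have := nmD w s%:C; lra.
    exists (s%:C^-1 *: (f (w + s%:C) - f w)), (s%:C^-1 *: (2^-1 *: k - 2^-1 *: d)).
    apply: (dquot_prim_jet2 (lt_trans r0 rr') fh) => //; first lra.
    by have := nmD w s%:C; lra.
  have h1 := near_ w ltac:(lra); have h2 := fB w wr.
  have := nmDB (dquot (prim f) s%:C w) (f w); lra.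
have := near_ z zr; have := nmDB (f z) (dquot (prim f) s%:C z); rewrite (nmC (f z)); lra.
Qed.

End MaximumPrinciple.

(** * Schwarz estimates and division by the variable *)

Section Division.
Variables (R : realType) (X : completeNormedModType R[i]).
Local Notation C := R[i].
Implicit Types f g : C -> X.
Ltac lmod := lincomb_with R[i] X.

(** The value [d] at [0] stands for the derivative of [f] at [0]. *)
Definition quot f (d : X) (z : C) : X := if z == 0 then d else z^-1 *: (f z - f 0).

Lemma quotE f d z : quot f d z = if z == 0 then d else z^-1 *: (f z - f 0).
Proof. by []. Qed.

Lemma quotK f d z : f z = f 0 + z *: quot f d z.
Proof.
rewrite /quot; case: eqP => [->|/eqP z0]; first by rewrite scale0r addr0.
by rewrite scalerA divff// scale1r addrC subrK.
Qed.

Lemma quot_dif_off f d z k : z != 0 -> dif f z k -> exists k', dif (quot f d) z k'.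
Proof.
move=> z0 fk; have n0 := nm_gt0 z0.
have := difM (sdif_inv z0) (difD fk (dif_cst (- f 0) z)).
set d' := _ + _ => H; exists d'; apply: dif_local H; exists (nm z) => // w wz.
rewrite /quot ifF//; apply/negP => /eqP w0; move: wz.
by rewrite w0 sub0r nmN ltxx.
Qed.

Lemma quot_jet2 f c1 c2 : jet2at f 0 c1 c2 -> dif (quot f c1) 0 c2.
Proof.
move=> fj e e0; have [t t0 ft] := fj e e0; exists t => // h /ft.
rewrite !add0r /quot eqxx; case: eqP => [->|/eqP h0] H.
  by rewrite subrr scale0r subrr !nm0 mulr0.
have -> : h^-1 *: (f h - f 0) - c1 - h *: c2 = h^-1 *: (f h - f 0 - h *: c1 - h ^+ 2 *: c2).
  by lmod; do ?split; field.
rewrite nmZ nmV ler_pdivrMl ?nm_gt0// (le_trans H)// expr2 mulrCA; lra.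
Qed.

Lemma quot_jet2_hol f r c1 c2 : jet2at f 0 c1 c2 -> hol f r -> hol (quot f c1) r.
Proof.
move=> fj fh z zr; have [->|z0] := eqVneq z 0; first by exists c2; exact: quot_jet2.
by have [k /(quot_dif_off c1 z0)] := fh z zr.
Qed.

Lemma dif_comp f a z b d : sdif a z b -> dif f (a z) d ->
  dif (fun w => f (a w)) z (b *: d).
Proof.
move=> ab fd e e0.
pose K := nm b + nm d + 2.
have bz := nm_ge0 b; have dz := nm_ge0 d.
have K0 : 0 < K by rewrite /K; lra.
pose e' := Num.min 1 (e / K).
have e'0 : 0 < e' by rewrite lt_min ltr01 divr_gt0.
have e'1 : e' <= 1 by rewrite ge_min lexx.
have e'K : e' * K <= e by rewrite -ler_pdivlMr// ge_min lexx orbT.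
have [t t0 ft] := fd _ e'0; have [s s0 as_] := ab _ e'0.
exists (Num.min s (t / (nm b + 1))); first by rewrite lt_min s0 divr_gt0//; lra.
move=> h; rewrite lt_min => /andP[/as_ h1]; rewrite ltr_pdivlMr; last lra.
move=> h2; pose k := a (z + h) - a z.
have hh := nm_ge0 h.
have kh : nm k <= (nm b + e') * nm h.
  by have := nmDB k (h * b); rewrite nmM /k; lra.
have kt : nm k < t.
  apply: (le_lt_trans kh); apply: le_lt_trans h2.
  by rewrite mulrC ler_wpM2l//; lra.
have := ft k kt; rewrite {1}/k (addrCA (a z)) subrr addr0 => H.
have -> : f (a (z + h)) - f (a z) - h *: (b *: d) = (f (a (z + h)) - f (a z) - k *: d) + (k - h * b) *: d.
  by rewrite /k; lmod; do ?split; ring.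
rewrite (le_trans (nmD _ _))// nmZ.
have p1 : nm (k - h * b) * nm d <= e' * nm h * nm d by rewrite ler_wpM2r.
have p2 : e' * nm k <= e' * ((nm b + e') * nm h) by rewrite ler_wpM2l// ltW.
have p3 : e' * nm h * (nm b + e' + nm d) <= e' * nm h * K.
  have KK : nm b + e' + nm d <= K by rewrite /K; lra.
  by rewrite ler_wpM2l// mulr_ge0// ltW.
have p4 : e' * K * nm h <= e * nm h by rewrite ler_wpM2r.
lra.
Qed.

Lemma sdif_sqr (z : C) : sdif (fun w => w ^+ 2) z (2 * z).
Proof.
have := sdifM (sdif_id z) (sdif_id z); rewrite /= => H.
have -> : 2 * z = z * 1 + 1 * z by ring.
by move=> e /H[t t0 ft]; exists t => // h /ft; rewrite !expr2.
Qed.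

(** The remainder of [f] at order one, evaluated at [m ^+ 2] and divided by [m ^+ 3].
    Thanks to the substitution a second order expansion of [f] leaves a factor [m],
    so that this quotient is differentiable at [0]. *)
Definition kap f (c1 : X) (m : C) : X :=
  if m == 0 then 0 else (m ^+ 3)^-1 *: (f (m ^+ 2) - f 0 - m ^+ 2 *: c1).

Lemma kap_hol f r c1 c2 (s : R) : jet2at f 0 c1 c2 -> hol f r -> s ^+ 2 <= r -> hol (kap f c1) s.
Proof.
move=> fj fh sr z zs; have [->|z0] := eqVneq z 0.
  exists c2 => e e0; have [t t0 ft] := fj e e0.
  exists (Num.min 1 t); first by rewrite lt_min ltr01.
  move=> h; rewrite lt_min => /andP[h1 ht].
  rewrite !add0r /kap eqxx; case: eqP => [->|/eqP h0].
    by rewrite scale0r !subr0 !nm0 mulr0.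
  have h2t : nm (h ^+ 2) < t.
    by rewrite nmX; have := nm_ge0 h; nra.
  have := ft _ h2t; rewrite add0r -exprM => H.
  have -> : (h ^+ 3)^-1 *: (f (h ^+ 2) - f 0 - h ^+ 2 *: c1) - 0 - h *: c2 =
    (h ^+ 3)^-1 *: (f (h ^+ 2) - f 0 - h ^+ 2 *: c1 - (h ^+ 4) *: c2).
    by lmod; do ?split; field.
  rewrite nmZ nmV ler_pdivrMl ?nm_gt0 ?expf_neq0// (le_trans H)//.
  by rewrite !nmX -exprM [leRHS]mulrCA -exprSr.
have zr : nm (z ^+ 2) < r.
  by rewrite nmX; apply: lt_le_trans sr; have := nm_ge0 z; nra.
have [d fd] := fh _ zr.
have z30 : z ^+ 3 != 0 by rewrite expf_neq0.
have h1 : dif (fun w => f (w ^+ 2) - f 0 - w ^+ 2 *: c1) z ((2 * z) *: d + 0 + - ((2 * z) *: c1)).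
  apply: difD; first exact: difD (dif_comp (sdif_sqr z) fd) (dif_cst _ _).
  have := difZ (-1) (difM (sdif_sqr z) (dif_cst c1 z)).
  rewrite scaler0 add0r scaleN1r => H e /H[t t0 ft]; exists t => // h /ft.
  by rewrite !scaleN1r.
have h2 : exists b, sdif (fun w : C => (w ^+ 3)^-1) z b.
  have := sdifM (sdif_inv z0) (sdifM (sdif_inv z0) (sdif_inv z0)).
  set b := _ + _ => H; exists b => e /H[t t0 ft]; exists t => // h /ft.
  by rewrite /= -!invfM !exprS !expr0 !mulr1.
case: h2 => b hb; have := difM hb h1.
set d' := _ + _ => H; exists d'; apply: dif_local H; exists (nm z); first exact: nm_gt0.
move=> w wz; rewrite /kap ifF//; apply/negP => /eqP w0; move: wz.
by rewrite w0 sub0r nmN ltxx.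
Qed.

(** The maximum principle for [quot f c1] and for [kap f c1]. *)
Lemma schwarz_jet2 f r' s M c1 c2 : 0 < s -> s ^+ 2 < r' -> hol f r' -> jet2at f 0 c1 c2 ->
  (forall z : C, nm z <= s ^+ 2 -> nm (f z) <= M) ->
  nm c1 <= 2 * M / s ^+ 2 /\
  forall m : C, nm m <= s -> nm (f (m ^+ 2) - f 0 - m ^+ 2 *: c1) * s ^+ 3 <= 4 * M * nm m ^+ 3.
Proof.
move=> s0 sr fh fj fM.
have s20 : 0 < s ^+ 2 by rewrite exprn_gt0.
have s30 : 0 < s ^+ 3 by rewrite exprn_gt0.
have f0M : nm (f 0) <= M by apply: fM; rewrite nm0 ltW.
have M0 : 0 <= M by exact: le_trans (nm_ge0 _) f0M.
have h1 : nm c1 <= 2 * M / s ^+ 2.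
  have := max_hol s20 sr (quot_jet2_hol fj fh) (B := 2 * M / s ^+ 2) _ (z := 0).
  rewrite quotE eqxx nm0; apply; last exact: ltW.
  move=> z zs; have z0 : z != 0 by apply/eqP => z0; rewrite z0 nm0 in zs; lra.
  rewrite quotE (negbTE z0) nmZ nmV zs mulrC ler_pM2r ?invr_gt0//.
  have := fM z ltac:(lra); have := nmD (f z) (- f 0); rewrite nmN; lra.
split => // m ms.
have [->|m0] := eqVneq m 0.
  by rewrite !expr2 mulr0 subrr scale0r subrr !nm0 mul0r expr0n /= mulr0.
pose s' := Num.sqrt r'.
have r'0 : 0 < r' by lra.
have ss' : s < s'.
  by rewrite -(ltr_pXn2r (n := 2)) ?nnegrE ?sqrtr_ge0 ?ltW// sqr_sqrtr// ltW.
have := max_hol s0 ss' (kap_hol (s := s') fj fh _) (B := 4 * M / s ^+ 3) _ ms.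
rewrite sqr_sqrtr ?(ltW r'0)// => /(_ (lexx _)).
rewrite /kap (negbTE m0) nmZ nmV nmX ler_pdivrMl ?exprn_gt0 ?nm_gt0//.
rewrite mulrA ler_pdivlMr// (mulrC (nm m ^+ 3)); apply => z zs.
have z0 : z != 0 by apply/eqP => z0; rewrite z0 nm0 in zs; lra.
rewrite (negbTE z0) nmZ nmV nmX zs mulrC ler_pM2r ?invr_gt0//.
have z2 : nm (z ^+ 2) <= s ^+ 2 by rewrite nmX zs.
have := fM _ z2; have := nmD (f (z ^+ 2) - f 0) (- (z ^+ 2 *: c1)).
have := nmD (f (z ^+ 2)) (- f 0); rewrite !nmN nmZ nmX zs.
have : s ^+ 2 * nm c1 <= s ^+ 2 * (2 * M / s ^+ 2) by rewrite ler_wpM2l// ltW.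
have -> : s ^+ 2 * (2 * M / s ^+ 2) = 2 * M by field; rewrite gt_eqF.
lra.
Qed.

Lemma small_point (t : R) : 0 < t -> exists2 h : C, h != 0 & nm h < t.
Proof.
move=> t0; have t2 : 0 < t / 2 by lra.
have e1 : nm ((t / 2)%:C : C) = t / 2 by rewrite nmR gtr0_norm.
exists (t / 2)%:C; last by rewrite e1; lra.
by apply/eqP => e2; rewrite e2 nm0 in e1; lra.
Qed.

(** Passage to the limit in an inequality whose error is a multiple of [e]. *)
Lemma le_eps (x y c : R) : (forall e, 0 < e -> x <= y + e * c) -> x <= y.
Proof.
move=> H; apply/ler_addgt0Pr => e e0.
have c0 : 0 < `|c| + 1 by rewrite ltr_wpDl.
apply: (le_trans (H (e / (`|c| + 1)) (divr_gt0 e0 c0))).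
rewrite lerD2l mulrAC ler_pdivrMr// ler_wpM2l ?(ltW e0)//.
by have := ler_norm c; lra.
Qed.

(** The approximant is a difference quotient of a primitive of [f]. *)
Lemma jet2_approx f r r1 d e : 0 < r1 -> r1 < r -> hol f r -> dif f 0 d -> 0 < e ->
  exists u c1 c2, [/\ jet2at u 0 c1 c2, hol u r1,
    forall z : C, nm z <= r1 -> nm (u z - f z) <= e & nm (c1 - d) <= e].
Proof.
move=> r10 r1r fh fd e0; have r0 : 0 < r by lra.
have [t t0 ft] := dquot_prim_near r10 r1r fh e0.
have [t' t'0 ft'] := fd _ e0.
have [|h h0] := @small_point (Num.min (Num.min t t') (r - r1)).
  by rewrite !lt_min t0 t'0 subr_gt0.
rewrite !lt_min -andbA => /and3P[ht ht' hr].
have [k fk] : exists k, dif f (0 + h) k by apply: fh; rewrite add0r; lra.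
exists (dquot (prim f) h), (h^-1 *: (f (0 + h) - f 0)), (h^-1 *: (2^-1 *: k - 2^-1 *: d)).
split.
- by apply: (dquot_prim_jet2 r0 fh) => //; rewrite ?add0r ?nm0//; lra.
- move=> z zr1; have [|d1 fd1] := fh z; first lra.
  have [|d2 fd2] := fh (z + h); first by have := nmD z h; lra.
  exists (h^-1 *: (f (z + h) - f z)); apply: jet2_dif.
  apply: (dquot_prim_jet2 r0 fh) fd1 fd2; first lra.
  by have := nmD z h; lra.
- exact: ft.
- have -> : h^-1 *: (f (0 + h) - f 0) - d = h^-1 *: (f (0 + h) - f 0 - h *: d).
    by rewrite [RHS]scalerBr scalerA mulVf// scale1r.
  by rewrite nmZ nmV ler_pdivrMl ?nm_gt0// mulrC ft'.
Qed.

(** The bounds of [schwarz_jet2] depend only on a bound of the function, hence pass to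
    the limit along [jet2_approx]. *)
Lemma schwarz f r' s M d : 0 < s -> s ^+ 2 < r' -> hol f r' -> dif f 0 d ->
  (forall z : C, nm z < r' -> nm (f z) <= M) ->
  nm d <= 2 * M / s ^+ 2 /\
  forall m : C, nm m <= s -> nm (f (m ^+ 2) - f 0 - m ^+ 2 *: d) * s ^+ 3 <= 4 * M * nm m ^+ 3.
Proof.
move=> s0 sr fh fd fM.
have s20 : 0 < s ^+ 2 by rewrite exprn_gt0.
have s30 : 0 < s ^+ 3 by rewrite exprn_gt0.
pose r1 := (s ^+ 2 + r') / 2.
have sr1 : s ^+ 2 < r1 by rewrite /r1; lra.
have r1r' : r1 < r' by rewrite /r1; lra.
have r10 : 0 < r1 by lra.
have apx e : 0 < e -> exists u c1, [/\
    nm c1 <= 2 * (M + e) / s ^+ 2,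
    forall m : C, nm m <= s -> nm (u (m ^+ 2) - u 0 - m ^+ 2 *: c1) * s ^+ 3 <= 4 * (M + e) * nm m ^+ 3,
    forall z : C, nm z <= s ^+ 2 -> nm (u z - f z) <= e & nm (c1 - d) <= e].
  move=> e0; have [u [c1 [c2 [uj uh uf cd]]]] := jet2_approx r10 r1r' fh fd e0.
  have [|h1 h2] := schwarz_jet2 (M := M + e) s0 sr1 uh uj.
    move=> z zs; have := uf z ltac:(lra); have := fM z ltac:(lra).
    have := nmDB (u z) (f z); lra.
  by exists u, c1; split => // z zs; apply: uf; lra.
split.
  apply: (@le_eps _ _ (2 / s ^+ 2 + 1)) => e /apx[u [c1 [h1 _ _ h2]]].
  have := nmDB d c1; rewrite (nmC d).
  have -> : 2 * M / s ^+ 2 + e * (2 / s ^+ 2 + 1) = 2 * (M + e) / s ^+ 2 + e by ring.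
  lra.
move=> m ms; have nm0' := nm_ge0 m.
apply: (@le_eps _ _ (4 * nm m ^+ 3 + (2 + s ^+ 2) * s ^+ 3)) => e e0.
have [u [c1 [_ h2 h3 h4]]] := apx e e0.
have m2 : nm m ^+ 2 <= s ^+ 2 by rewrite ler_pXn2r ?nnegrE// ltW.
have {h2} := h2 m ms; set a := u _ - _ - _.
have k1 := h3 (m ^+ 2) ltac:(by rewrite nmX).
have k2 := h3 0 ltac:(by rewrite nm0 ltW).
set b := f _ - _ - _.
have k3 : nm (b - a) <= (2 + s ^+ 2) * e.
  have -> : b - a = - (u (m ^+ 2) - f (m ^+ 2)) + (u 0 - f 0) + m ^+ 2 *: (c1 - d).
    by rewrite /a /b; lmod; do ?split; ring.
  have := nmD (- (u (m ^+ 2) - f (m ^+ 2)) + (u 0 - f 0)) (m ^+ 2 *: (c1 - d)).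
  have := nmD (- (u (m ^+ 2) - f (m ^+ 2))) (u 0 - f 0).
  rewrite nmN nmZ nmX.
  have : nm m ^+ 2 * nm (c1 - d) <= s ^+ 2 * e.
    by rewrite ler_pM ?sqr_ge0 ?nm_ge0.
  lra.
have := nmDB b a => k4 k5.
have : nm b * s ^+ 3 <= (nm a + (2 + s ^+ 2) * e) * s ^+ 3.
  by rewrite ler_pM2r//; lra.
lra.
Qed.

Lemma sqrt_exists (z : C) : exists m : C, m ^+ 2 = z.
Proof. by exists (sqrtC z); rewrite sqrtCK. Qed.

(** By [schwarz] applied to differences the derivatives at [0] of the approximants form
    a Cauchy sequence, and their remainders have a common bound. *)
Lemma weierstrass f r M : 0 < r -> (forall z : C, nm z < r -> nm (f z) <= M) ->
  (forall e, 0 < e -> exists2 g, hol g r & forall z : C, nm z < r -> nm (f z - g z) <= e) ->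
  exists d, dif f 0 d.
Proof.
move=> r0 fM fapx.
have [s s0 sr] : exists2 s, 0 < s & s ^+ 2 < r.
  exists (Num.sqrt (r / 2)); first by rewrite sqrtr_gt0; lra.
  by rewrite sqr_sqrtr; lra.
have s20 : 0 < s ^+ 2 by rewrite exprn_gt0.
have s30 : 0 < s ^+ 3 by rewrite exprn_gt0.
have n0 : nm (0 : C) < r by rewrite nm0.
have M0 : 0 <= M by apply: le_trans (fM 0 n0); rewrite nm_ge0.
have gex (n : nat) : exists gd : (C -> X) * X, [/\ hol gd.1 r, dif gd.1 0 gd.2 &
    forall z : C, nm z < r -> nm (f z - gd.1 z) <= n.+1%:R^-1].
  have [|g gh fg] := fapx n.+1%:R^-1; first by rewrite invr_gt0.
  by have [d gd] := gh 0 n0; exists (g, d).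
have [G GP] := choice gex.
have inv1 (n : nat) : n.+1%:R^-1 <= 1 :> R by rewrite invf_le1 ?ler1n.
have dd (m n : nat) : nm ((G m).2 - (G n).2) <= 2 * (m.+1%:R^-1 + n.+1%:R^-1) / s ^+ 2.
  have [gm dm fm] := GP m; have [gn dn fn] := GP n.
  have [] := @schwarz (fun z => (G m).1 z + -1 *: (G n).1 z) r s (m.+1%:R^-1 + n.+1%:R^-1)
     ((G m).2 + -1 *: (G n).2) s0 sr.
  - move=> z zr; have [a ga] := gm z zr; have [b gb] := gn z zr.
    by exists (a + -1 *: b); apply: difD => //; apply: difZ.
  - by apply: difD => //; apply: difZ.
  - move=> z zr; rewrite scaleN1r; have := nmB (f z) ((G m).1 z) ((G n).1 z).
    rewrite (nmC ((G m).1 z) (f z)); have := fm z zr; have := fn z zr.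
    move: (_^-1) (_^-1) => p q; lra.
  - by rewrite scaleN1r.
have [d dlim] : exists d, slim (fun n => (G n).2) d.
  apply: cauchy_slim => e e0.
  have [|N hN] := @inv_small R (e * s ^+ 2 / 4); first by rewrite !divr_gt0// mulr_gt0.
  exists N => m n Nm Nn; apply: le_lt_trans (dd m n) _.
  rewrite ltr_pdivrMr//; have := hN _ Nm; have := hN _ Nn.
  move: (m.+1%:R^-1) (n.+1%:R^-1) => p q; lra.
exists d.
have key (m : C) : nm m <= s -> nm (f (m ^+ 2) - f 0 - m ^+ 2 *: d) * s ^+ 3 <= 4 * (M + 1) * nm m ^+ 3.
  move=> ms; have nm0' := nm_ge0 m.
  apply: (@le_eps _ _ ((2 + nm m ^+ 2) * s ^+ 3)) => e e0.
  have [N1 hN1] := dlim e e0; have [N2 hN2] := @inv_small R e e0.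
  pose n := maxn N1 N2.
  have {hN1} d1 := hN1 n (leq_maxl _ _); have {hN2} d2 := hN2 n (leq_maxr _ _).
  have [gh gd fg] := GP n.
  have [|_ /(_ m ms)] := schwarz (M := M + 1) s0 sr gh gd.
    move=> z zr; have := fM z zr; have := fg z zr; have := inv1 n.
    by have := nmDB ((G n).1 z) (f z); rewrite (nmC _ (f z)); move: (_^-1) => q; lra.
  set a := (G n).1 _ - _ - _; set b := f _ - _ - _.
  have m2 : nm (m ^+ 2) < r.
    by rewrite nmX; apply: le_lt_trans sr; rewrite ler_pXn2r ?nnegrE// ltW.
  have k1 := fg _ m2; have k2 := fg 0 n0.
  have k3 : nm (b - a) <= (2 + nm m ^+ 2) * e.
    have -> : b - a = (f (m ^+ 2) - (G n).1 (m ^+ 2)) - (f 0 - (G n).1 0) + m ^+ 2 *: ((G n).2 - d).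
      by rewrite /a /b; lmod; do ?split; ring.
    have := nmD ((f (m ^+ 2) - (G n).1 (m ^+ 2)) - (f 0 - (G n).1 0)) (m ^+ 2 *: ((G n).2 - d)).
    have := nmD (f (m ^+ 2) - (G n).1 (m ^+ 2)) (- (f 0 - (G n).1 0)).
    rewrite nmN nmZ nmX.
    have : nm m ^+ 2 * nm ((G n).2 - d) <= nm m ^+ 2 * e.
      by rewrite ler_wpM2l ?sqr_ge0// ltW.
    move: (_^-1) d2 k1 k2 => q d2 k1 k2; lra.
  have := nmDB b a => k4 k5.
  have : nm b * s ^+ 3 <= (nm a + (2 + nm m ^+ 2) * e) * s ^+ 3.
    by rewrite ler_pM2r//; lra.
  lra.
move=> e e0; pose t := Num.min s (e * s ^+ 3 / (4 * (M + 1))).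
have M1 : 0 < 4 * (M + 1) by lra.
have t0 : 0 < t by rewrite lt_min s0 divr_gt0// mulr_gt0.
exists (t ^+ 2); first by rewrite exprn_gt0.
move=> h; have [m <-] := sqrt_exists h; rewrite add0r nmX.
rewrite ltr_pXn2r ?nnegrE ?nm_ge0 ?(ltW t0)// lt_min ltr_pdivlMr// => /andP[ms me].
have := key m (ltW ms) => k; rewrite -(ler_pM2r s30) (le_trans k)//.
rewrite exprSr; have : nm m ^+ 2 * (nm m * (4 * (M + 1))) <= nm m ^+ 2 * (e * s ^+ 3).
  by rewrite ler_wpM2l ?sqr_ge0// ltW.
lra.
Qed.

(** Only the point [0] matters. There the quotient is a uniform limit of quotients of
    the functions of [jet2_approx], which are differentiable at [0]: the bound on the
    difference of two quotients is clear on a circle and extends inside by the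
    maximum principle. *)
Lemma quot_hol f r d : 0 < r -> hol f r -> dif f 0 d -> hol (quot f d) r.
Proof.
move=> r0 fh fd z zr; have [->|z0] := eqVneq z 0; last first.
  by have [k /(quot_dif_off d z0)] := fh z zr.
pose r1 := r / 2; have r10 : 0 < r1 by rewrite /r1; lra.
pose r2 := r1 / 2; have r20 : 0 < r2 by rewrite /r2; lra.
have r1r : r1 < r by rewrite /r1; lra.
have r2r1 : r2 < r1 by rewrite /r2; lra.
have apx e : 0 < e -> exists g, hol g r1 /\
    forall z : C, nm z <= r2 -> nm (quot f d z - g z) <= e.
  move=> e0.
  pose w := e * r2 / 4; have w0 : 0 < w by rewrite /w divr_gt0// mulr_gt0.
  have [u [c1 [c2 [uj uh uf cd]]]] := jet2_approx r10 r1r fh fd w0.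
  exists (quot u c1); split; first exact: quot_jet2_hol uj uh.
  move=> y yr.
  (* The quotient of [f] is not yet known to obey the maximum principle, which is
     therefore applied to the difference of [quot u c1] and of a much closer
     approximant [g']. *)
  have step e' : 0 < e' -> exists2 g', (forall x : C, nm x <= r1 -> x != 0 -> nm (quot f d x - g' x) <= 2 * e' / nm x)
      & nm (d - g' 0) <= e' /\ hol g' r1.
    move=> e'0; have [u' [c1' [c2' [uj' uh' uf' cd']]]] := jet2_approx r10 r1r fh fd e'0.
    exists (quot u' c1'); last by rewrite /quot eqxx nmC; split=> //; exact: quot_jet2_hol uj' uh'.
    move=> x xr x0; rewrite /quot (negbTE x0) -scalerBr nmZ nmV mulrC.
    rewrite ler_pM2r ?invr_gt0 ?nm_gt0//.
    have -> : f x - f 0 - (u' x - u' 0) = (u' 0 - f 0) - (u' x - f x).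
      by lmod; do ?split; ring.
    have := nmD (u' 0 - f 0) (- (u' x - f x)); rewrite nmN.
    have := uf' x xr; have := uf' 0; rewrite nm0 => /(_ (ltW r10)); lra.
  have bd e' : 0 < e' -> nm (quot f d y - quot u c1 y) <= e + e' * (2 / r2 + (if y == 0 then 1 else 2 / nm y)).
    move=> e'0; have [g' g'1 [g'2 g'h]] := step e' e'0.
    have D x : nm x = r2 -> nm (g' x + -1 *: quot u c1 x) <= e / 2 + e' * (2 / r2).
      move=> xr; have x0 : x != 0 by apply/eqP => x0; rewrite x0 nm0 in xr; lra.
      have xr1 : nm x <= r1 by lra.
      have k1 := g'1 x xr1 x0.
      have k2 : nm (quot f d x - quot u c1 x) <= e / 2.
        rewrite /quot (negbTE x0) -scalerBr nmZ nmV xr ler_pdivrMl//.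
        have -> : f x - f 0 - (u x - u 0) = (u 0 - f 0) - (u x - f x).
          by lmod; do ?split; ring.
        have := nmD (u 0 - f 0) (- (u x - f x)); rewrite nmN.
        have := uf x xr1; have := uf 0; rewrite nm0 => /(_ (ltW r10)); rewrite /w; lra.
      have := nmB (quot f d x) (g' x) (quot u c1 x); rewrite (nmC (g' x) (quot f d x)).
      by rewrite scaleN1r; move: k1 k2; rewrite xr; lra.
    have gh : hol (fun x => g' x + -1 *: quot u c1 x) r1.
      move=> x xr; have [a ga] := g'h x xr; have [b gb] := quot_jet2_hol uj uh xr.
      by exists (a + -1 *: b); apply: difD => //; apply: difZ.
    have := max_hol r20 r2r1 gh D yr; rewrite scaleN1r => k3.
    have k4 : nm (quot f d y - g' y) <= e' * (if y == 0 then 1 else 2 / nm y).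
      case: eqP => [->|/eqP y0]; first by rewrite mulr1 {1}/quot eqxx.
      by rewrite (le_trans (g'1 y _ y0)); lra.
    by have := nmB (g' y) (quot f d y) (quot u c1 y); lra.
  exact: le_eps bd.
have [g1 [g1h fg1]] := apx 1 ltr01.
have [M M0 gM] := hol_bounded r2r1 g1h.
apply: (@weierstrass _ r2 (M + 1)) => // [y yr|e /apx[g [gh fg]]].
  have := nmDB (quot f d y) (g1 y); have := gM y (ltW yr); have := fg1 y (ltW yr); lra.
exists g => [y yr|y yr]; first by apply: gh; lra.
exact/fg/ltW.
Qed.

End Division.

(** * Taylor coefficients and removable singularities in the plane *)

Section Taylor.
Variables (R : realType) (X : completeNormedModType R[i]).
Local Notation C := R[i].
Implicit Types f g : C -> X.

Definition der f z : X := get [set d | dif f z d].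

Lemma derP f z d : dif f z d -> der f z = d.
Proof. by move=> fd; exact: dif_uniq (@getI _ [set d | dif f z d] d fd) fd. Qed.

Lemma hol_der f r z : hol f r -> nm z < r -> dif f z (der f z).
Proof. by move=> fh /fh[d fd]; rewrite (derP fd). Qed.

(** The Taylor remainder of order [n] divided by [z ^+ n]; its value at [0] is the
    Taylor coefficient. *)
Fixpoint tquot f n : C -> X :=
  if n is m.+1 then quot (tquot f m) (der (tquot f m) 0) else f.

Definition tcoef f n : X := tquot f n 0.

Lemma tquot_hol f r n : 0 < r -> hol f r -> hol (tquot f n) r.
Proof.
move=> r0 fh; elim: n => [//|n ih] /=; apply: quot_hol => //.
by apply: (hol_der ih); rewrite nm0.
Qed.

Lemma taylorE f n z :
  f z = \sum_(k < n) z ^+ k *: tcoef f k + z ^+ n *: tquot f n z.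
Proof.
elim: n => [|n ih]; first by rewrite big_ord0 add0r expr0 scale1r.
rewrite {1}ih big_ord_recr /= -addrA; congr (_ + _).
by rewrite {1}(quotK (tquot f n) (der (tquot f n) 0) z) scalerDr scalerA -exprSr.
Qed.

(** Roots of unity of order a power of two are obtained by repeated square roots. *)
Lemma unity_root m : exists w : C, w ^+ (2 ^ m) = -1.
Proof.
elim: m => [|m [w hw]]; first by exists (-1); rewrite expn0 expr1.
by have [v hv] := sqrt_exists w; exists v; rewrite expnS exprM hv.
Qed.

Lemma unity_root_order m (w : C) p : w ^+ (2 ^ m) = -1 -> w ^+ p = 1 -> (2 ^ m.+1 %| p)%N.
Proof.
have odd_m1 q : (-1) ^+ q = 1 :> C -> ~~ odd q.
  rewrite -signr_odd; case: (odd q) => //=; rewrite expr1 => /eqP.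
  by rewrite eq_sym -subr_eq0 opprK -(natrD _ 1 1) pnatr_eq0.
elim: m w p => [|m ih] w p hw hp.
  by move: hw hp; rewrite expn0 expr1 => -> /odd_m1; rewrite expn1 dvdn2.
have hv : (w ^+ 2) ^+ (2 ^ m) = -1 by rewrite -exprM -expnS.
have /(ih _ _ hv)/dvdnP[s ps] : (w ^+ 2) ^+ p = 1 by rewrite exprAC hp expr1n.
have : (-1) ^+ s = 1 :> C by rewrite -hw -exprM mulnC -ps.
move=> /odd_m1; rewrite -dvdn2 => /dvdnP[q qs].
by rewrite ps qs -mulnA -expnS dvdn_mull.
Qed.

Lemma unity_root_nm m (w : C) : w ^+ (2 ^ m) = -1 -> nm w = 1.
Proof.
move=> hw; apply/eqP; rewrite -(@pexpr_eq1 _ _ (2 ^ m)) ?nm_ge0 ?expn_gt0//.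
by rewrite -nmX hw nmN nm1.
Qed.

Lemma unity_root_sum m (w : C) p : w ^+ (2 ^ m) = -1 -> (0 < p < 2 ^ m.+1)%N ->
  \sum_(j < 2 ^ m.+1) (w ^+ j) ^+ p = 0.
Proof.
move=> hw /andP[p0 pm].
have wp : w ^+ p != 1.
  by apply/eqP => /(unity_root_order hw)/(dvdn_leq p0); rewrite leqNgt pm.
have := subrX1 (w ^+ p) (2 ^ m.+1).
rewrite -exprM mulnC exprM expnSr exprM hw expr2 mulrNN mulr1 expr1n subrr => /esym/eqP.
rewrite mulf_eq0 subr_eq0 (negbTE wp) /= => /eqP; rewrite -[(_ ^ m * 2)%N]expnSr => h.
by rewrite -[RHS]h; apply: eq_bigr => j _; rewrite exprAC.
Qed.

Lemma hol_sum I (s : seq I) (F : I -> C -> X) r : (forall i, hol (F i) r) ->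
  hol (fun z => \sum_(i <- s) F i z) r.
Proof.
move=> Fh z zr; elim: s => [|i s [d ih]].
  exists 0; apply: (dif_local _ (dif_cst 0 z)); exists 1 => // w _.
  by rewrite big_nil.
have [k hk] := Fh i z zr; exists (k + d).
by apply: (dif_local _ (difD hk ih)); exists 1 => // w _; rewrite big_cons.
Qed.

(** Let [F z] be the mean of [tquot f n] over the points [w ^- j * z], for [w] a
    primitive root of unity of order [N > n]. The value at [0] is unchanged, and in
    [z ^+ n *: F z] the Taylor terms of degree less than [n] average out, so that
    [z ^+ n *: F z] is a mean of values of [f] up to factors of modulus one. The
    maximum principle for [F] then gives the sharp constant. *)
Lemma cauchy_estimate f r r' M n : 0 < r -> r < r' -> hol f r' ->
  (forall z : C, nm z = r -> nm (f z) <= M) -> nm (tcoef f n) * r ^+ n <= M.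
Proof.
move=> r0 rr' fh fM; have r'0 : 0 < r' by lra.
have [w hw] := unity_root n.
have nN : (n < 2 ^ n.+1)%N by rewrite ltnW// ltn_expl.
set N := (2 ^ n.+1)%N in nN *.
have N0 : N%:R != 0 :> C by rewrite pnatr_eq0 -lt0n (leq_trans _ nN).
have nw := unity_root_nm hw.
have w0 : w != 0 by apply/eqP => w0; move: nw; rewrite w0 nm0; lra.
have nwj j : nm (w ^+ j) = 1 by rewrite nmX nw expr1n.
pose F (z : C) := N%:R^-1 *: \sum_(j < N) tquot f n ((w ^+ j)^-1 * z).
have F0 : F 0 = tcoef f n.
  rewrite /F (eq_bigr (fun=> tcoef f n)) => [|j _]; last by rewrite mulr0.
  by rewrite sumr_const card_ord -[X in _ *: X]scaler_nat scalerA mulVf// scale1r.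
have Fh : hol F r'.
  have Gh (j : 'I_N) : hol (fun z => tquot f n ((w ^+ j)^-1 * z)) r'.
    move=> y yr; have [|d hd] := tquot_hol n r'0 fh (z := 0 + (w ^+ j)^-1 * y).
      by rewrite add0r nmM nmV nwj invr1 mul1r.
    exists ((w ^+ j)^-1 *: d); apply: (dif_local _ (dif_comp_affine hd)).
    by exists 1 => // v _; rewrite add0r.
  move=> z zr; have [d hd] := hol_sum (index_enum 'I_N) Gh zr.
  by exists (N%:R^-1 *: d); apply: difZ.
have Fr (z : C) : nm z = r -> nm (F z) <= M / r ^+ n.
  move=> zr; rewrite ler_pdivlMr ?exprn_gt0// -zr -nmX mulrC -nmZ.
  have z0 : z != 0 by apply/eqP => z0; move: zr; rewrite z0 nm0; lra.
  have -> : z ^+ n *: F z = N%:R^-1 *: \sum_(j < N) (w ^+ j) ^+ n *: f ((w ^+ j)^-1 * z).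
    rewrite /F scalerA mulrC -scalerA; congr (_ *: _); rewrite scaler_sumr.
    have E (j : 'I_N) : z ^+ n *: tquot f n ((w ^+ j)^-1 * z) =
       (w ^+ j) ^+ n *: f ((w ^+ j)^-1 * z) - \sum_(k < n) (w ^+ j) ^+ (n - k) *: (z ^+ k *: tcoef f k).
      have wj0 : w ^+ j != 0 by rewrite expf_neq0.
      rewrite [in RHS](taylorE f n) scalerDr scalerA -exprMn mulrA divff// mul1r.
      rewrite addrAC scaler_sumr -[LHS]add0r; congr (_ + _).
      rewrite -sumrB big1// => k _; rewrite scalerA scalerA exprMn mulrA exprVn.
      rewrite -expfB_cond ?(negbTE wj0) ?(ltnW (ltn_ord k))//.
        by rewrite subrr.
    rewrite (eq_bigr _ (fun j _ => E j)) sumrB [X in _ - X]exchange_big /=.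
    rewrite [X in _ - X]big1 ?subr0// => k _; rewrite -scaler_suml unity_root_sum ?scale0r//.
    rewrite subn_gt0 ltn_ord /=; apply: leq_ltn_trans nN; exact: leq_subr.
  rewrite nmZ nmV nm_nat ler_pdivrMl; last by rewrite ltr0n (leq_trans _ nN).
  apply: (le_trans (nm_sum _ _ _)).
  rewrite (@le_trans _ _ (\sum_(j < N) M))//; last by rewrite sumr_const card_ord mulr_natl.
  apply: ler_sum => j _; rewrite nmZ nmX nwj expr1n mul1r fM//.
  by rewrite nmM nmV nwj invr1 mul1r.
have := max_hol r0 rr' Fh Fr (z := 0); rewrite nm0 F0 => /(_ (ltW r0)).
by rewrite ler_pdivlMr// exprn_gt0.
Qed.

(** On the circle [z ^+ n *: tquot f n z] is [f z] minus [n] Taylor terms, each bounded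
    by [M]. *)
Lemma tquot_bound f r r' M n (z : C) : 0 < r -> r < r' -> hol f r' ->
  (forall z : C, nm z = r -> nm (f z) <= M) -> nm z <= r ->
  nm (tquot f n z) <= n.+1%:R * M / r ^+ n.
Proof.
move=> r0 rr' fh fM zr; have r'0 : 0 < r' by lra.
apply: (max_hol r0 rr' (tquot_hol n r'0 fh)) zr => w wr.
rewrite ler_pdivlMr ?exprn_gt0// -wr -nmX mulrC -nmZ.
have -> : w ^+ n *: tquot f n w = f w - \sum_(k < n) w ^+ k *: tcoef f k.
  by rewrite [in RHS](taylorE f n) addrAC subrr add0r.
rewrite (le_trans (nmD _ _))// nmN -natr1 mulrDl mul1r addrC lerD ?fM//.
apply: (le_trans (nm_sum _ _ _)).
rewrite (@le_trans _ _ (\sum_(j < n) M))//; last by rewrite sumr_const card_ord mulr_natl.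
apply: ler_sum => k _; rewrite nmZ nmX wr mulrC.
exact: cauchy_estimate r0 rr' fh fM.
Qed.

(** With [s] the square root of [q], Bernoulli's inequality bounds [n.+1 * s ^+ n], and
    the other factor [s ^+ n] tends to [0]. *)
Lemma geometric_small (q c e : R) : 0 <= q < 1 -> 0 < e ->
  exists N, forall n, (N <= n)%N -> n.+1%:R * q ^+ n * c < e.
Proof.
move=> /andP[q0 q1] e0.
pose s := Num.sqrt q; have s0 : 0 <= s by exact: sqrtr_ge0.
have sq : s ^+ 2 = q by rewrite sqr_sqrtr.
have s1 : s < 1.
  by rewrite -(ltr_pXn2r (n := 2)) ?nnegrE ?ler01// expr1n sq.
have [s_eq0|s_neq0] := eqVneq s 0.
  exists 1%N => -[//|n] _.
  by rewrite -sq s_eq0 expr0n /= expr0n /= mulr0 mul0r.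
have s_gt0 : 0 < s by rewrite lt_neqAle eq_sym s_neq0.
pose d := s^-1 - 1; have d0 : 0 < d by rewrite /d subr_gt0 invf_gt1.
have bern n : 1 + n%:R * d <= (1 + d) ^+ n.
  elim: n => [|n ih]; first by rewrite mul0r addr0 expr0.
  rewrite exprSr; apply: (@le_trans _ _ ((1 + n%:R * d) * (1 + d))); last first.
    by rewrite ler_wpM2r//; lra.
  have : 0 <= n%:R * d * d by rewrite !mulr_ge0// ltW.
  rewrite -natr1; lra.
have sd : s * (1 + d) = 1 by rewrite /d addrC subrK divff.
have sn n : s ^+ n * (1 + n%:R * d) <= 1.
  apply: (@le_trans _ _ (s ^+ n * (1 + d) ^+ n)).
    by rewrite ler_wpM2l// exprn_ge0.
  by rewrite -exprMn sd expr1n.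
pose K := 1 + d^-1; have K0 : 0 < K by rewrite /K addr_gt0// invr_gt0.
have nK n : n.+1%:R * s ^+ n <= K.
  have := sn n; have p0 : 0 <= s ^+ n by rewrite exprn_ge0.
  rewrite -natr1 => h.
  have h1 : s ^+ n <= 1 by rewrite exprn_ile1 // ltW.
  have h2 : s ^+ n * (n%:R * d) <= 1 by lra.
  have : n%:R * s ^+ n <= d^-1 by rewrite -[leRHS]mul1r ler_pdivlMr// mulrAC mulrC.
  rewrite /K; lra.
pose c' := `|c| + 1; have c'0 : 0 < c' by rewrite ltr_wpDl.
have Kc : 0 < K * c' by rewrite mulr_gt0.
exists (Num.bound (K * c' / e * d^-1)) => n hn.
have : K * c' / e * d^-1 < n%:R.
  apply: lt_le_trans (archi_boundP _) _; last by rewrite ler_nat.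
  by rewrite mulr_ge0 ?invr_ge0 ?divr_ge0 ?(ltW Kc) ?(ltW d0) ?(ltW e0).
rewrite ltr_pdivrMr// ltr_pdivrMr// => h.
have p0 : 0 < s ^+ n by rewrite exprn_gt0.
have h3 : s ^+ n * (K * c') < e.
  have : s ^+ n * (n%:R * d * e) <= 1 * e.
    by rewrite mulrA ler_wpM2r ?(ltW e0)//; have := sn n; lra.
  have : s ^+ n * (K * c') < s ^+ n * (n%:R * d * e) by rewrite ltr_pM2l.
  lra.
apply: le_lt_trans h3.
rewrite -sq -exprM mulnC exprM expr2 mulrA.
have q1' := nK n; have q2 : c <= c' by have := ler_norm c; rewrite /c'; lra.
set a := n.+1%:R * s ^+ n in q1' *.
have a0 : 0 <= a by rewrite mulr_ge0// ltW.
apply: (@le_trans _ _ (a * s ^+ n * c')).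
  by rewrite ler_wpM2l// mulr_ge0// ltW.
rewrite mulrA ler_wpM2r ?(ltW c'0)// mulrC ler_wpM2l// ltW//.
Qed.

Lemma taylor_lim f r z : hol f r -> nm z < r ->
  slim (fun n => \sum_(k < n) z ^+ k *: tcoef f k) (f z).
Proof.
move=> fh zr e e0; have z0 := nm_ge0 z.
pose r1 := (nm z + r) / 2; have zr1 : nm z < r1 by rewrite /r1; lra.
have r1r : r1 < r by rewrite /r1; lra.
have r10 : 0 < r1 by lra.
clearbody r1.
have [M M0 fM] := hol_bounded r1r fh.
have [|N hN] := @geometric_small (nm z / r1) M e _ e0.
  by rewrite divr_ge0 ?(ltW r10)//= ltr_pdivrMr// mul1r.
exists N => n /hN h; rewrite nmC {1}(taylorE f n) addrAC subrr add0r nmZ nmX.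
apply: le_lt_trans h.
have fM1 (w : C) : nm w = r1 -> nm (f w) <= M by move=> wr; apply: fM; rewrite wr.
have h := tquot_bound n r10 r1r fh fM1 (ltW zr1).
apply: (@le_trans _ _ (nm z ^+ n * (n.+1%:R * M / r1 ^+ n))).
  by rewrite ler_wpM2l// exprn_ge0.
rewrite expr_div_n; move: (nm z ^+ n) (r1 ^- n) (n.+1%:R : R) => a b c.
by rewrite (_ : a * (c * M * b) = c * (a * b) * M)//; ring.
Qed.

Lemma tquot_local f g n : (exists2 t : R, 0 < t & forall z : C, nm z < t -> f z = g z) ->
  exists2 t : R, 0 < t & forall z : C, nm z < t -> tquot f n z = tquot g n z.
Proof.
move=> fg; elim: n => [//|n [t t0 ih]] /=; exists t => // z zt.
have e0 : tquot f n 0 = tquot g n 0 by rewrite ih// nm0.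
have -> : der (tquot f n) 0 = der (tquot g n) 0.
  congr get; apply/seteqP; split => d /=; apply: dif_local; exists t => // w;
    by rewrite subr0 => /ih.
by rewrite /quot e0 ih.
Qed.

Lemma tcoef_local f g n : (exists2 t : R, 0 < t & forall z : C, nm z < t -> f z = g z) ->
  tcoef f n = tcoef g n.
Proof. by move=> /(tquot_local n)[t t0 h]; rewrite /tcoef h// nm0. Qed.

Lemma tcoef0_eq0 f r : hol f r -> (forall n, tcoef f n = 0) -> forall z, nm z < r -> f z = 0.
Proof.
move=> fh f0 z zr; apply: slim_uniq (taylor_lim fh zr) _.
by move=> e e0; exists 0%N => n _; rewrite subr0 big1 ?nm0// => k _; rewrite f0 scaler0.
Qed.

(** All [tquot f n] vanish on a real interval around [0], the value at [0] being
    recovered by continuity; hence the Taylor coefficients vanish. *)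
Lemma hol_real_zero f r t : 0 < r -> 0 < t -> hol f r ->
  (forall x : R, `|x| < t -> f x%:C = 0) -> forall z, nm z < r -> f z = 0.
Proof.
move=> r0 t0 fh f0.
have n0 : nm (0 : C) < r by rewrite nm0.
suff tq n (x : R) : `|x| < t -> tquot f n x%:C = 0.
  by apply: (tcoef0_eq0 fh) => n; apply: (tq n 0); rewrite normr0.
elim: n x => [//|n ih] x xt; have th := tquot_hol n.+1 r0 fh.
have off (y : R) : `|y| < t -> y != 0 -> tquot f n.+1 y%:C = 0.
  move=> yt y0; rewrite /= /quot ih// (_ : tquot f n 0 = 0).
    by rewrite subrr scaler0 ifF//; apply/eqP => /complexI/eqP; rewrite (negbTE y0).
  by rewrite (ih 0)// normr0.
have [->|x0] := eqVneq x 0; last exact: off.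
apply: nm_eq0; apply/eqP; rewrite eq_le nm_ge0 andbT; apply/ler_addgt0Pr => e e0.
rewrite add0r; have [d /dif_ccont/(_ e e0)[s s0 hs]] := th 0 n0.
pose y := Num.min s t / 2; have m0 : 0 < Num.min s t by rewrite lt_min s0.
have y0 : 0 < y by rewrite /y; lra.
have : y < Num.min s t by rewrite /y; lra.
rewrite lt_min => /andP[ys yt].
have yo : tquot f n.+1 y%:C = 0 by apply: off; rewrite ?gtr0_norm ?gt_eqF.
have := hs y%:C; rewrite subr0 nmR gtr0_norm// yo sub0r nmN => /(_ ys)/ltW//.
Qed.

(** If the singularity of [f] at [0] is removable, then its value at [0] is the
    derivative at [0] of [w *: f w]. *)
Definition rext f (z : C) : X := if z == 0 then der (fun w => w *: f w) 0 else f z.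

(** The function [z ^+ 2 *: f z] is differentiable at [0] with derivative [0]; dividing
    it twice by [z] gives the extension. *)
Lemma riemann f r M : 0 < r ->
  (forall z : C, nm z < r -> z != 0 -> exists d, dif f z d) ->
  (forall z : C, nm z < r -> z != 0 -> nm (f z) <= M) -> hol (rext f) r.
Proof.
move=> r0 fd fM.
have n0 : nm (0 : C) < r by rewrite nm0.
pose k (z : C) := z ^+ 2 *: f z.
have k0 : dif k 0 0.
  move=> e e0; have M1 : 0 < `|M| + 1 by rewrite ltr_wpDl.
  exists (Num.min r (e / (`|M| + 1))); first by rewrite lt_min r0 divr_gt0.
  move=> h; rewrite lt_min ltr_pdivlMr// => /andP[hr he].
  rewrite /k add0r expr0n /= scale0r scaler0 !subr0.
  have [->|h0] := eqVneq h 0; first by rewrite expr0n /= scale0r !nm0 mulr0.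
  rewrite nmZ nmX expr2 -mulrA (mulrC e) ler_wpM2l ?nm_ge0//.
  apply: (le_trans _ (ltW he)); rewrite ler_wpM2l ?nm_ge0//.
  by have := fM h hr h0; have := ler_norm M; lra.
have kh : hol k r.
  move=> z zr; have [->|z0] := eqVneq z 0; first by exists 0.
  have [d hd] := fd z zr z0; exists (z ^+ 2 *: d + (2 * z) *: f z).
  exact: difM (sdif_sqr z) hd.
have q1h := quot_hol r0 kh k0.
have q1E (z : C) : quot k 0 z = z *: f z.
  rewrite /quot /k expr0n /= scale0r subr0; case: eqP => [->|/eqP z0].
    by rewrite scale0r.
  by rewrite scalerA expr2 mulrA mulVf// mul1r.
have q2h := quot_hol r0 q1h (hol_der q1h n0).
move=> z zr; have [d hd] := q2h z zr; exists d; apply: dif_local hd; exists 1 => // w _.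
rewrite quotE /rext; case: eqP => [_|/eqP w0].
  by congr get; apply/seteqP; split => c /=; apply: dif_local; exists 1 => // v _; rewrite q1E.
by rewrite !q1E scale0r subr0 scalerA mulVf// scale1r.
Qed.

Lemma remove_finite (F : seq C) f : (forall z, z \notin F -> exists d, dif f z d) ->
  (forall z : C, exists2 t : R, 0 < t & exists M, forall w, nm (w - z) < t -> w \notin F -> nm (f w) <= M) ->
  exists2 g, (forall z, exists d, dif g z d) & forall z, z \notin F -> g z = f z.
Proof.
elim: F f => [|p F ih] f fd fb; first by exists f => // z; apply: fd.
have sep : exists2 t : R, 0 < t & forall w : C, w != p -> nm (w - p) < t -> w \notin F.
  elim: (F) => [|q s [t t0 hs]]; first by exists 1.
  have [->|qp] := eqVneq q p.
    by exists t => // w wp /(hs w wp); rewrite in_cons (negbTE wp).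
  exists (Num.min t (nm (q - p))); first by rewrite lt_min t0 nm_gt0// subr_eq0.
  move=> w wp; rewrite lt_min => /andP[/(hs w wp) ws wq]; rewrite in_cons negb_or ws andbT.
  by apply/eqP => e; rewrite e ltxx in wq.
have [t t0 ts] := sep.
have [s s0 [M hM]] := fb p.
pose u := Num.min t s; have u0 : 0 < u by rewrite lt_min t0.
have rh : hol (rext (fun h => f (p + h))) u.
  apply: (@riemann _ u M u0) => h; rewrite lt_min => /andP[ht hs] h0.
    have e1 : p + h - p = h by rewrite (addrC p) addrK.
    have [|d hd] := fd (p + h).
      by rewrite in_cons negb_or ts ?e1// -subr_eq0 e1 h0.
    by exists d; apply: dif_unshift; apply: (dif_local _ (dif_shift hd)); exists 1 => // w _; rewrite addrA.
  have e1 : p + h - p = h by rewrite (addrC p) addrK.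
  by apply: hM; rewrite ?e1// in_cons negb_or ts ?e1// -subr_eq0 e1 h0.
pose f1 (w : C) := if w == p then rext (fun h => f (p + h)) 0 else f w.
have f1d z : z \notin F -> exists d, dif f1 z d.
  move=> zF; have [->|zp] := eqVneq z p.
    have [|d hd] := rh 0; first by rewrite nm0.
    exists d; apply: dif_unshift; apply: dif_local hd; exists u => // w.
    rewrite subr0 => wu; rewrite /f1 (_ : (p + w == p) = (w == 0)).
      by rewrite /rext eqxx.
    by rewrite -subr_eq0 (addrC p) addrK.
  have [|d hd] := fd z; first by rewrite in_cons negb_or zp.
  exists d; apply: dif_local hd; exists (nm (p - z)); first by rewrite nm_gt0// subr_eq0 eq_sym.
  by move=> w wz; rewrite /f1 ifF//; apply/eqP => e; rewrite e ltxx in wz.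
have [|g gd gf] := ih f1 f1d.
  move=> z; have [v v0 [M' hM']] := fb z; exists v => //.
  exists (Num.max M' (nm (f1 p))) => w wv wF; rewrite le_max.
  have [->|wp] := eqVneq w p; first by rewrite lexx orbT.
  by rewrite /f1 (negbTE wp) hM'// in_cons negb_or wp.
exists g => // z; rewrite in_cons negb_or => /andP[zp zF].
by rewrite gf// /f1 (negbTE zp).
Qed.

(** Cauchy estimates on large circles. *)
Lemma poly_growth f (M c R0 : R) n k : (forall z, exists d, dif f z d) -> 0 <= M -> 0 <= c ->
  (forall z : C, R0 <= nm z -> nm (f z) <= M * (1 + c * nm z) ^+ n) ->
  (n < k)%N -> tcoef f k = 0.
Proof.
move=> fd M0 c0 fM nk; apply: nm_eq0; apply/eqP; rewrite eq_le nm_ge0 andbT.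
apply/ler_addgt0Pr => e e0; rewrite add0r.
pose K := M * (1 + c) ^+ n.
have K0 : 0 <= K by rewrite mulr_ge0// exprn_ge0//; lra.
pose r := Num.max (Num.max R0 1) (K / e).
have rR : R0 <= r by rewrite !le_max lexx.
have r1 : 1 <= r by rewrite !le_max lexx orbT.
have rK : K <= r * e by rewrite -ler_pdivrMr// le_max lexx orbT.
have r0 : 0 < r by lra.
have := @cauchy_estimate f r (r + 1) (K * r ^+ n) k r0 ltac:(lra) (fun z _ => fd z).
have rn0 : 0 < r ^+ n by rewrite exprn_gt0.
rewrite -(subnK (ltnW nk)) exprD mulrA => /(_ _)/le_trans h.
have {}h : nm (tcoef f (k - n + n)) * r ^+ (k - n) * r ^+ n <= K * r ^+ n.
  apply: h => [z zr|]; last by [].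
  have a1 : 0 <= 1 + c * r by rewrite addr_ge0// mulr_ge0// ltW.
  have a2 : 1 + c * r <= (1 + c) * r by lra.
  rewrite /K -mulrA -exprMn (le_trans (fM z _)) ?zr// ler_wpM2l//.
  by apply: lerXn2r; rewrite ?nnegrE// (le_trans a1).
move: h; rewrite ler_pM2r// => h.
have rr : r <= r ^+ (k - n).
  by rewrite -[leLHS]expr1 ler_weXn2l// subn_gt0.
set T := nm _ in h *; have T0 : 0 <= T by exact: nm_ge0.
have : T * r <= r * e by apply: le_trans rK; apply: le_trans h; rewrite ler_wpM2l.
by rewrite mulrC ler_pM2l.
Qed.

Lemma hol_shift f r z : hol f r -> hol (fun h => f (z + h)) (r - nm z).
Proof.
move=> fh h hr; have [|d hd] := fh (z + h); first by have := nmD z h; lra.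
exists d; apply: dif_unshift; apply: (dif_local _ (dif_shift hd)).
by exists 1 => // w _; rewrite addrA.
Qed.

Lemma weierstrass_disc f r M : (forall z : C, nm z < r -> nm (f z) <= M) ->
  (forall e, 0 < e -> exists2 g, hol g r & forall z : C, nm z < r -> nm (f z - g z) <= e) ->
  hol f r.
Proof.
move=> fM fa z zr; suff [d hd] : exists d, dif (fun h => f (z + h)) 0 d.
  by exists d; apply: dif_unshift.
have zhr h : nm h < r - nm z -> nm (z + h) < r by have := nmD z h; lra.
apply: (@weierstrass _ _ _ (r - nm z) M) => [|h /zhr/fM//|e /fa[g gh fg]]; first lra.
by exists (fun h => g (z + h)) => [|h /zhr/fg//]; exact: hol_shift.
Qed.

(** Dependence of Taylor coefficients on a parameter [z]: by [tquot_bound] the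
    coefficient [tquot (phi z) k 0] is the limit of [tquot (phi z) k m] as [m] tends to
    [0], uniformly in [z], and [tquot (phi z) k.+1 m] is an explicit combination of
    these two. *)
Lemma tcoef_hol (phi : C -> C -> X) s r M n : 0 < r ->
  (forall z : C, nm z < s -> hol (phi z) r) ->
  (forall z m : C, nm z < s -> nm m < r -> nm (phi z m) <= M) ->
  (forall m : C, nm m < r -> m != 0 -> hol (fun z => phi z m) s) ->
  hol (fun z => tcoef (phi z) n) s.
Proof.
move=> r0 ph pM pz.
pose r1 := r / 2; have r10 : 0 < r1 by rewrite /r1; lra.
have r1r : r1 < r by rewrite /r1; lra.
clearbody r1.
have pr (z : C) : nm z < s -> forall w : C, nm w = r1 -> nm (phi z w) <= M.
  by move=> zs w wr; apply: pM => //; lra.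
have tqh k : (forall m : C, nm m < r -> m != 0 -> hol (fun z => tquot (phi z) k m) s) ->
   hol (fun z => tcoef (phi z) k) s.
  move=> tk; apply: (@weierstrass_disc _ s (k.+1%:R * M / r1 ^+ k)) => [z zs|e e0].
    by apply: (tquot_bound _ r10 r1r (ph z zs) (pr z zs)); rewrite nm0 ltW.
  pose K := `|k.+2%:R * M / r1 ^+ k.+1| + 1.
  have K0 : 0 < K by rewrite ltr_wpDl.
  have [|m m0] := @small_point R (Num.min r1 (e / K)); first by rewrite lt_min r10 divr_gt0.
  rewrite lt_min ltr_pdivlMr// => /andP[mr me].
  exists (fun z => tquot (phi z) k m) => [|z zs]; first by apply: tk => //; lra.
  have := tquot_bound k.+1 r10 r1r (ph z zs) (pr z zs) (ltW mr).
  rewrite /= /quot (negbTE m0) nmZ nmV ler_pdivrMl ?nm_gt0// nmC => h.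
  apply: le_trans h _; apply: le_trans (ltW me); rewrite ler_wpM2l ?nm_ge0//.
  by rewrite (le_trans (ler_norm _))// /K; lra.
apply: (tqh n); elim: n => [//|n ih] m mr m0 z zs /=.
have [a ha] := ih m mr m0 z zs; have [b hb] := tqh n ih z zs.
exists (m^-1 *: (a + -1 *: b)).
apply: (dif_local _ (difZ m^-1 (difD ha (difZ (-1) hb)))); exists 1 => // w _.
by rewrite /quot (negbTE m0) scaleN1r.
Qed.

End Taylor.

(** * Holomorphic functions on normed spaces *)

Section Gateaux.
Variables (R : realType) (E : normedModType R[i]) (X : completeNormedModType R[i]).
Local Notation C := R[i].
Implicit Types (f : E -> X) (U : E -> Prop).
Ltac lmod := lincomb_with R[i] X.

(** Gateaux holomorphy: holomorphy along complex lines, with no continuity in the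
    direction [v]. *)
Definition gat f U := forall x v, U x -> exists d, dif (fun s => f (x + s *: v)) 0 d.

Definition opn U := forall x, U x -> exists2 t : R, 0 < t & forall y, nm (y - x) < t -> U y.

Lemma gat_line f U x v r : gat f U -> (forall s : C, nm s < r -> U (x + s *: v)) ->
  hol (fun s => f (x + s *: v)) r.
Proof.
move=> fg Us z /Us zU; have [d hd] := fg _ v zU.
exists d; apply: dif_unshift; apply: dif_local hd; exists 1 => // w _.
by rewrite scalerDl addrA.
Qed.

Lemma gat_of_lines f U : (forall x v, U x -> exists2 r, 0 < r & hol (fun s => f (x + s *: v)) r) -> gat f U.
Proof. by move=> h x v /(h x v)[r r0 fh]; apply: fh; rewrite nm0. Qed.

Lemma ball_line (x v : E) (r t : R) (s : C) : 0 < t ->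
  nm v * r <= t -> nm s < r -> nm (x + s *: v - x) < t.
Proof.
move=> t0 vr sr; rewrite addrC addKr nmZ.
have [v0|v0] := eqVneq v 0; first by rewrite v0 nm0 mulr0.
have v1 := nm_gt0 v0; apply: lt_le_trans vr; rewrite mulrC ltr_pM2l//.
Qed.

Lemma radius_exists (v : E) (t : R) : 0 < t -> exists2 r, 0 < r & nm v * r <= t.
Proof.
move=> t0; have v1 : 0 < nm v + 1 by rewrite ltr_wpDl// nm_ge0.
exists (t / (nm v + 1)); first by rewrite divr_gt0.
by rewrite mulrCA ger_pMr// ler_pdivrMr//; lra.
Qed.

Definition frechet f x := exists2 L : E -> X, [/\ forall v w, L (v + w) = L v + L w,
    forall (a : C) v, L (a *: v) = a *: L v & exists K, forall v, nm (L v) <= K * nm v]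
  & forall e : R, 0 < e -> exists2 t : R, 0 < t &
    forall v, nm v < t -> nm (f (x + v) - f x - L v) <= e * nm v.

(** The estimate [schwarz] on complex lines makes the first order expansion of [f]
    uniform with respect to the direction and to the base point. Directional
    derivatives are homogeneous by definition. They are additive because the
    expansions from [x] to [x + c *: v] and from there to [x + c *: v + c *: w] add up,
    and the derivative in the direction [w] depends continuously on the base point:
    it is a Taylor coefficient depending on a parameter. *)
Lemma gat_bounded_frechet f x t M : 0 < t -> gat f (fun y => nm (y - x) < t) ->
  (forall y, nm (y - x) < t -> nm (f y) <= M) -> frechet f x.
Proof.
move=> t0 fg fM.
have M0 : 0 <= M by apply: le_trans (nm_ge0 _) (fM x _); rewrite subrr nm0.
pose L y v := der (fun s => f (y + s *: v)) 0.
have Ld y v : nm (y - x) < t -> dif (fun s => f (y + s *: v)) 0 (L y v).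
  by move=> yt; have [d hd] := fg y v yt; rewrite /L (derP hd).
have expn e : 0 < e -> exists2 u : R, 0 < u & forall y v, nm (y - x) < t / 2 -> nm v < u ->
    nm (f (y + v) - f y - L y v) <= e * nm v.
  move=> e0; pose Q := 32 * M / (t * e) + 1.
  have Q0 : 0 < Q by rewrite ltr_wpDl// divr_ge0 ?mulr_ge0// ltW.
  have Q1 : 1 <= Q by rewrite lerDr divr_ge0 ?mulr_ge0 ?(ltW t0) ?(ltW e0).
  have Q2 : 32 * M / (t * e) <= Q by rewrite lerDl.
  clearbody Q.
  exists (t / (4 * Q ^+ 2)); first by rewrite divr_gt0// mulr_gt0// exprn_gt0.
  move=> y v yt; have Q20 : 0 < Q ^+ 2 by rewrite exprn_gt0.
  rewrite ltr_pdivlMr ?mulr_gt0// => vQ.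
  have [->|v0] := eqVneq v 0.
    have -> : L y 0 = 0.
      apply: derP; apply: dif_local (dif_cst (f y) 0); exists 1 => // w _.
      by rewrite scaler0 addr0.
    by rewrite addr0 !subrr nm0 nm0 mulr0.
  have nv := nm_gt0 v0.
  have yt' : nm (y - x) < t by lra.
  pose r' := t / 2 / nm v; pose s := Num.sqrt (t / 4 / nm v).
  have sq : s ^+ 2 = t / 4 / nm v by rewrite sqr_sqrtr// ltW// !divr_gt0.
  have s0 : 0 < s by rewrite sqrtr_gt0 !divr_gt0.
  have sr : s ^+ 2 < r' by rewrite sq /r' ltr_pM2r ?invr_gt0//; lra.
  have qs : Q <= s.
    rewrite -(ler_pXn2r (n := 2)) ?nnegrE ?(ltW Q0) ?(ltW s0)// sq ler_pdivlMr//; lra.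
  have sU (c : C) : nm c < r' -> nm (y + c *: v - x) < t.
    rewrite /r' ltr_pdivlMr// => cr.
    by have := nmD (y - x) (c *: v); rewrite nmZ addrAC; lra.
  have fh := gat_line fg sU.
  have [_ /(_ 1)] := schwarz s0 sr fh (Ld y v yt') (fun c cr => fM _ (sU c cr)).
  rewrite nm1 !expr1n scale1r scale0r addr0 scale1r mulr1 => H.
  have {}H := H ltac:(lra).
  set T := nm _ in H *; have T0 : 0 <= T by exact: nm_ge0.
  have s3 : s ^+ 3 = t / 4 / nm v * s by rewrite exprSr sq.
  move: H; rewrite s3 => H.
  have h1 : T * (t / 4 / nm v * Q) <= 4 * M.
    apply: le_trans H; rewrite ler_wpM2l// ler_wpM2l// !divr_ge0 ?ltW//.
  have h2 : T * (t * Q) <= 16 * M * nm v.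
    have : T * (t / 4 / nm v * Q) * (4 * nm v) <= 4 * M * (4 * nm v).
      by rewrite ler_wpM2r// mulr_ge0// ltW.
    rewrite (_ : T * (t / 4 / nm v * Q) * (4 * nm v) = T * (t * Q)); first lra.
    by field; rewrite gt_eqF.
  have h3 : 32 * M <= t * e * Q by move: Q2; rewrite ler_pdivrMr ?mulr_gt0//; lra.
  have tQ : 0 < t * Q by rewrite mulr_gt0.
  rewrite -(ler_pM2r tQ) (le_trans h2)//.
  have : 32 * M * nm v <= t * e * Q * nm v by rewrite ler_wpM2r// ltW.
  have : 0 <= M * nm v by rewrite mulr_ge0// ltW.
  lra.
have LZ y (a : C) v : nm (y - x) < t -> L y (a *: v) = a *: L y v.
  move=> yt; apply: derP.
  have h : dif (fun s => f (y + s *: v)) (0 + a * 0) (L y v) by rewrite mulr0 addr0; exact: Ld.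
  apply: dif_local (dif_comp_affine h); exists 1 => // w _.
  by rewrite add0r scalerA mulrC.
have xx : nm (x - x) < t by rewrite subrr nm0.
have LM y v : nm (y - x) < t / 2 -> nm (L y v) <= 8 * M / t * nm v.
  move=> yt; have yt' : nm (y - x) < t by lra.
  have [v0|v0] := eqVneq v 0.
    by have := LZ y 0 v yt'; rewrite !scale0r v0 => ->; rewrite nm0 nm0 mulr0.
  have nv := nm_gt0 v0.
  pose r' := t / 2 / nm v; pose s := Num.sqrt (t / 4 / nm v).
  have sq : s ^+ 2 = t / 4 / nm v by rewrite sqr_sqrtr// ltW// !divr_gt0.
  have s0 : 0 < s by rewrite sqrtr_gt0 !divr_gt0.
  have sr : s ^+ 2 < r' by rewrite sq /r' ltr_pM2r ?invr_gt0//; lra.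
  have sU (c : C) : nm c < r' -> nm (y + c *: v - x) < t.
    rewrite /r' ltr_pdivlMr// => cr.
    by have := nmD (y - x) (c *: v); rewrite nmZ addrAC; lra.
  have [h _] := schwarz s0 sr (gat_line fg sU) (Ld y v yt') (fun c cr => fM _ (sU c cr)).
  rewrite (le_trans h)// sq le_eqVlt; apply/orP; left; apply/eqP.
  by field; rewrite !gt_eqF.
have t20 : 0 < t / 2 by lra.
have x2 : nm (x - x) < t / 2 by rewrite subrr nm0.
exists (L x); last first.
  by move=> e /expn[u u0 hu]; exists u => // v; exact: hu.
split; [|by move=> a v; rewrite LZ|by exists (8 * M / t) => v; rewrite LM].
move=> v w.
have [r r0 vr] := radius_exists v t20.
have [q q0 wq] := radius_exists w t20.
have Lw_hol : hol (fun s => L (x + s *: v) w) r.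
  have H := @tcoef_hol R X (fun s m => f ((x + s *: v) + m *: w)) r q M 1 q0.
  have inU (z m : C) : nm z < r -> nm m < q -> nm (x + z *: v + m *: w - x) < t.
    move=> zr mq; have h1 := ball_line x t20 vr zr; have h2 := ball_line x t20 wq mq.
    have := nmD (x + z *: v - x) (x + m *: w - x).
    rewrite (_ : x + z *: v - x + (x + m *: w - x) = x + z *: v + m *: w - x); first lra.
    by lincomb_with R[i] E; do ?split; ring.
  have {}H : hol (fun s => tcoef (fun m => f (x + s *: v + m *: w)) 1) r.
    apply: H => [z zr|z m zr mq|m mq m0].
    - by apply: (gat_line fg) => m mq; exact: inU.
    - by apply: fM; exact: inU.
    - have G : hol (fun z => f ((x + m *: w) + z *: v)) r.
        by apply: (gat_line fg) => z zr; rewrite (addrAC x); exact: inU.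
      move=> z /G[d hd]; exists d; apply: dif_local hd; exists 1 => // y _.
      by rewrite addrAC.
  move=> z /H[d hd]; exists d; apply: dif_local hd; exists 1 => // y _.
  by rewrite /tcoef /= /quot eqxx.
have [d /dif_ccont Lc] := Lw_hol 0 ltac:(by rewrite nm0).
apply/eqP; rewrite -subr_eq0; apply/eqP; apply: nm_eq0; apply/eqP.
rewrite eq_le nm_ge0 andbT; apply/ler_addgt0Pr => e e0; rewrite add0r.
pose K := nm (v + w) + nm v + nm w + 1.
have vw0 := nm_ge0 (v + w); have v0 := nm_ge0 v; have w0 := nm_ge0 w.
have K0 : 0 < K by rewrite /K; lra.
have [|u u0 hu] := expn (e / (2 * K)); first by rewrite divr_gt0// mulr_gt0.
have [|u' u'0 hu'] := Lc (e / 2); first lra.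
have [|c c0] := @small_point R (Num.min (Num.min r u') (u / K)).
  by rewrite !lt_min r0 u'0 divr_gt0.
rewrite !lt_min -andbA ltr_pdivlMr// => /and3P[cr cu' cu].
have nc := nm_gt0 c0.
have small (p : E) : nm p <= K -> nm (c *: p) < u.
  by move=> pK; rewrite nmZ; apply: le_lt_trans cu; rewrite ler_wpM2l// ltW.
have e1 := hu x (c *: (v + w)) x2 ltac:(apply: small; rewrite /K; clear -vw0 v0 w0; lra).
have e2 := hu x (c *: v) x2 ltac:(apply: small; rewrite /K; clear -vw0 v0 w0; lra).
have xcv := ball_line x t20 vr cr.
have e3 := hu (x + c *: v) (c *: w) xcv ltac:(apply: small; rewrite /K; clear -vw0 v0 w0; lra).
have := hu' c; rewrite subr0 scale0r addr0 => /(_ cu') e4.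
rewrite LZ// in e1; rewrite LZ// in e2; rewrite LZ in e3; last by lra.
set l1 := L x (v + w) in e1 *; set l2 := L x v in e2 *; set l3 := L (x + c *: v) w in e3 e4.
set l4 := L x w in e4 *.
rewrite scalerDr addrA in e1.
set f1 := f (x + c *: v + c *: w) in e1 e3; set f2 := f (x + c *: v) in e2 e3; set f0 := f x in e1 e2.
have E1 : c *: (l1 - (l2 + l4)) = - (f1 - f0 - c *: l1) + (f2 - f0 - c *: l2) + (f1 - f2 - c *: l3) + c *: (l3 - l4).
  by lmod; do ?split; ring.
have : nm (c *: (l1 - (l2 + l4))) <= nm c * e.
  rewrite E1; set a1 := _ - _ in e1 *; set a2 := _ - _ in e2 *; set a3 := _ - _ in e3 *.
  have := nmD (- a1 + a2 + a3) (c *: (l3 - l4)); have := nmD (- a1 + a2) a3; have := nmD (- a1) a2.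
  rewrite nmN (nmZ c (l3 - l4)) => n1 n2 n3.
  move: e1 e2 e3; rewrite !nmZ => e1 e2 e3.
  have e5 : nm c * nm (l3 - l4) <= nm c * (e / 2) by rewrite ler_wpM2l// ltW.
  have e6 : e / (2 * K) * (nm c * nm (v + w)) + e / (2 * K) * (nm c * nm v) +
    e / (2 * K) * (nm c * nm w) <= nm c * (e / 2).
    rewrite -!mulrDr (_ : nm c * (e / 2) = e / (2 * K) * (nm c * K)); last by field; rewrite gt_eqF.
    by rewrite ler_wpM2l ?divr_ge0 ?mulr_ge0 ?(ltW e0) ?(ltW K0)// ler_wpM2l ?(ltW nc)// /K; clear; lra.
  rewrite -scalerDr nmZ in e1; clear -e1 e2 e3 e5 e6 n1 n2 n3; lra.
by rewrite nmZ ler_pM2l.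
Qed.

Lemma frechet_cont f x e : frechet f x -> 0 < e ->
  exists2 t : R, 0 < t & forall y, nm (y - x) < t -> nm (f y - f x) < e.
Proof.
move=> [L [_ _ [K LK]] fL] e0; have [t t0 ft] := fL 1 ltr01.
have K0 : 0 < `|K| + 2 by rewrite ltr_wpDl.
exists (Num.min t (e / (`|K| + 2))); first by rewrite lt_min t0 divr_gt0.
move=> y; rewrite lt_min ltr_pdivlMr// => /andP[/ft]; rewrite addrCA subrr addr0 => h1 h2.
have := nmDB (f y - f x) (L (y - x)); have := LK (y - x); have := ler_norm K.
have := nm_ge0 (y - x); nra.
Qed.

Lemma frechet_comp f (a : C -> E) z d : frechet f (a z) -> dif a z d ->
  exists k, dif (fun w => f (a w)) z k.
Proof.
move=> [L [LD LZ [K0 LK0]] fL] ad; exists (L d).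
have [K K1 LK] : exists2 K, 0 < K & forall v, nm (L v) <= K * nm v.
  exists (`|K0| + 1) => [|v]; first by rewrite ltr_wpDl.
  by rewrite (le_trans (LK0 v))// ler_wpM2r ?nm_ge0//; have := ler_norm K0; lra.
move=> e e0; have dz := nm_ge0 d.
pose e1 := Num.min 1 (e / (2 * K)); have e10 : 0 < e1 by rewrite lt_min ltr01 divr_gt0// mulr_gt0.
have e11 : e1 <= 1 by rewrite ge_min lexx.
have e1K : K * e1 <= e / 2.
  have : e1 <= e / (2 * K) by rewrite ge_min lexx orbT.
  by rewrite ler_pdivlMr ?mulr_gt0//; lra.
clearbody e1.
have [|t t0 ft] := fL (e / (2 * (nm d + 1))); first by rewrite divr_gt0// mulr_gt0//; lra.
have [s s0 as_] := ad e1 e10.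
exists (Num.min s (t / (nm d + 1))); first by rewrite lt_min s0 divr_gt0//; lra.
move=> h; rewrite lt_min => /andP[/as_ h1]; rewrite ltr_pdivlMr; last lra.
move=> h2; pose k := a (z + h) - a z; have hh := nm_ge0 h.
have kh : nm k <= (nm d + 1) * nm h.
  have := nmDB k (h *: d); rewrite nmZ -/k in h1 *; nra.
have kt : nm k < t by lra.
have := ft k kt; rewrite {1}/k (addrCA (a z)) subrr addr0 => H.
have -> : f (a (z + h)) - f (a z) - h *: L d = (f (a (z + h)) - f (a z) - L k) + L (k - h *: d).
  have -> : L (k - h *: d) = L k - h *: L d by rewrite -(scaleN1r (h *: d)) LD !LZ scaleN1r.
  by lmod; do ?split; ring.
have H2 := LK (k - h *: d).
have H3 : K * nm (k - h *: d) <= K * (e1 * nm h) by rewrite ler_wpM2l// ltW.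
have H4 : K * e1 * nm h <= e / 2 * nm h by rewrite ler_wpM2r.
have H5 : e / (2 * (nm d + 1)) * nm k <= e / 2 * nm h.
  rewrite (_ : e / 2 * nm h = e / (2 * (nm d + 1)) * ((nm d + 1) * nm h)); last by field; rewrite gt_eqF//; lra.
  by rewrite ler_wpM2l// divr_ge0 ?ltW// mulr_gt0//; lra.
rewrite (le_trans (nmD _ _))//; lra.
Qed.

End Gateaux.

(** * Extension of bounded holomorphic functions to the ball *)

Section Extension.
Variables (R : realType) (E : normedModType R[i]) (X : completeNormedModType R[i]).
Local Notation C := R[i].
(** [G] stands for the component of the identity [one] and [Sa] for the set of
    self-adjoint elements. These hypotheses are all that the extension theorem needs
    to know about the algebra; [Gconn] is connectedness in the form used for the
    identity theorem. *)
Variables (G : E -> Prop) (one : E) (Sa : E -> Prop).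
Hypothesis Gopn : opn G.
Hypothesis Gone : G one.
Hypothesis nm_one : nm one <= 1.
Hypothesis Gscale : forall (c : C) Z, c != 0 -> G Z -> G (c *: Z).
Hypothesis Gconn : forall K : E -> Prop, K one ->
  (forall Z, G Z -> K Z -> exists2 t : R, 0 < t & forall Y, nm (Y - Z) < t -> K Y) ->
  (forall Z, G Z -> (forall t : R, 0 < t -> exists2 Y, nm (Y - Z) < t & K Y) -> K Z) ->
  forall Z, G Z -> K Z.
Hypothesis Sa_line : forall S T, Sa S -> Sa T -> forall x : R, Sa (S + x%:C *: T).
Hypothesis Sa_split : forall W, exists S T, [/\ Sa S, Sa T & W = S + 'i *: T].
Hypothesis Sa_dense : forall S, Sa S -> forall e : R, 0 < e ->
  exists2 W, nm (W - S) < e & exists F : seq C, forall m, m \notin F -> G (one + m *: W).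
Hypothesis discs : forall Z, nm Z < 1 -> exists T : C -> E,
  [/\ exists2 r : R, 1 < r & forall z, nm z < r -> exists d, dif T z d, T 0 = Z &
    forall z : C, nm z = 1 -> G (T z) /\ nm (T z) <= 1].

Variables (h : E -> X) (M : R).
Hypothesis h_gat : gat h (fun Z => G Z /\ nm Z < 1).
Hypothesis h_bounded : forall Z, G Z -> nm Z < 1 -> nm (h Z) <= M.

(** The restriction of [h] to the line through [0] and [Z], defined at [0] as well
    although [0] is not in [G]. *)
Definition radial (Z : E) : C -> X := rext (fun m => h (m *: Z)).

Definition hcoef n Z : X := tcoef (radial Z) n.

Lemma M_ge0 : 0 <= M.
Proof.
have n2 : nm (2^-1 *: one) < 1.
  by rewrite nmZ nmV nm_nat; have := nm_one; have := nm_ge0 one; lra.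
apply: le_trans (nm_ge0 _) (h_bounded _ n2); by apply: Gscale => //; rewrite invr_eq0 pnatr_eq0.
Qed.

Lemma scale_lt1 (Z : E) (m : C) r : nm Z * r <= 1 -> nm m < r -> nm (m *: Z) < 1.
Proof.
move=> Zr mr; rewrite nmZ; have [Z0|Z0] := eqVneq (nm Z) 0; first by rewrite Z0 mulr0.
have Zp : 0 < nm Z by rewrite lt_neqAle eq_sym Z0 nm_ge0.
by apply: lt_le_trans Zr; rewrite mulrC ltr_pM2l.
Qed.

Lemma radial_hol Z r : 0 < r -> G Z -> nm Z * r <= 1 -> hol (radial Z) r.
Proof.
move=> r0 GZ Zr; apply: (@riemann _ _ _ r M r0) => m mr m0; last first.
  by apply: h_bounded; [exact: Gscale|exact: scale_lt1 Zr mr].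
have [|d hd] := h_gat (x := m *: Z) Z; first by split; [exact: Gscale|exact: scale_lt1 Zr mr].
exists d; apply: dif_unshift; apply: dif_local hd; exists 1 => // w _.
by rewrite scalerDl.
Qed.

Lemma radialE Z m : m != 0 -> radial Z m = h (m *: Z).
Proof. by rewrite /radial /rext => /negbTE ->. Qed.

Lemma radial_circle Z r : 0 < r -> G Z -> nm Z * r < 1 -> forall m, nm m = r -> nm (radial Z m) <= M.
Proof.
move=> r0 GZ Zr m mr; have m0 : m != 0 by apply/eqP => m0; rewrite m0 nm0 in mr; lra.
rewrite radialE//; apply: h_bounded; [exact: Gscale|by rewrite nmZ mr mulrC].
Qed.

Lemma radial_bounded Z r : 0 < r -> G Z -> nm Z * r <= 1 -> forall m, nm m < r -> nm (radial Z m) <= M.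
Proof.
move=> r0 GZ Zr m mr; have [->|m0] := eqVneq m 0; last first.
  by rewrite radialE//; apply: h_bounded; [exact: Gscale|exact: scale_lt1 Zr mr].
have := @cauchy_estimate _ _ (radial Z) (r / 2) r M 0 ltac:(lra) ltac:(lra) (radial_hol r0 GZ Zr).
rewrite expr0 mulr1; apply; apply: radial_circle => //; first lra.
by have := nm_ge0 Z; nra.
Qed.

Lemma hcoef_bound n Z q : G Z -> nm Z < q -> nm (hcoef n Z) <= M * q ^+ n.
Proof.
move=> GZ Zq; have Z0 := nm_ge0 Z; have q0 : 0 < q by lra.
have r0 : 0 < 2 / (q + nm Z) by rewrite divr_gt0//; lra.
have qr : q^-1 < 2 / (q + nm Z) by rewrite ltr_pdivlMr ?ltr_pdivrMl//; lra.
have Zr : nm Z * (2 / (q + nm Z)) <= 1 by rewrite mulrA ler_pdivrMr; lra.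
have qZ : nm Z * q^-1 < 1 by rewrite ltr_pdivrMr// mul1r.
have q'0 : 0 < q^-1 by rewrite invr_gt0.
have := cauchy_estimate n q'0 qr (radial_hol r0 GZ Zr) (radial_circle q'0 GZ qZ).
by rewrite exprVn ler_pdivrMr ?exprn_gt0.
Qed.

(** The functions [radial (Z + z *: V)] of [m] form a family depending holomorphically
    on [z] for every [m != 0]; apply [tcoef_hol]. *)
Lemma hcoef_gat n : gat (hcoef n) G.
Proof.
apply: gat_of_lines => Z V GZ; have [t t0 tG] := Gopn GZ.
have u0 : 0 < Num.min t 1 by rewrite lt_min t0 ltr01.
have [r r0 Vr] := radius_exists V u0.
have near_ z : nm z < r -> G (Z + z *: V) /\ nm (Z + z *: V) <= nm Z + 1.
  move=> zr; have := ball_line Z u0 Vr zr; rewrite lt_min => /andP[/tG h1 h2]; split => //.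
  by have := nmDB (Z + z *: V) Z; lra.
have Z0 : 0 < nm Z + 1 by rewrite ltr_wpDl// nm_ge0.
have p0 : 0 < (nm Z + 1)^-1 by rewrite invr_gt0.
have pr z : nm z < r -> nm (Z + z *: V) * (nm Z + 1)^-1 <= 1.
  by move=> /near_[_ zz]; rewrite ler_pdivrMr// mul1r.
exists r => //; apply: (@tcoef_hol _ _ (fun z => radial (Z + z *: V)) r (nm Z + 1)^-1 M n p0).
- by move=> z zr; apply: radial_hol => //; [case: (near_ z zr)|exact: pr].
- by move=> z m zr mp; apply: radial_bounded mp => //; [case: (near_ z zr)|exact: pr].
- move=> m mp m0; have H : hol (fun z => h (m *: Z + z *: (m *: V))) r.
    apply: (gat_line h_gat) => z zr; rewrite scalerA mulrC -scalerA -scalerDr.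
    split; first by apply: Gscale => //; case: (near_ z zr).
    exact: scale_lt1 (pr z zr) mp.
  move=> z zr; have [d hd] := H z zr; exists d; apply: dif_local hd; exists 1 => // w _.
  by rewrite radialE// scalerDr !scalerA (mulrC w).
Qed.

Definition dcoef n k V : X := tcoef (fun m => hcoef n (one + m *: V)) k.

Lemma Gball : exists2 t : R, 0 < t <= 1 & forall Y, nm (Y - one) < t -> G Y /\ nm Y < 2.
Proof.
have [t t0 tG] := Gopn Gone; exists (Num.min t 1).
  by rewrite lt_min t0 ltr01 ge_min lexx orbT.
move=> Y; rewrite lt_min => /andP[/tG GY Y1]; split => //.
by have := nmDB Y one; have := nm_one; lra.
Qed.

Section Ball.
Variable t : R.
Hypothesis t01 : 0 < t <= 1.
Hypothesis tG : forall Y, nm (Y - one) < t -> G Y /\ nm Y < 2.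

Let t0 : 0 < t. Proof. by case/andP: t01. Qed.

Lemma dline_hol n V r : nm V * r <= t -> hol (fun m => hcoef n (one + m *: V)) r.
Proof.
move=> Vr; apply: (gat_line (@hcoef_gat n)) => m mr.
by case: (tG (ball_line one t0 Vr mr)).
Qed.

Lemma dline_bounded n V r m : nm V * r <= t -> nm m < r -> nm (hcoef n (one + m *: V)) <= M * 2 ^+ n.
Proof.
by move=> Vr mr; have [GY Y2] := tG (ball_line one t0 Vr mr); exact: hcoef_bound.
Qed.

Lemma dcoef_bound n k V K : nm V < K -> nm (dcoef n k V) <= M * 2 ^+ n * (2 * K / t) ^+ k.
Proof.
move=> VK; have V0 := nm_ge0 V; have K0 : 0 < K by lra.
have r0 : 0 < t / (2 * K) by rewrite divr_gt0// mulr_gt0.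
have rr : t / (2 * K) < t / K by rewrite ltr_pM2l// ltf_pV2 ?posrE ?mulr_gt0//; lra.
have Vr : nm V * (t / K) <= t.
  by rewrite mulrCA ger_pMr// ler_pdivrMr// mul1r ltW.
have := cauchy_estimate k r0 rr (dline_hol n Vr) (M := M * 2 ^+ n) _.
have -> : t / (2 * K) = (2 * K / t)^-1 by rewrite invf_div.
rewrite exprVn ler_pdivrMr; last by rewrite exprn_gt0// !divr_gt0// mulr_gt0.
apply => m mr; apply: dline_bounded Vr _; rewrite mr; lra.
Qed.

(** [dcoef n k] is defined and holomorphic on the whole space although [hcoef n] is
    only known on [G]: the expansion takes place near [one]. *)
Lemma dcoef_gat n k : gat (dcoef n k) (fun=> True).
Proof.
apply: gat_of_lines => V Y _.
have [r r0 Yr] := radius_exists Y (@ltr01 R).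
have VK : 0 < nm V + 1 by rewrite ltr_wpDl// nm_ge0.
have p0 : 0 < t / (nm V + 1) by rewrite divr_gt0.
have pr z : nm z < r -> nm (V + z *: Y) * (t / (nm V + 1)) <= t.
  move=> zr; have := ball_line V ltr01 Yr zr => h1.
  rewrite mulrCA ger_pMr// ler_pdivrMr// mul1r.
  by have := nmDB (V + z *: Y) V; lra.
exists r => //.
apply: (@tcoef_hol _ _ (fun z m => hcoef n (one + m *: (V + z *: Y))) r _ (M * 2 ^+ n) k p0).
- by move=> z zr; apply: dline_hol; exact: pr.
- by move=> z m zr mp; apply: dline_bounded mp; exact: pr.
- move=> m mp m0; have H : hol (fun z => hcoef n ((one + m *: V) + z *: (m *: Y))) r.
    apply: (gat_line (@hcoef_gat n)) => z zr.
    have := ball_line one t0 (pr z zr) mp => /tG[+ _].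
    by rewrite scalerDr addrA !scalerA (mulrC z).
  move=> z zr; have [d hd] := H z zr; exists d; apply: dif_local hd; exists 1 => // w _.
  by rewrite scalerDr addrA !scalerA (mulrC w).
Qed.

Lemma dcoef_frechet n k S : frechet (dcoef n k) S.
Proof.
apply: (@gat_bounded_frechet _ _ _ (dcoef n k) S 1 (M * 2 ^+ n * (2 * (nm S + 1) / t) ^+ k)) => //.
  by move=> x v _; exact: dcoef_gat.
by move=> y yS; apply: dcoef_bound; have := nmDB y S; lra.
Qed.

(** Outside of finitely many [m] the function [hcoef n (one + m *: W)] is holomorphic
    and bounded by a multiple of the [n]-th power of [1 + nm m * nm W / 2]. Its finitely
    many singularities are removable, and [poly_growth] applies. *)
Lemma dcoef_finite n k W (F : seq C) : (forall m : C, m \notin F -> G (one + m *: W)) -> (n < k)%N -> dcoef n k W = 0.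
Proof.
move=> FG nk; pose F' := [seq m <- F | m != 0].
have F'G m : m \notin F' -> G (one + m *: W).
  have [->|m0] := eqVneq m 0; first by rewrite scale0r addr0.
  by rewrite mem_filter m0 /= => /FG.
have W0 := nm_ge0 W.
pose p m := hcoef n (one + m *: W).
have pb m : m \notin F' -> nm (p m) <= M * (2 + nm m * nm W) ^+ n.
  move=> /F'G Gm; apply: hcoef_bound => //.
  by have := nmD one (m *: W); rewrite nmZ; have := nm_one; lra.
have [||g gd gp] := @remove_finite _ _ F' p.
- move=> z /F'G Gz; have [d hd] := hcoef_gat n W Gz; exists d.
  apply: dif_unshift; apply: dif_local hd; exists 1 => // w _.
  by rewrite /p scalerDl addrA.
- move=> z; exists 1 => //; exists (M * (2 + (nm z + 1) * nm W) ^+ n) => w wz /pb/le_trans; apply.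
  have h1 := nmDB w z; have w0 := nm_ge0 w; have z0 := nm_ge0 z.
  rewrite ler_wpM2l ?M_ge0//; apply: lerXn2r; rewrite ?nnegrE ?addr_ge0 ?mulr_ge0 ?addr_ge0//.
  by rewrite lerD2l ler_wpM2r//; lra.
have [R0 hR0] : exists R0 : R, forall m, m \in F' -> nm m < R0.
  elim: (F') => [|a s [r0 hr]]; first by exists 0.
  exists (Num.max (nm a + 1) r0) => m; rewrite in_cons lt_max => /predU1P[->|/hr ->]; last by rewrite orbT.
  by rewrite ltrDl ltr01.
have [s s0 hs] : exists2 s : R, 0 < s & forall m : C, nm m < s -> m \notin F'.
  have : 0 \notin F' by rewrite mem_filter eqxx.
  elim: (F') => [|a l ih]; first by exists 1.
  rewrite in_cons negb_or eq_sym => /andP[a0 /ih[s s0 hs]].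
  exists (Num.min s (nm a)); first by rewrite lt_min s0 nm_gt0.
  move=> m; rewrite lt_min in_cons negb_or => /andP[/hs -> ma]; rewrite andbT.
  by apply/eqP => e; rewrite e ltxx in ma.
have -> : dcoef n k W = tcoef g k.
  by apply: tcoef_local; exists s => // m /hs mF; rewrite gp.
apply: (@poly_growth _ _ g (M * 2 ^+ n) (nm W / 2) R0 n k gd _ _ _ nk).
- by rewrite mulr_ge0 ?M_ge0// exprn_ge0.
- by rewrite divr_ge0.
- move=> m mR; have mF : m \notin F' by apply/negP => /hR0; lra.
  rewrite gp//; apply: le_trans (pb m mF) _; rewrite -mulrA -exprMn.
  by rewrite (_ : 2 * (1 + nm W / 2 * nm m) = 2 + nm m * nm W)//; field.
Qed.

(** [dcoef_finite] and continuity on [Sa]; then holomorphy in [s] of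
    [dcoef n k (S + s *: T)], evaluated at ['i]. *)
Lemma dcoef_eq0 n k W : (n < k)%N -> dcoef n k W = 0.
Proof.
move=> nk.
have Sa0 S : Sa S -> dcoef n k S = 0.
  move=> SS; apply: nm_eq0; apply/eqP; rewrite eq_le nm_ge0 andbT.
  apply/ler_addgt0Pr => e e0; rewrite add0r.
  have [|d d0 hd] := frechet_cont (dcoef_frechet n k S) (e := e) _; first by [].
  have [Y YS [F FG]] := Sa_dense SS d0.
  by have := hd Y YS; rewrite (dcoef_finite FG nk) sub0r nmN => /ltW.
have [S [T [SS ST ->]]] := Sa_split W.
have hh : hol (fun s => dcoef n k (S + s *: T)) 2 by apply: (gat_line (@dcoef_gat n k)).
apply: (hol_real_zero (r := 2) (t := 1) _ _ hh) => //; last by rewrite nm_i; lra.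
by move=> x _; apply: Sa0; exact: Sa_line.
Qed.

Lemma hcoef_near_one n W : nm W < t -> hcoef n (one + W) = \sum_(k < n.+1) dcoef n k W.
Proof.
move=> Wt.
have [r r1 Wr] : exists2 r, 1 < r & nm W * r <= t.
  have [->|W0] := eqVneq W 0; first by exists 2; rewrite ?nm0 ?mul0r ?ltW//; lra.
  exists (t / nm W); first by rewrite ltr_pdivlMr ?nm_gt0// mul1r.
  by rewrite mulrC divfK// gt_eqF// nm_gt0.
have n1 : nm (1 : C) < r by rewrite nm1.
have := taylor_lim (dline_hol n Wr) n1; rewrite scale1r => H.
apply: slim_uniq H _ => e e0; exists n.+1 => m nm_.
rewrite -(subnKC nm_) big_split_ord /= [X in _ + X - _]big1 => [|k _].
  rewrite addr0 [X in X - _](eq_bigr (fun k : 'I_n.+1 => dcoef n k W)) ?subrr ?nm0// => k _.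
  by rewrite expr1n scale1r.
by rewrite -/(dcoef _ _ _) dcoef_eq0 ?scaler0// ltn_addr.
Qed.

(** The polynomial that continues [hcoef n] from [G] to the whole space. *)
Definition hpoly n Z : X := \sum_(k < n.+1) dcoef n k (Z - one).

Lemma hpoly_bounded n K : exists B, forall Z, nm Z < K -> nm (hpoly n Z) <= B.
Proof.
exists (\sum_(k < n.+1) (M * 2 ^+ n * (2 * (K + 1) / t) ^+ k)) => Z ZK.
apply: (le_trans (nm_sum _ _ _)); apply: ler_sum => k _; apply: dcoef_bound.
by have := nmD Z (- one); rewrite nmN; have := nm_one; lra.
Qed.

Lemma hpoly_gat n : gat (hpoly n) (fun=> True).
Proof.
move=> Z V _.
have H (k : 'I_n.+1) : hol (fun s => dcoef n k ((Z - one) + s *: V)) 1.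
  by apply: (gat_line (@dcoef_gat n k)).
have [|d hd] := hol_sum (index_enum 'I_n.+1) H (z := 0); first by rewrite nm0.
exists d; apply: dif_local hd; exists 1 => // w _.
by apply: eq_bigr => k _; rewrite addrAC.
Qed.

Lemma hpoly_hcoef n Z : G Z -> hpoly n Z = hcoef n Z.
Proof.
move=> GZ; suff [s s0 H] : exists2 s : R, 0 < s & forall Y, nm (Y - Z) < s -> hpoly n Y = hcoef n Y.
  by apply: H; rewrite subrr nm0.
apply: (@Gconn (fun Z => exists2 s : R, 0 < s & forall Y, nm (Y - Z) < s -> hpoly n Y = hcoef n Y)) GZ.
- exists t => // Y Yt; rewrite -[in RHS](subrK one Y) addrC hcoef_near_one//.
- move=> {}Z GZ [s s0 H]; exists (s / 2); first lra.
  move=> Y YZ; exists (s / 2); first lra.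
  by move=> Y' Y'Y; apply: H; have := nmB Y Y' Z; lra.
- move=> {}Z GZ H; have [s s0 sG] := Gopn GZ.
  have [|Y YZ [u u0 hu]] := H (s / 4); first lra.
  exists (s / 4); first lra.
  move=> Y' Y'Z.
  have YY' : nm (Y' - Y) < s / 2 by have := nmB Z Y' Y; rewrite (nmC Z); lra.
  have h1 : hol (fun z => hcoef n (Y + z *: (Y' - Y))) (3 / 2).
    apply: (gat_line (@hcoef_gat n)) => z zr; apply: sG.
    have := nmD (Y - Z) (z *: (Y' - Y)); rewrite nmZ addrAC.
    have : nm z * nm (Y' - Y) <= 3 / 2 * (s / 2) by rewrite ler_pM ?nm_ge0// ltW.
    lra.
  have h2 : hol (fun z => hpoly n (Y + z *: (Y' - Y))) (3 / 2).
    exact: (gat_line (@hpoly_gat n)).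
  have D : hol (fun z => hpoly n (Y + z *: (Y' - Y)) + -1 *: hcoef n (Y + z *: (Y' - Y))) (3 / 2).
    move=> z zr; have [a ha] := h1 z zr; have [b hb] := h2 z zr.
    by exists (b + -1 *: a); apply: difD => //; apply: difZ.
  have [v v0 Yv] := radius_exists (Y' - Y) u0.
  have := hol_real_zero (r := 3 / 2) (t := v) _ v0 D _ (z := 1).
  rewrite nm1 scale1r (addrC Y) subrK scaleN1r => E1.
  apply/eqP; rewrite -subr_eq0; apply/eqP; apply: E1; [lra| |lra].
  move=> x xv; rewrite hu ?scaleN1r ?subrr//.
  by apply: (ball_line Y u0 Yv); rewrite nmR.
Qed.

Lemma hpoly_frechet n Z : frechet (hpoly n) Z.
Proof.
have [B hB] := hpoly_bounded n (nm Z + 1).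
apply: (@gat_bounded_frechet _ _ _ (hpoly n) Z 1 B) => //.
  by move=> x v _; exact: hpoly_gat.
by move=> y yZ; apply: hB; have := nmDB y Z; lra.
Qed.

(** The maximum principle along the disc through [r^-1 *: Z], scaled by [r]: on its
    boundary [hpoly n] is equal to [hcoef n]. *)
Lemma hpoly_bound n Z r q : 0 < r -> r < q -> nm Z < r -> nm (hpoly n Z) <= M * q ^+ n.
Proof.
move=> r0 rq Zr.
have [|T [[s s1 Td] T0 Tc]] := discs (Z := r%:C^-1 *: Z).
  by rewrite nmZ nmV nmR gtr0_norm// ltr_pdivrMl// mulr1.
have rC : r%:C != 0 :> C by apply/eqP => /complexI; lra.
have H : hol (fun z => hpoly n (r%:C *: T z)) s.
  move=> z zs; have [d hd] := Td z zs.
  exact: frechet_comp (hpoly_frechet n _) (difZ r%:C hd).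
have := max_hol ltr01 s1 H (B := M * q ^+ n) _ (z := 0).
rewrite nm0 T0 scalerA divff// scale1r; apply => // z z1.
have [Gz Tz] := Tc z z1; have GrT := Gscale rC Gz.
rewrite hpoly_hcoef//; apply: hcoef_bound => //.
by rewrite nmZ nmR gtr0_norm//; apply: le_lt_trans rq; rewrite ger_pMr.
Qed.

Definition gext Z : X := get [set l | slim (fun N => \sum_(n < N) hpoly n Z) l].

Lemma tail_bound Z r q N k : 0 < r -> r < q -> q < 1 -> nm Z < r ->
  nm (\sum_(n < N + k) hpoly n Z - \sum_(n < N) hpoly n Z) <= M / (1 - q) * q ^+ N.
Proof.
move=> r0 rq q1 Zr; have q0 : 0 < q by lra.
have Mq : 0 <= M / (1 - q) by rewrite divr_ge0 ?M_ge0//; lra.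
suff : nm (\sum_(n < N + k) hpoly n Z - \sum_(n < N) hpoly n Z) <= M / (1 - q) * (q ^+ N - q ^+ (N + k)).
  by move=> /le_trans; apply; rewrite ler_wpM2l// gerBl exprn_ge0// ltW.
elim: k => [|k ih]; first by rewrite addn0 !subrr nm0 mulr0.
rewrite addnS big_ord_recr /= addrAC.
have h1 := hpoly_bound (N + k) r0 rq Zr.
have := nmD (\sum_(n < N + k) hpoly n Z - \sum_(n < N) hpoly n Z) (hpoly (N + k) Z).
have E1 : M / (1 - q) * (q ^+ N - q ^+ (N + k).+1) = M / (1 - q) * (q ^+ N - q ^+ (N + k)) + M * q ^+ (N + k).
  by rewrite exprS; field; rewrite subr_eq0 gt_eqF.
by rewrite E1; lra.
Qed.

Lemma tail_small q e : 0 <= q < 1 -> 0 < e -> exists N, M / (1 - q) * q ^+ N < e.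
Proof.
move=> q01 e0; have [N hN] := geometric_small (M / (1 - q)) q01 e0.
exists N; apply: le_lt_trans (hN N (leqnn N)).
have Mq : 0 <= M / (1 - q) by case/andP: q01 => q0 q1; rewrite divr_ge0 ?M_ge0//; lra.
rewrite mulrC ler_wpM2r// ler_peMl ?exprn_ge0//; first by case/andP: q01.
by rewrite ler1n.
Qed.

Lemma gext_lim Z : nm Z < 1 -> slim (fun N => \sum_(n < N) hpoly n Z) (gext Z).
Proof.
move=> Z1; rewrite /gext.
suff : exists l, slim (fun N => \sum_(n < N) hpoly n Z) l by move=> [l /getI].
have Z0 := nm_ge0 Z.
pose r := (2 * nm Z + 1) / 3; pose q := (nm Z + 2) / 3.
have Zr : nm Z < r by rewrite /r; lra.
have rq : r < q by rewrite /r /q; lra.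
have q1 : q < 1 by rewrite /q; lra.
have r0 : 0 < r by lra.
apply: cauchy_slim => e e0; have [||N hN] := @tail_small q (e / 2); [lra|lra|].
exists N => m n Nm Nn.
have hm := tail_bound N (m - N) r0 rq q1 Zr; rewrite subnKC// in hm.
have hn := tail_bound N (n - N) r0 rq q1 Zr; rewrite subnKC// in hn.
have := nmB (\sum_(i < N) hpoly i Z) (\sum_(i < m) hpoly i Z) (\sum_(i < n) hpoly i Z).
rewrite (nmC (\sum_(i < N) hpoly i Z)); lra.
Qed.

Lemma gext_tail Z r q N : 0 < r -> r < q -> q < 1 -> nm Z < r ->
  nm (gext Z - \sum_(n < N) hpoly n Z) <= M / (1 - q) * q ^+ N.
Proof.
move=> r0 rq q1 Zr; apply: (slim_le (N := N) (gext_lim (Z := Z) _)); first lra.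
by move=> n Nn; rewrite -(subnKC Nn); apply: (tail_bound _ _ r0).
Qed.

Lemma gext_frechet Z : nm Z < 1 -> frechet gext Z.
Proof.
move=> Z1; have Z0 := nm_ge0 Z.
pose r := (2 * nm Z + 1) / 3; pose q := (nm Z + 2) / 3.
have Zr : nm Z < r by rewrite /r; lra.
have rq : r < q by rewrite /r /q; lra.
have q1 : q < 1 by rewrite /q; lra.
have r0 : 0 < r by lra.
have gb Y : nm Y < r -> nm (gext Y) <= M / (1 - q).
  by move=> Yr; have := gext_tail 0 r0 rq q1 Yr; rewrite big_ord0 subr0 expr0 mulr1.
have YZ Y : nm (Y - Z) < r - nm Z -> nm Y < r by have := nmDB Y Z; lra.
apply: (@gat_bounded_frechet _ _ _ gext Z (r - nm Z) (M / (1 - q))); first lra.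
  move=> x V /YZ xr.
  have [u u0 Vu] := @radius_exists _ _ V (r - nm x) ltac:(lra).
  have xsr s : nm s < u -> nm (x + s *: V) < r.
    move=> su; have := @ball_line _ _ x V u (r - nm x) s; have := nmDB (x + s *: V) x.
    move=> h1 /(_ ltac:(lra) Vu su); lra.
  have : hol (fun s => gext (x + s *: V)) u.
    apply: (@weierstrass_disc _ _ _ u (M / (1 - q))) => [s /xsr/gb//|e e0].
    have [||N hN] := @tail_small q e; [lra|lra|].
    exists (fun s => \sum_(n < N) hpoly n (x + s *: V)).
      apply: hol_sum => n; exact: (gat_line (@hpoly_gat n)).
    by move=> s /xsr/(gext_tail N r0 rq q1)/le_trans; apply; exact: ltW.
  by move=> /(_ 0); apply; rewrite nm0.
by move=> y /YZ/gb.
Qed.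

Lemma gext_eq Z : G Z -> nm Z < 1 -> gext Z = h Z.
Proof.
move=> GZ Z1.
have [r r1 Zr] : exists2 r, 1 < r & nm Z * r <= 1.
  have [Z0|Z0] := eqVneq Z 0; first by exists 2; rewrite ?Z0 ?nm0 ?mul0r//; lra.
  exists (nm Z)^-1; first by rewrite invf_gt1 ?nm_gt0.
  by rewrite divff// gt_eqF// nm_gt0.
have n1 : nm (1 : C) < r by rewrite nm1.
have := taylor_lim (radial_hol (lt_trans ltr01 r1) GZ Zr) n1.
rewrite radialE ?oner_eq0// scale1r => H; apply: slim_uniq (gext_lim Z1) _.
move=> e /H[N hN]; exists N => n /hN.
rewrite (eq_bigr (fun k : 'I_n => hpoly k Z)) // => k _.
by rewrite expr1n scale1r hpoly_hcoef.
Qed.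

End Ball.

Theorem bounded_extension : exists2 g : E -> X,
  (forall Z, nm Z < 1 -> frechet g Z) & forall Z, G Z -> nm Z < 1 -> g Z = h Z.
Proof.
have [t t01 tG] := Gball.
by exists gext => Z; [exact: (gext_frechet t01 tG)|exact: (gext_eq t01 tG)].
Qed.

End Extension.

(** * The ring of bounded operators *)

Section OperatorRing.
Variables (R : realType) (V : normedModType R[i]).
Local Notation C := R[i].
Implicit Types S T U : boundedOp V.

Lemma opA : associative (@compop R V).
Proof. by move=> S T U; apply: boundedOpP. Qed.
Lemma op1m : left_id (idop V) (@compop R V).
Proof. by move=> S; apply: boundedOpP. Qed.
Lemma opm1 : right_id (idop V) (@compop R V).
Proof. by move=> S; apply: boundedOpP. Qed.

Lemma op_addr T x y : T (x + y) = T x + T y.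
Proof. by have := boundedOp_linear T 1 x y; rewrite !scale1r. Qed.

Lemma opDl : left_distributive (@compop R V) +%R.
Proof. by move=> S T U; apply: boundedOpP. Qed.
Lemma opDr : right_distributive (@compop R V) +%R.
Proof. by move=> S T U; apply: boundedOpP => x; rewrite /= op_addr. Qed.

HB.instance Definition _ := GRing.Zmodule_isPzRing.Build (boundedOp V) opA op1m opm1 opDl opDr.

Lemma op_mulE S T x : (S * T) x = S (T x). Proof. by []. Qed.
Lemma op_addE S T x : (S + T) x = S x + T x. Proof. by []. Qed.
Lemma op_oppE S x : (- S) x = - S x. Proof. by []. Qed.
Lemma op_subE S T x : (S - T) x = S x - T x. Proof. by []. Qed.
Lemma op_scaleE a S x : (a *: S) x = a *: S x. Proof. by []. Qed.
Lemma op_oneE x : (1 : boundedOp V) x = x. Proof. by []. Qed.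
Lemma op_zeroE x : (0 : boundedOp V) x = 0. Proof. by []. Qed.

Lemma op_subr T x y : T (x - y) = T x - T y.
Proof. by rewrite op_addr -(scaleN1r y) boundedOpZ scaleN1r. Qed.

Lemma opZl a S T : (a *: S) * T = a *: (S * T).
Proof. by apply: boundedOpP. Qed.
Lemma opZr a S T : S * (a *: T) = a *: (S * T).
Proof. by apply: boundedOpP => x; rewrite op_mulE op_scaleE boundedOpZ. Qed.

(** The operator norm is a supremum over the unit ball; homogeneity turns it into the
    usual Lipschitz constant. *)
Lemma nm_op_le T (K : R) : 0 <= K -> (forall x, nm (T x) <= K * nm x) -> nm T <= K.
Proof.
move=> K0 TK; rewrite -lecR -nmE; apply: opnorm_le => x.
rewrite !nmE -[1]/(1%:C) !lecR => x1; apply: le_trans (TK x) _.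
by rewrite ler_piMr.
Qed.

Lemma nm_op T x : nm (T x) <= nm T * nm x.
Proof.
have [->|x0] := eqVneq x 0; first by rewrite boundedOp0 !nm0 mulr0.
have nx := nm_gt0 x0.
have : `|T ((nm x)^-1%:C *: x)| <= `|T|.
  by apply: opnorm_ub; rewrite nmE nmZ nmR gtr0_norm ?invr_gt0// mulVf// gt_eqF.
rewrite !nmE lecR boundedOpZ nmZ nmR gtr0_norm ?invr_gt0// ler_pdivrMl// mulrC.
by [].
Qed.

Lemma nm_mul S T : nm (S * T) <= nm S * nm T.
Proof.
apply: nm_op_le => [|x]; first by rewrite mulr_ge0 ?nm_ge0.
rewrite op_mulE (le_trans (nm_op _ _))// -mulrA ler_wpM2l ?nm_ge0// nm_op.
by [].
Qed.

Lemma nm_one_le : nm (1 : boundedOp V) <= 1.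
Proof. by apply: nm_op_le => // x; rewrite mul1r. Qed.

Lemma nm_exp T n : nm (T ^+ n) <= nm T ^+ n.
Proof.
elim: n => [|n ih]; first by rewrite !expr0 nm_one_le.
by rewrite !exprS (le_trans (nm_mul _ _))// ler_wpM2l ?nm_ge0.
Qed.

Definition strong_lim (T : nat -> boundedOp V) S := forall x, slim (fun n => T n x) (S x).

Lemma strong_lim_uniq (T : nat -> boundedOp V) S S' : strong_lim T S -> strong_lim T S' -> S = S'.
Proof. by move=> TS TS'; apply: boundedOpP => x; apply: slim_uniq (TS x) (TS' x). Qed.

Lemma strong_lim_ext (T T' : nat -> boundedOp V) S : T =1 T' -> strong_lim T S -> strong_lim T' S.
Proof. by move=> TT TS x e e0; have [N hN] := TS x e e0; exists N => n /hN; rewrite TT. Qed.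

Lemma strong_lim_cst S : strong_lim (fun=> S) S.
Proof. by move=> x; exact: slim_cst. Qed.

Lemma strong_limD (T T' : nat -> boundedOp V) S S' : strong_lim T S -> strong_lim T' S' ->
  strong_lim (fun n => T n + T' n) (S + S').
Proof. by move=> TS TS' x; exact: (slimD (TS x) (TS' x)). Qed.

Lemma strong_limN (T : nat -> boundedOp V) S : strong_lim T S -> strong_lim (fun n => - T n) (- S).
Proof. by move=> TS x; exact: (slimN (TS x)). Qed.

Lemma strong_limB (T T' : nat -> boundedOp V) S S' : strong_lim T S -> strong_lim T' S' ->
  strong_lim (fun n => T n - T' n) (S - S').
Proof. by move=> TS TS'; apply: strong_limD => //; exact: strong_limN. Qed.

Lemma strong_limZ a (T : nat -> boundedOp V) S : strong_lim T S -> strong_lim (fun n => a *: T n) (a *: S).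
Proof. by move=> TS x; exact: (slimZ a (TS x)). Qed.

Lemma strong_lim_shift (T : nat -> boundedOp V) S : strong_lim T S -> strong_lim (fun n => T n.+1) S.
Proof. by move=> TS x; exact: slim_shift (TS x). Qed.

Lemma strong_limM (T T' : nat -> boundedOp V) S S' K : (forall n, nm (T n) <= K) -> strong_lim T S ->
  strong_lim T' S' ->
  strong_lim (fun n => T n * T' n) (S * S').
Proof.
move=> TK TS TS' x e e0; have K0 : 0 <= K by exact: le_trans (nm_ge0 _) (TK 0%N).
have [|N1 h1] := TS (S' x) (e / 2); first lra.
have [|N2 h2] := TS' x (e / (2 * (K + 1))); first by rewrite divr_gt0//; lra.
exists (maxn N1 N2) => n; rewrite geq_max => /andP[/h1 k1 /h2 k2].
rewrite !op_mulE; have := nmB (T n (S' x)) (T n (T' n x)) (S (S' x)).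
rewrite -op_subr; have := nm_op (T n) (T' n x - S' x).
have k0 := nm_ge0 (T' n x - S' x).
have : nm (T n) * nm (T' n x - S' x) <= K * nm (T' n x - S' x) by rewrite ler_wpM2r.
move: k2; rewrite ltr_pdivlMr; last lra.
lra.
Qed.

Lemma strong_lim_nm (T : nat -> boundedOp V) S K : (forall n, nm (T n) <= K) -> strong_lim T S -> nm S <= K.
Proof.
move=> TK TS; have K0 : 0 <= K by exact: le_trans (nm_ge0 _) (TK 0%N).
apply: nm_op_le => // x; rewrite -[S x]subr0; apply: (slim_le (N := 0%N) (TS x)) => n _.
by rewrite subr0 (le_trans (nm_op _ _))// ler_wpM2r ?nm_ge0.
Qed.

End OperatorRing.

Section StrongLimits.
Variables (R : realType) (V : completeNormedModType R[i]).
Local Notation C := R[i].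
Implicit Types S T U : boundedOp V.

Lemma strong_lim_exists (T : nat -> boundedOp V) K : (forall n, nm (T n) <= K) ->
  (forall x e, 0 < e -> exists N, forall m n, (N <= m)%N -> (N <= n)%N -> nm (T m x - T n x) < e) ->
  exists S, strong_lim T S.
Proof.
move=> TK Tc; have K0 : 0 <= K by exact: le_trans (nm_ge0 _) (TK 0%N).
have lex x : exists l, slim (fun n => T n x) l by apply: cauchy_slim => e; exact: Tc.
have [f fP] := choice lex.
have fbl : f \in @bounded_linear R V.
  apply/asboolP; split=> [a x y|].
    apply: slim_uniq (fP _) _.
    have := slimD (slimZ a (fP x)) (fP y); rewrite /slim => H e /H[N hN].
    by exists N => n /hN; rewrite boundedOp_linear.
  exists K%:C => x; rewrite !nmE -rmorphM lecR -[f x]subr0.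
  apply: (slim_le (N := 0%N) (fP x)) => n _; rewrite subr0.
  by rewrite (le_trans (nm_op _ _))// ler_wpM2r ?nm_ge0.
by exists (BoundedOp fbl).
Qed.

Lemma neumann T : nm T < 1 -> exists U, [/\ (1 - T) * U = 1, U * (1 - T) = 1,
  nm U <= (1 - nm T)^-1 & strong_lim (fun n => \sum_(k < n) T ^+ k) U].
Proof.
move=> T1; have T0 := nm_ge0 T; set q := nm T in T1 T0 *.
pose P n := \sum_(k < n) T ^+ k.
have q1 : 0 < 1 - q by lra.
have tail n k x : nm (P (n + k)%N x - P n x) <= (1 - q)^-1 * nm x * (q ^+ n - q ^+ (n + k)).
  elim: k => [|k ih]; first by rewrite addn0 !subrr nm0 mulr0.
  have PS : P (n + k).+1 x = P (n + k)%N x + (T ^+ (n + k)) x by rewrite /P big_ord_recr.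
  rewrite addnS PS addrAC.
  have := nmD (P (n + k)%N x - P n x) ((T ^+ (n + k)) x).
  have := nm_op (T ^+ (n + k)) x; have := nm_exp T (n + k); rewrite -/q => h1 h2.
  have h3 : nm (T ^+ (n + k)) * nm x <= q ^+ (n + k) * nm x by rewrite ler_wpM2r ?nm_ge0.
  have -> : (1 - q)^-1 * nm x * (q ^+ n - q ^+ (n + k).+1) =
     (1 - q)^-1 * nm x * (q ^+ n - q ^+ (n + k)) + q ^+ (n + k) * nm x.
    by rewrite exprS; field; rewrite gt_eqF.
  lra.
have tailN n m x : (n <= m)%N -> nm (P m x - P n x) <= (1 - q)^-1 * nm x * q ^+ n.
  move=> nm_; have := tail n (m - n)%N x; rewrite subnKC// => /le_trans; apply.
  rewrite ler_wpM2l ?mulr_ge0 ?nm_ge0 ?invr_ge0 ?(ltW q1)//.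
  by rewrite gerBl exprn_ge0.
have PK n : nm (P n) <= (1 - q)^-1.
  apply: nm_op_le => [|x]; first by rewrite invr_ge0 ltW.
  have := tailN 0%N n x (leq0n n); rewrite /P big_ord0 op_zeroE subr0 expr0 mulr1.
  by [].
have small e : 0 < e -> exists N, forall n, (N <= n)%N -> q ^+ n < e.
  move=> e0; have [||N hN] := @geometric_small R q 1 e; [by rewrite T0 T1|by []|].
  exists N => n /hN; apply: le_lt_trans; rewrite mulr1 ler_peMl ?exprn_ge0// ler1n.
  by [].
have [|U PU] := strong_lim_exists PK.
  move=> x e e0; have c0 : 0 < 2 * ((1 - q)^-1 * nm x + 1).
    by rewrite mulr_gt0// ltr_wpDl// mulr_ge0 ?nm_ge0// invr_ge0 ltW.
  have [N hN] := small _ (divr_gt0 e0 c0).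
  exists N => m n Nm Nn; have h1 := tailN N m x Nm; have h2 := tailN N n x Nn.
  have := nmB (P N x) (P m x) (P n x); rewrite (nmC (P N x)).
  have := hN N (leqnn N); rewrite ltr_pdivlMr// => h3.
  have : 0 <= q ^+ N by rewrite exprn_ge0.
  nra.
have Tn0 : strong_lim (fun n => T ^+ n) 0.
  move=> x e e0; have c0 : 0 < nm x + 1 by rewrite ltr_wpDl// nm_ge0.
  have [N hN] := small _ (divr_gt0 e0 c0).
  exists N => n /hN; rewrite op_zeroE subr0 ltr_pdivlMr// => h.
  have := nm_op (T ^+ n) x; have := nm_exp T n; rewrite -/q.
  have := nm_ge0 x; have : 0 <= q ^+ n by rewrite exprn_ge0.
  nra.
have E n : (1 - T) * P n = 1 - T ^+ n /\ P n * (1 - T) = 1 - T ^+ n.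
  elim: n => [|n [ih1 ih2]]; first by rewrite /P big_ord0 mulr0 mul0r expr0 subrr.
  have PS : P n.+1 = P n + T ^+ n by rewrite /P big_ord_recr.
  rewrite PS; split.
    by rewrite mulrDr ih1 mulrBl mul1r -exprS addrA subrK.
  by rewrite mulrDl ih2 mulrBr mulr1 -exprSr addrA subrK.
have L : strong_lim (fun n => 1 - T ^+ n) 1.
  by rewrite -[X in strong_lim _ X]subr0; apply: strong_limB => //; exact: strong_lim_cst.
exists U; split => //; last exact: strong_lim_nm PK PU.
- apply: strong_lim_uniq L; have := strong_limM (fun=> lexx (nm (1 - T))) (strong_lim_cst (1 - T)) PU.
  by apply: strong_lim_ext => n; rewrite (E n).1.
- apply: strong_lim_uniq L; have := strong_limM PK PU (strong_lim_cst (1 - T)).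
  by apply: strong_lim_ext => n; rewrite (E n).2.
Qed.

End StrongLimits.

(** * Adjoints and positive operators *)

Section Adjoint.
Variables (R : realType) (H : hilbertType R).
Local Notation C := R[i].
Implicit Types (x y z : H) (S T U : 'L(H)).
Local Notation ip := (hdot H).

(** The real part of the form. It is symmetric and bilinear over the reals, and it
    determines the form, so that adjoints can be handled with it alone. *)
Definition rip x y : R := complex.Re (ip x y).

Lemma ip_conj x y : ip y x = (ip x y)^*.
Proof. by rewrite hermC expr0 mul1r. Qed.

Lemma ipxx x : ip x x = (nm x ^+ 2)%:C.
Proof. by rewrite hdotxx nmE rmorphXn. Qed.

Lemma ripxx x : rip x x = nm x ^+ 2.
Proof. by rewrite /rip ipxx. Qed.

Lemma ripC x y : rip x y = rip y x.
Proof. by rewrite /rip ip_conj; case: (ip y x). Qed.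

Lemma ripDl x y z : rip (x + y) z = rip x z + rip y z.
Proof. by rewrite /rip linearDl raddfD. Qed.

Lemma ripDr x y z : rip x (y + z) = rip x y + rip x z.
Proof. by rewrite ripC ripDl !(ripC x). Qed.

Lemma ripNl x y : rip (- x) y = - rip x y.
Proof. by rewrite /rip linearNl raddfN. Qed.

Lemma ripNr x y : rip x (- y) = - rip x y.
Proof. by rewrite ripC ripNl ripC. Qed.

Lemma ripZl (a : R) x y : rip (a%:C *: x) y = a * rip x y.
Proof. by rewrite /rip linearZl /=; case: (ip x y) => c d /=; rewrite mul0r subr0. Qed.

Lemma ripZr (a : R) x y : rip x (a%:C *: y) = a * rip x y.
Proof. by rewrite ripC ripZl ripC. Qed.

Lemma nm_add_sqr x y : nm (x + y) ^+ 2 = nm x ^+ 2 + nm y ^+ 2 + 2 * rip x y.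
Proof. by rewrite -!ripxx ripDl !ripDr (ripC y x); ring. Qed.

Lemma nm_sub_sqr x y : nm (x - y) ^+ 2 = nm x ^+ 2 + nm y ^+ 2 - 2 * rip x y.
Proof. by rewrite nm_add_sqr nmN ripNr; ring. Qed.

Lemma rip_le x y : rip x y <= nm x * nm y.
Proof.
have [->|x0] := eqVneq x 0; first by rewrite /rip linear0l nm0 mul0r.
have nx := nm_gt0 x0; have ny := nm_ge0 y.
have := sqr_ge0 (nm ((nm y)%:C *: x - (nm x)%:C *: y)).
rewrite nm_sub_sqr !nmZ !nmR ripZl ripZr !ger0_norm ?(ltW nx)//.
have [->|y0] := eqVneq y 0; first by rewrite /rip linear0r nm0 mulr0.
have {}ny := nm_gt0 y0; rewrite !exprMn => h.
have p : 0 < nm x * nm y by rewrite mulr_gt0.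
rewrite -(ler_pM2l p); lra.
Qed.

Lemma ip_rip x y : ip x y = rip x y +i* rip x ('i *: y).
Proof.
rewrite /rip linearZr /=; case: (ip x y) => a b /=.
by congr (_ +i* _); rewrite !(mul0r, mulr0, mul1r, mulr1, mulN1r); ring.
Qed.

Lemma nm_ip_le x y : nm (ip x y) <= 2 * (nm x * nm y).
Proof.
have abs u v : `|rip u v| <= nm u * nm v.
  by apply/ler_normlP; split; [rewrite -ripNl -(nmN u)|]; exact: rip_le.
rewrite ip_rip (le_trans (nm_le_ReIm _))//=.
have := abs x y; have := abs x ('i *: y); rewrite nmZ nm_i mul1r; lra.
Qed.

Definition radj T S := forall x y, rip (T x) y = rip x (S y).

Lemma radjP T S : is_adjoint T S <-> radj T S.
Proof.
split=> TS x y; first by rewrite /rip TS.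
by rewrite !ip_rip !TS boundedOpZ.
Qed.

Lemma radj_sym T S : radj T S -> radj S T.
Proof. by move=> TS x y; rewrite ripC -TS ripC. Qed.

Lemma radjD T S T' S' : radj T S -> radj T' S' -> radj (T + T') (S + S').
Proof. by move=> h h' x y; rewrite !op_addE ripDl ripDr h h'. Qed.

Lemma radjN T S : radj T S -> radj (- T) (- S).
Proof. by move=> h x y; rewrite !op_oppE ripNl ripNr h. Qed.

Lemma radjM T S T' S' : radj T S -> radj T' S' -> radj (T * T') (S' * S).
Proof. by move=> h h' x y; rewrite !op_mulE h h'. Qed.

Lemma radj1 : radj 1 1. Proof. by []. Qed.

Lemma radjZ (c : C) T S : radj T S -> radj (c *: T) (c^* *: S).
Proof.
move=> h; apply/radjP => x y; rewrite !op_scaleE.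
by rewrite linearZl linearZr /= conjCK ((radjP T S).2 h).
Qed.

Lemma radjZr (a : R) T S : radj T S -> radj (a%:C *: T) (a%:C *: S).
Proof. by move=> h x y; rewrite !op_scaleE ripZl ripZr h. Qed.

Lemma radj_nm T S : radj T S -> nm S <= nm T.
Proof.
move=> h; apply: nm_op_le => [|x]; first exact: nm_ge0.
have [->|y0] := eqVneq (S x) 0; first by rewrite nm0 mulr_ge0 ?nm_ge0.
have := ripxx (S x); rewrite -h => e; have := rip_le (T (S x)) x; rewrite e.
have := nm_op T (S x); have n0 := nm_gt0 y0; have x0 := nm_ge0 x => h1 h2.
rewrite -(ler_pM2l n0) -expr2 (le_trans h2)//.
have : nm (T (S x)) * nm x <= nm T * nm (S x) * nm x by rewrite ler_wpM2r.
lra.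
Qed.

(** The adjoints of a strongly convergent sequence need not converge strongly, so their
    convergence is a hypothesis. *)
Lemma radj_strong_lim (T T' : nat -> 'L(H)) S S' : strong_lim T S -> strong_lim T' S' ->
  (forall n, radj (T n) (T' n)) -> radj S S'.
Proof.
move=> TS TS' a x y; apply/eqP; rewrite -subr_eq0 -normr_le0; apply/ler_addgt0Pr => e e0.
have x0 := nm_ge0 x; have y0 := nm_ge0 y.
have [|N1 h1] := TS x (e / (2 * (nm y + 1))); first by rewrite divr_gt0//; lra.
have [|N2 h2] := TS' y (e / (2 * (nm x + 1))); first by rewrite divr_gt0//; lra.
pose n := maxn N1 N2; have k1 := h1 n (leq_maxl _ _); have k2 := h2 n (leq_maxr _ _).
rewrite (_ : rip (S x) y - rip x (S' y) = rip (S x - T n x) y + rip x (T' n y - S' y)); last first.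
  by rewrite !ripDl !ripDr !ripNl !ripNr a; ring.
have abs u v : `|rip u v| <= nm u * nm v.
  by apply/ler_normlP; split; [rewrite -ripNl -(nmN u)|]; exact: rip_le.
rewrite (le_trans (ler_normD _ _))//.
have a1 := abs (S x - T n x) y; have a2 := abs x (T' n y - S' y).
have py : 0 < 2 * (nm y + 1) by lra.
have px : 0 < 2 * (nm x + 1) by lra.
move: k1 k2; rewrite (ltr_pdivlMr _ _ py) (ltr_pdivlMr _ _ px) add0r => k1 k2.
rewrite nmC in a1; have m1 := nm_ge0 (T n x - S x); have m2 := nm_ge0 (T' n y - S' y).
nra.
Qed.

Definition selfadj T := radj T T.
Definition qform T x := rip (T x) x.

(** The operator inequalities [0 <= T <= 1]. *)
Definition contr_pos T := [/\ selfadj T, forall x, 0 <= qform T x & forall x, qform T x <= nm x ^+ 2].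

(** This is [T ^+ 2 <= T]: evaluate [0 <= T] at [x - T x] and [T <= 1] at [T x]. *)
Lemma contr_pos_sq T : contr_pos T -> forall x, nm (T x) ^+ 2 <= qform T x.
Proof.
move=> [Ts T0 T1] x; have h := T0 (x - T x); have h1 := T1 (T x).
move: h; rewrite /qform op_subr ripDl !ripDr ripNl !ripNr ripxx.
rewrite (Ts (T x) x) ripxx -/(qform T x) ripNl -/(qform T (T x)); lra.
Qed.

Lemma contr_pos_nm T : contr_pos T -> nm T <= 1.
Proof.
move=> Tp; apply: nm_op_le => // x; rewrite mul1r.
rewrite -(ler_pXn2r (n := 2)) ?nnegrE ?nm_ge0// (le_trans (contr_pos_sq Tp x))//.
by case: Tp.
Qed.

Lemma bounded_increasing (u : nat -> R) M : (forall n, u n <= u n.+1) -> (forall n, u n <= M) ->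
  forall e, 0 < e -> exists N, forall n, (N <= n)%N -> u n - u N < e.
Proof.
move=> ui uM e e0; pose A := [set u n | n in setT].
have hs : has_sup A by split; [exists (u 0%N), 0%N|exists M => _ [n _ <-]].
have [_ [N _ <-] hN] := sup_adherent e0 hs.
exists N => n Nn; have : u n <= sup A by apply: ub_le_sup; [case: hs|exists n].
lra.
Qed.

(** Vigier's theorem: the bounded increasing sequences of real numbers [qform (T n) x] are
    Cauchy, and by [contr_pos_sq] the square of [nm (T n x - T m x)] is at most the
    difference of their terms. *)
Lemma increasing_strong_lim (T : nat -> 'L(H)) : (forall n, contr_pos (T n)) ->
  (forall n x, qform (T n) x <= qform (T n.+1) x) -> exists S, strong_lim T S.
Proof.
move=> Tp Ti; apply: (@strong_lim_exists _ _ T 1) => [n|x e e0]; first exact: contr_pos_nm.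
have e2 : 0 < (e / 2) ^+ 2 by rewrite exprn_gt0//; lra.
have [N hN] := bounded_increasing (fun n => Ti n x) (fun n => let: And3 _ _ h := Tp n in h x) e2.
have mono n k y : qform (T n) y <= qform (T (n + k)%N) y.
  by elim: k => [|k ih]; rewrite ?addn0// addnS (le_trans ih).
have key n : (N <= n)%N -> nm (T n x - T N x) < e / 2.
  move=> Nn; have -> : T n x - T N x = (T n - T N) x by [].
  have P : contr_pos (T n - T N).
    have [sn n0 n1] := Tp n; have [sN N0 N1] := Tp N.
    split=> [|y|y]; first by apply: radjD => //; exact: radjN.
      by have := mono N (n - N)%N y; rewrite subnKC// /qform op_subE ripDl ripNl; lra.
    by have := N0 y; have := n1 y; rewrite /qform op_subE ripDl ripNl; lra.
  rewrite -(ltr_pXn2r (n := 2)) ?nnegrE ?nm_ge0//; last lra.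
  apply: le_lt_trans (contr_pos_sq P x) _.
  by have := hN n Nn; rewrite /qform op_subE ripDl ripNl.
exists N => m n /key h1 /key h2.
by have := nmB (T N x) (T m x) (T n x); rewrite (nmC (T N x)); lra.
Qed.

End Adjoint.

(** * Square roots of operators *)

Section SquareRoot.
Variables (R : realType) (H : hilbertType R).
Local Notation C := R[i].
Implicit Types (x y z : H) (S T U X : 'L(H)).

Definition half : C := (2^-1 : R)%:C.

Lemma halfE : half = 2^-1.
Proof. by rewrite /half fmorphV rmorph_nat. Qed.

(** Polynomials in [X] with nonnegative coefficients. *)
Inductive cone X : 'L(H) -> Prop :=
  | cone_pow k : cone X (X ^+ k)
  | coneD T U : cone X T -> cone X U -> cone X (T + U)
  | coneZ (c : R) T : 0 <= c -> cone X T -> cone X (c%:C *: T).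

Lemma coneM X T U : cone X T -> cone X U -> cone X (T * U).
Proof.
elim=> [k|T1 T2 _ h1 _ h2|c T1 c0 _ h1] cU.
- elim: cU => [j|U1 U2 _ k1 _ k2|c U1 c0 _ k1].
  + by rewrite -exprD; exact: cone_pow.
  + by rewrite mulrDr; exact: coneD.
  + by rewrite opZr; exact: coneZ.
- by rewrite mulrDl; apply: coneD; [exact: h1|exact: h2].
- by rewrite opZl; apply: coneZ => //; exact: h1.
Qed.

Lemma cone_comm X T U : GRing.comm U X -> cone X T -> GRing.comm U T.
Proof.
move=> UX; elim=> [k|T1 T2 _ h1 _ h2|c T1 c0 _ h1].
- exact: commrX.
- exact: commrD.
- by rewrite /GRing.comm opZl opZr h1.
Qed.

Lemma selfadj_exp X k : selfadj X -> selfadj (X ^+ k).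
Proof.
move=> Xs; elim: k => [|k ih]; first by rewrite expr0.
by rewrite /selfadj {1}exprS exprSr; apply: radjM.
Qed.

(** The powers of a positive operator are positive: write [X ^+ k] as [X^j X^e X^j]
    with [e] at most one. *)
Lemma cone_pos X T : selfadj X -> (forall x, 0 <= qform X x) -> cone X T ->
  selfadj T /\ forall x, 0 <= qform T x.
Proof.
move=> Xs X0; elim=> [k|T1 T2 _ [h1 k1] _ [h2 k2]|c T1 c0 _ [h1 k1]].
- split=> [|x]; first exact: selfadj_exp.
  rewrite -(odd_double_half k) -addnn; set j := k./2; rewrite /qform addnCA.
  rewrite exprD op_mulE (selfadj_exp j Xs).
  case: (odd k); last by rewrite add0n ripxx sqr_ge0.
  by rewrite exprD expr1 op_mulE X0.
- split=> [|x]; first exact: radjD.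
  by rewrite /qform op_addE ripDl addr_ge0 ?k1 ?k2.
- split=> [|x]; first exact: radjZr.
  by rewrite /qform op_scaleE ripZl mulr_ge0 ?k1.
Qed.

(** The iteration [b = (X + b ^+ 2) / 2], whose limit is [1 - (1 - X)^(1/2)]. It stays
    among the polynomials in [X], hence in every closed power algebra that contains
    [X]. *)
Fixpoint bq X n : 'L(H) := if n is m.+1 then half *: (X + bq X m * bq X m) else 0.

Lemma half_ge0 : 0 <= (2^-1 : R). Proof. by rewrite invr_ge0. Qed.

Lemma bq_cone X n : cone X (bq X n).
Proof.
elim: n => [|n ih] /=.
  have -> : 0 = 0%:C *: X ^+ 0 by rewrite rmorph0 scale0r.
  by apply: coneZ => //; exact: cone_pow.
apply: (coneZ half_ge0); apply: coneD; last exact: coneM.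
by rewrite -(expr1 X); exact: cone_pow.
Qed.

(** The increments have nonnegative coefficients because
    [a^2 - b^2 = (a - b) a + b (a - b)]; hence the iteration is increasing when [X] is
    positive. *)
Lemma bq_incr X n : cone X (bq X n.+1 - bq X n).
Proof.
elim: n => [|n ih].
  rewrite /= subr0 mulr0 addr0; apply: (coneZ half_ge0).
  by rewrite -[X in cone _ X](expr1 X); exact: cone_pow.
rewrite [bq X n.+2]/= [X in _ - X]/= -/(bq X n.+1).
set a := bq X n.+1 in ih *; set b := bq X n in ih *.
have -> : half *: (X + a * a) - half *: (X + b * b) = half *: ((a - b) * a + b * (a - b)).
  rewrite mulrBl mulrBr; lincomb_with R[i] 'L(H); do ?split; ring.
by apply: (coneZ half_ge0); apply: coneD; apply: coneM => //; exact: bq_cone.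
Qed.

Lemma nm_half T : nm (half *: T) = nm T / 2.
Proof. by rewrite nmZ halfE nmV nm_nat mulrC. Qed.

Lemma bq_nm X q n : nm X <= q ^+ 2 -> 0 <= q <= 1 -> nm (bq X n) <= q.
Proof.
move=> Xq /andP[q0 q1]; elim: n => [|n ih] /=; first by rewrite nm0.
rewrite nm_half; have := nmD X (bq X n * bq X n); have := nm_mul (bq X n) (bq X n).
have := nm_ge0 (bq X n); nra.
Qed.

Lemma strong_lim_qform_ge0 (T : nat -> 'L(H)) S x : strong_lim T S -> (forall n, 0 <= qform (T n) x) ->
  0 <= qform S x.
Proof.
move=> TS T0; apply/ler_addgt0Pr => e e0; have x0 := nm_ge0 x.
have x1 : 0 < nm x + 1 by lra.
have [N hN] := TS x _ (divr_gt0 e0 x1).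
have := hN N (leqnn N); rewrite ltr_pdivlMr// => h.
have := rip_le (T N x - S x) x; rewrite ripDl ripNl -/(qform _ _) -/(qform S x).
by have := T0 N; have := nm_ge0 (T N x - S x); nra.
Qed.

Lemma strong_lim_comm (T : nat -> 'L(H)) S U K : (forall n, nm (T n) <= K) -> strong_lim T S ->
  (forall n, GRing.comm U (T n)) -> GRing.comm U S.
Proof.
move=> TK TS TU; have h1 := strong_limM (fun=> lexx (nm U)) (strong_lim_cst U) TS.
have h2 := strong_limM TK TS (strong_lim_cst U); apply: strong_lim_uniq h1 _.
by apply: strong_lim_ext h2 => n; rewrite TU.
Qed.

Lemma sqrt_exists_op X q : selfadj X -> (forall x, 0 <= qform X x) -> nm X <= q ^+ 2 -> 0 <= q <= 1 ->
  exists b, [/\ strong_lim (bq X) b, selfadj b, nm b <= q, b = half *: (X + b * b) &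
    (forall x, 0 <= qform b x) /\ forall U, GRing.comm U X -> GRing.comm U b].
Proof.
move=> Xs X0 Xq q01.
have bn n := bq_nm n Xq q01.
have bp n := cone_pos Xs X0 (bq_cone X n).
have hp n : contr_pos (bq X n).
  have [s p] := bp n; split=> // x; rewrite (le_trans (rip_le _ _))// expr2.
  have := nm_op (bq X n) x; have := bn n; have := nm_ge0 x; case/andP: q01; nra.
have hi n x : qform (bq X n) x <= qform (bq X n.+1) x.
  have [_ h] := cone_pos Xs X0 (bq_incr X n).
  by have := h x; rewrite /qform op_subE ripDl ripNl subr_ge0.
have [b hb] := increasing_strong_lim hp hi.
exists b; split => //.
- by apply: (radj_strong_lim hb hb) => n; case: (bp n).
- exact: strong_lim_nm bn hb.
- apply: strong_lim_uniq (strong_lim_shift hb) _.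
  by apply: strong_lim_ext (strong_limZ half (strong_limD (strong_lim_cst X) (strong_limM bn hb hb))) => n.
- split=> [x|U UX]; first by apply: (strong_lim_qform_ge0 hb) => n; case: (bp n).
  by apply: (strong_lim_comm bn hb) => n; apply: cone_comm UX _; exact: bq_cone.
Qed.

Lemma sqr_one_sub X (b : 'L(H)) : b = half *: (X + b * b) -> (1 - b) * (1 - b) = 1 - X.
Proof.
move=> hb; rewrite mulrBl !mulrBr !mul1r mulr1.
have h2 : b * b = 2 *: b - X.
  rewrite [in RHS]hb halfE scalerA divff ?scale1r ?pnatr_eq0// addrC addrA.
  by rewrite addNr add0r.
by rewrite h2; lincomb_with R[i] 'L(H); do ?split; ring.
Qed.

End SquareRoot.

(** * Products in power algebras *)

Section Algebra.
Variables (R : realType) (H : hilbertType R) (A : powerAlgebra H).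
Local Notation C := R[i].
Implicit Types (x y z : H) (S T U X W Z : 'L(H)).
Hypothesis wA : wot_closed A.
Local Notation inA := (pa_set A).

Lemma inA_lin (a : C) S T : inA S -> inA T -> inA (a *: S + T).
Proof.
move=> SA TA; have [_ h] := pa_submod A.
exact: (asboolW (h a S T (asboolT SA) (asboolT TA))).
Qed.

Lemma inA0 : inA 0.
Proof. by have [h _] := pa_submod A; exact: (asboolW h). Qed.

Lemma inA1 : inA 1. Proof. exact: pa_id. Qed.

Lemma inAZ (a : C) T : inA T -> inA (a *: T).
Proof. by move=> TA; have := inA_lin a TA inA0; rewrite addr0. Qed.

Lemma inAD S T : inA S -> inA T -> inA (S + T).
Proof. by move=> SA TA; have := inA_lin 1 SA TA; rewrite scale1r. Qed.

Lemma inAN T : inA T -> inA (- T).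
Proof. by move=> TA; rewrite -scaleN1r; exact: inAZ. Qed.

Lemma inAB S T : inA S -> inA T -> inA (S - T).
Proof. by move=> SA TA; apply: inAD => //; exact: inAN. Qed.

Lemma inA_sq T : inA T -> inA (T * T).
Proof. exact: pa_sqr. Qed.

(** Polarization of the square. *)
Lemma inA_jordan S T : inA S -> inA T -> inA (S * T + T * S).
Proof.
move=> SA TA.
have -> : S * T + T * S = (S + T) * (S + T) - S * S - T * T.
  by rewrite mulrDl !mulrDr; lincomb_with R[i] 'L(H); do ?split; ring.
by apply: inAB; [apply: inAB|]; apply: inA_sq => //; exact: inAD.
Qed.

(** The product [S * T * S] is a combination of iterated Jordan products. *)
Lemma inA_triple S T : inA S -> inA T -> inA (S * T * S).
Proof.
move=> SA TA.
have -> : S * T * S = half R *: (((S * T + T * S) * S + S * (S * T + T * S)) - ((S * S) * T + T * (S * S))).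
  by rewrite halfE !mulrDl !mulrDr !mulrA; lincomb_with R[i] 'L(H); do ?split; field.
apply: inAZ; apply: inAB; apply: inA_jordan => //; first exact: inA_jordan.
exact: inA_sq.
Qed.

Lemma inA_triple2 S T U : inA S -> inA T -> inA U -> inA (S * T * U + U * T * S).
Proof.
move=> SA TA UA.
have -> : S * T * U + U * T * S = (S + U) * T * (S + U) - S * T * S - U * T * U.
  by rewrite !mulrDl !mulrDr; lincomb_with R[i] 'L(H); do ?split; ring.
by apply: inAB; [apply: inAB|]; apply: inA_triple => //; exact: inAD.
Qed.

Lemma inA_exp T n : inA T -> inA (T ^+ n).
Proof.
move=> TA; suff [] : inA (T ^+ n) /\ inA (T ^+ n.+1) by [].
elim: n => [|n [ih1 ih2]]; first by rewrite expr0 expr1; split => //; exact: inA1.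
split => //; rewrite exprS exprSr mulrA; exact: inA_triple.
Qed.

Lemma inA_sum (F : nat -> 'L(H)) n : (forall k, inA (F k)) -> inA (\sum_(k < n) F k).
Proof.
move=> FA; elim: n => [|n ih]; first by rewrite big_ord0; exact: inA0.
by rewrite big_ord_recr; apply: inAD.
Qed.

(** Strong limits are weak limits. *)
Lemma inA_strong_lim (T : nat -> 'L(H)) S : (forall n, inA (T n)) -> strong_lim T S -> inA S.
Proof.
move=> TA TS; apply: wA => B; rewrite nbhsE => -[N1 [ [Q1 Q1o Q1N] N1S] N1B].
pose f := (fun T p => hdot H (T p.1) p.2) : 'L(H) -> {ptws H * H -> R[i]^o}.
have fT : f (T n) @[n --> \oo] --> f S.
  apply/pointwise_cvgP => -[x y] /=; apply/cvgrPdist_lt => e e0.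
  have e0' : 0 < complex.Re e by move: e0; case: e => a b; rewrite ltcE /= => /andP[].
  have y0 := nm_ge0 y; have y1 : 0 < 2 * (nm y + 1) by lra.
  have [N hN] := TS x _ (divr_gt0 e0' y1).
  exists N => // n /= /hN; rewrite ltr_pdivlMr// => h.
  have -> : e = (complex.Re e)%:C by rewrite RRe_real// gtr0_real.
  rewrite nmE ltcR -linearBl.
  apply: (le_lt_trans (nm_ip_le _ _)); rewrite nmC.
  by have := nm_ge0 (T n x - S x); nra.
have : nbhs (f S) Q1 by apply: open_nbhs_nbhs; split => //; rewrite -Q1N in N1S.
move=> /fT[N _ hN]; exists (T N); split; first exact: TA.
by apply: N1B; rewrite -Q1N; apply: hN => /=.
Qed.

End Algebra.

(** * Approximation by operators with finite spectrum *)

Section Spectral.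
Variables (R : realType) (H : hilbertType R) (A : powerAlgebra H).
Local Notation C := R[i].
Implicit Types (x y z : H) (S T U X W Z : 'L(H)).
Hypothesis wA : wot_closed A.
Local Notation inA := (pa_set A).

Lemma inA_bq X n : inA X -> inA (bq X n).
Proof.
move=> XA; elim: n => [|n ih] /=; first exact: inA0.
by apply: inAZ; apply: inAD => //; exact: inA_sq.
Qed.

Lemma strong_lim_comm_l (T : nat -> 'L(H)) S U : strong_lim T S -> strong_lim (fun n => U * T n) (U * S).
Proof. by move=> TS; exact: (strong_limM (fun=> lexx (nm U)) (strong_lim_cst U) TS). Qed.

(** The absolute value of [S] is the square root of [S * S], that is [1 - b] for the
    limit [b] of [bq X] with [X = 1 - S * S]. *)
Lemma abs_exists S : selfadj S -> nm S <= 1 -> inA S -> exists Y, [/\ selfadj Y, forall x, 0 <= qform Y x,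
  Y * Y = S * S, inA Y & forall U, GRing.comm U S -> GRing.comm U Y].
Proof.
move=> Ss S1 SA; set X := 1 - S * S.
have XA : inA X by apply: inAB; [exact: inA1|exact: inA_sq].
have Xs : selfadj X by apply: radjD; [exact: radj1|apply: radjN; exact: radjM].
have rX x : qform X x = nm x ^+ 2 - nm (S x) ^+ 2.
  by rewrite /qform /X op_subE ripDl ripNl ripxx op_mulE Ss ripxx.
have Sx x : nm (S x) ^+ 2 <= nm x ^+ 2.
  rewrite ler_pXn2r ?nnegrE ?nm_ge0// (le_trans (nm_op S x))// ler_piMl ?nm_ge0//.
have X0 x : 0 <= qform X x by rewrite rX subr_ge0.
have X1 : nm X <= 1 ^+ 2.
  rewrite expr1n; apply: contr_pos_nm; split=> // x.
  by rewrite rX gerBl sqr_ge0.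
have [|b [hb bs b1 bE [b0 bc]]] := sqrt_exists_op Xs X0 X1; first by rewrite ler01 lexx.
exists (1 - b); split.
- by apply: radjD; [exact: radj1|exact: radjN].
- move=> x; rewrite /qform op_subE ripDl ripNl ripxx subr_ge0.
  apply: (le_trans (rip_le _ _)); rewrite expr2 ler_wpM2r ?nm_ge0//.
  by rewrite (le_trans (nm_op b x))// ler_piMl ?nm_ge0.
- by rewrite (sqr_one_sub bE) /X opprB addrC subrK.
- by apply: inAB; [exact: inA1|apply: (inA_strong_lim wA _ hb) => n; exact: inA_bq].
- move=> U US; apply: commrB; first exact: commr1.
  by apply: bc; apply: commrB; [exact: commr1|exact: commrM].
Qed.

(** The polar decomposition of a self-adjoint element, with a symmetry in place of a
    partial isometry. Let [T = Y - S] with [Y] the absolute value of [S], and let [P] be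
    the projection on the kernel of [T], obtained as the strong limit of the powers of
    [1 - T^2 / 4]. Then [T * P = 0], and [(Y + S) * T = 0] gives [(Y + S) * P = Y + S];
    so [J = 2 P - 1] satisfies [S * J = Y]. *)
Lemma symmetry_exists S : selfadj S -> nm S <= 1 -> inA S -> exists J Y, [/\ inA J, selfadj J, J * J = 1,
  S * J = Y & [/\ selfadj Y, forall x, 0 <= qform Y x, nm Y <= 1 & forall U, GRing.comm U S -> GRing.comm U J]].
Proof.
move=> Ss S1 SA; have [Y [Ys Y0 YY YA Yc]] := abs_exists Ss S1 SA.
have YS : S * Y = Y * S by exact: (Yc S (commr_refl S)).
have nYx x : nm (Y x) = nm (S x).
  apply/eqP; rewrite -(@eqrXn2 _ 2) ?nm_ge0//; apply/eqP.
  by rewrite -!ripxx Ys Ss -!op_mulE YY.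
have Y1 : nm Y <= 1.
  by apply: nm_op_le => // x; rewrite nYx (le_trans (nm_op S x))// ler_wpM2r ?nm_ge0.
set T := Y - S.
have Ts : selfadj T by apply: radjD => //; exact: radjN.
have TA : inA T by exact: inAB.
have T2 x : nm (T x) <= 2 * nm x.
  have := nm_op Y x; have := nm_op S x; have := nmD (Y x) (- S x); rewrite nmN op_subE.
  have := nm_ge0 x; nra.
pose q : C := (4^-1 : R)%:C.
set B := q *: (T * T); set K := 1 - B.
have BA : inA B by apply: inAZ; exact: inA_sq.
have KA : inA K by apply: inAB => //; exact: inA1.
have Bs : selfadj B by apply: radjZr; exact: radjM.
have Ks : selfadj K by apply: radjD; [exact: radj1|exact: radjN].
have rB x : qform B x = 4^-1 * nm (T x) ^+ 2.
  by rewrite /qform /B op_scaleE ripZl op_mulE Ts ripxx.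
have rK x : qform K x = nm x ^+ 2 - qform B x by rewrite /qform /K op_subE ripDl ripNl ripxx.
have K0 x : 0 <= qform K x.
  rewrite rK rB subr_ge0 ler_pdivrMl//.
  by have := T2 x; have := nm_ge0 (T x); have := nm_ge0 x; nra.
have Kn n := cone_pos Ks K0 (cone_pow K n).
have TK n : GRing.comm T (K ^+ n).
  apply: commrX; apply: commrB; first exact: commr1.
  by rewrite /GRing.comm /B opZl opZr mulrA.
have incr n x : qform (1 - K ^+ n) x <= qform (1 - K ^+ n.+1) x.
  rewrite /qform !op_subE !ripDl lerD2l !ripNl lerN2 -subr_ge0 -ripNl -ripDl -op_subE.
  have -> : K ^+ n - K ^+ n.+1 = q *: (T * K ^+ n * T).
    rewrite exprSr /K mulrBr mulr1 opprB addrC subrK /B opZr mulrA -(TK n).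
    by [].
  rewrite op_scaleE ripZl !op_mulE Ts mulr_ge0//.
  by have [_ h] := Kn n; exact: h.
have cp n : contr_pos (1 - K ^+ n).
  have [kn0 kn1] := Kn n; split.
  - by apply: radjD; [exact: radj1|exact: radjN].
  - move=> x; elim: n {kn0 kn1} => [|n ih]; last exact: le_trans ih (incr n x).
    by rewrite /qform expr0 subrr op_zeroE /rip linear0l.
  - by move=> x; rewrite /qform op_subE ripDl ripNl ripxx gerBl kn1.
have [Q hQ] := increasing_strong_lim cp incr.
pose P := 1 - Q.
have hP : strong_lim (fun n => K ^+ n) P.
  apply: strong_lim_ext (strong_limB (strong_lim_cst 1) hQ) => n.
  by rewrite opprB addrC subrK.
have Kn1 n : nm (K ^+ n) <= 1.
  by apply: contr_pos_nm; have [kn0 kn1] := Kn n; split=> // x; have [_ /(_ x)] := cp n;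
    rewrite /qform op_subE ripDl ripNl ripxx subr_ge0.
have PA : inA P by apply: (inA_strong_lim wA _ hP) => n; exact: inA_exp.
have Ps : selfadj P by apply: (radj_strong_lim hP hP) => n; case: (Kn n).
have KP : K * P = P.
  by apply: strong_lim_uniq (strong_lim_comm_l K hP) _; apply: strong_lim_ext (strong_lim_shift hP) => n;
    rewrite exprS.
have KnP n : K ^+ n * P = P by elim: n => [|n ih]; rewrite ?mul1r// exprSr -mulrA KP.
have PP : P * P = P.
  by apply: strong_lim_uniq (strong_limM Kn1 hP (strong_lim_cst P)) _;
    apply: strong_lim_ext (strong_lim_cst P) => n; rewrite KnP.
have TP : T * P = 0.
  have BP : B * P = 0 by have := KP; rewrite /K mulrBl mul1r => /eqP; rewrite subr_eq addrC -subr_eq subrr => /eqP <-.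
  apply: boundedOpP => x; apply: nm_eq0; apply/eqP; rewrite op_mulE -sqrf_eq0.
  have := rB (P x); rewrite /qform -op_mulE BP op_zeroE /rip linear0l => /esym/eqP.
  by rewrite mulf_eq0 invr_eq0 pnatr_eq0.
have YST : (Y + S) * T = 0.
  rewrite /T mulrDl !mulrBr YY YS.
  by lincomb_with R[i] 'L(H); do ?split; ring.
have YSP : (Y + S) * P = Y + S.
  have YSK n : (Y + S) * K ^+ n = Y + S.
    elim: n => [|n ih]; first by rewrite mulr1.
    by rewrite exprSr mulrA ih /K mulrBr mulr1 /B opZr mulrA YST mul0r scaler0 subr0.
  apply: strong_lim_uniq (strong_lim_comm_l (Y + S) hP) _.
  by apply: strong_lim_ext (strong_lim_cst (Y + S)) => n; rewrite YSK.
have YPE : Y * P = S * P by apply/eqP; rewrite -subr_eq0 -mulrBl TP.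
have SPE : 2 *: (S * P) = Y + S by rewrite -YSP mulrDl YPE scaler_nat.
have Pc U : GRing.comm U S -> GRing.comm U P.
  move=> US; apply: (strong_lim_comm Kn1 hP) => n; apply: commrX; apply: commrB; first exact: commr1.
  have UT : GRing.comm U T by apply: commrB => //; exact: Yc.
  by rewrite /GRing.comm /B opZl opZr (commrM UT UT).
exists (2 *: P - 1), Y; split.
- by apply: inAB; [exact: inAZ|exact: inA1].
- apply: radjD; last by apply: radjN; exact: radj1.
  have -> : 2 = (2 : R)%:C :> C by rewrite rmorph_nat.
  exact: radjZr.
- rewrite mulrBl !mulrBr opZl opZr PP mul1r !mulr1.
  by lincomb_with R[i] 'L(H); do ?split; ring.
- rewrite mulrBr mulr1 opZr SPE addrK//.
- split => // U US; apply: commrB; last exact: commr1.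
  by rewrite /GRing.comm opZl opZr Pc.
Qed.

Definition real_spectrum W (F : seq R) := forall m : C, (forall r, r \in F -> m != r%:C) ->
  invertible (W - m *: (1 : 'L(H))).

Lemma invertibleP T : invertible T <-> exists V, T * V = 1 /\ V * T = 1.
Proof. by []. Qed.

(** Inverse of an operator that is block diagonal for the complementary projections [P]
    and [Q]. *)
Lemma block_inverse (K : pzRingType) (P Q B1 B2 V1 V2 : K) : P + Q = 1 ->
  P * Q = 0 -> Q * P = 0 -> P * P = P -> Q * Q = Q ->
  P * V1 = V1 * P -> P * V2 = V2 * P -> Q * V1 = V1 * Q -> Q * V2 = V2 * Q ->
  B1 * V1 = 1 -> B2 * V2 = 1 -> (B1 * P + B2 * Q) * (V1 * P + V2 * Q) = 1.
Proof.
move=> PQ PQ0 QP0 PP QQ c1 c2 c3 c4 h1 h2.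
rewrite mulrDl !mulrDr -!mulrA (mulrA P V1) c1 (mulrA P V2) c2 (mulrA Q V1) c3 (mulrA Q V2) c4.
by rewrite -!mulrA PP PQ0 QP0 QQ !mulr0 addr0 add0r !mulrA h1 h2 !mul1r.
Qed.

(** With [J] as in [symmetry_exists] and [Y] the absolute value of [S], the operator
    [2 S - J = J (2 Y - 1)] is again a contraction, because [0 <= Y <= 1]. If [W'] is
    an approximation of it, then [(W' + J) / 2] is one of [S] with half the error.
    Since [J] commutes with [W'], the space splits into the two eigenspaces of [J], on
    which [(W' + J) / 2] is [(W' + 1) / 2] and [(W' - 1) / 2]. *)
Lemma spectral_approx n S : selfadj S -> nm S <= 1 -> inA S -> exists W F, [/\ inA W,
  nm (S - W) <= 2^-1 ^+ n, real_spectrum W F & forall U, GRing.comm U S -> GRing.comm U W].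
Proof.
elim: n S => [|n ih] S Ss S1 SA.
  exists 0, [:: 0]; split; [exact: inA0|by rewrite subr0 expr0| |by move=> U _; exact: commr0].
  move=> m /(_ 0 (mem_head _ _)) m0; apply/invertibleP; exists (- m^-1 *: (1 : 'L(H))).
  by rewrite sub0r -scaleNr; split; rewrite opZl mul1r scalerA mulrNN ?divff ?mulVf ?scale1r.
have [J [Y [JA Js JJ SJ [Ys Y0 Y1 Jc]]]] := symmetry_exists Ss S1 SA.
have SJc : J * S = S * J by exact/esym/(Jc S (commr_refl S)).
pose S' := 2 *: S - J.
have S'A : inA S' by apply: inAB => //; exact: inAZ.
have two : 2 = (2 : R)%:C :> C by rewrite rmorph_nat.
have S's : selfadj S' by apply: radjD; [rewrite two; exact: radjZr|exact: radjN].
have nJ x : nm (J x) = nm x.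
  apply/eqP; rewrite -(@eqrXn2 _ 2) ?nm_ge0//; apply/eqP.
  by rewrite -!ripxx Js -op_mulE JJ.
have Ycp : contr_pos Y.
  split => // x; rewrite (le_trans (rip_le _ _))// expr2 ler_wpM2r ?nm_ge0//.
  by rewrite (le_trans (nm_op Y x))// ler_piMl ?nm_ge0.
have S'1 : nm S' <= 1.
  have -> : S' = J * (2 *: Y - 1).
    by rewrite -SJ mulrBr mulr1 opZr mulrA SJc -mulrA JJ mulr1.
  apply: nm_op_le => // x; rewrite op_mulE nJ mul1r.
  rewrite -(ler_pXn2r (n := 2)) ?nnegrE ?nm_ge0// op_subE op_scaleE nm_sub_sqr nmZ nm_nat.
  rewrite two ripZl; have := contr_pos_sq Ycp x; rewrite /qform op_oneE.
  by rewrite exprMn; lra.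
have [W' [F [W'A SW' W'F W'c]]] := ih S' S's S'1 S'A.
have JS' : GRing.comm J S'.
  by apply: commrB; [rewrite /GRing.comm opZl opZr SJc|exact: commr_refl].
have JW' := W'c J JS'.
pose W := half R *: (W' + J).
exists W, ([seq (r + 1) / 2 | r <- F] ++ [seq (r - 1) / 2 | r <- F]); split.
- by apply: inAZ; exact: inAD.
- have -> : S - W = half R *: (S' - W').
    by rewrite /W /S' halfE; lincomb_with R[i] 'L(H); do ?split; field.
  by rewrite nm_half exprSr ler_pdivrMr// -mulrA mulVf ?mulr1// pnatr_eq0.
- move=> m mF.
  have [|V1 [h1 k1]] := W'F (2 * m - 1).
    move=> r rF; apply/eqP => e.
    have /mF/eqP : (r + 1) / 2 \in [seq (r + 1) / 2 | r <- F] ++ [seq (r - 1) / 2 | r <- F].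
      by rewrite mem_cat (map_f (fun r => (r + 1) / 2) rF).
    apply.
    rewrite rmorphM rmorphD /= fmorphV rmorph_nat rmorph1 -e subrK mulrAC divff ?mul1r// pnatr_eq0.
  have [|V2 [h2 k2]] := W'F (2 * m + 1).
    move=> r rF; apply/eqP => e.
    have /mF/eqP : (r - 1) / 2 \in [seq (r + 1) / 2 | r <- F] ++ [seq (r - 1) / 2 | r <- F].
      by rewrite mem_cat (map_f (fun r => (r - 1) / 2) rF) orbT.
    apply.
    rewrite rmorphM rmorphB /= fmorphV rmorph_nat rmorph1 -e addrK mulrAC divff ?mul1r// pnatr_eq0.
  set B1 := W' - (2 * m - 1) *: (1 : 'L(H)) in h1 k1; set B2 := W' - (2 * m + 1) *: (1 : 'L(H)) in h2 k2.
  rewrite -/(B1 * V1) in h1; rewrite -/(V1 * B1) in k1; rewrite -/(B2 * V2) in h2; rewrite -/(V2 * B2) in k2.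
  pose P := half R *: (1 + J); pose Q := half R *: (1 - J).
  have PQ : P + Q = 1 by rewrite /P /Q halfE; lincomb_with R[i] 'L(H); do ?split; field.
  have PQ0 : P * Q = 0.
    rewrite /P /Q opZl opZr mulrDl !mulrBr JJ !mul1r mulr1.
    by lincomb_with R[i] 'L(H); do ?split; ring.
  have QP0 : Q * P = 0.
    rewrite /P /Q opZl opZr mulrBl !mulrDr JJ !mul1r mulr1.
    by lincomb_with R[i] 'L(H); do ?split; ring.
  have JB (c : C) : J * (W' - c *: (1 : 'L(H))) = (W' - c *: (1 : 'L(H))) * J.
    by rewrite mulrBr mulrBl JW' opZr opZl mul1r mulr1.
  have JV (B V : 'L(H)) : J * B = B * J -> B * V = 1 -> V * B = 1 -> J * V = V * J.
    by move=> jb bv vb; rewrite -[LHS]mul1r -vb -mulrA (mulrA B) -jb -(mulrA J) bv mulr1.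
  have JV1 := JV _ _ (JB _) h1 k1; have JV2 := JV _ _ (JB _) h2 k2.
  have cP U : J * U = U * J -> P * U = U * P.
    by move=> h; rewrite /P opZl opZr mulrDl mulrDr mul1r mulr1 h.
  have cQ U : J * U = U * J -> Q * U = U * Q.
    by move=> h; rewrite /Q opZl opZr mulrBl mulrBr mul1r mulr1 h.
  have PP : P * P = P by rewrite -[in RHS](mulr1 P) -PQ mulrDr PQ0 addr0.
  have QQ : Q * Q = Q by rewrite -[in RHS](mulr1 Q) -PQ mulrDr QP0 add0r.
  have WE : W - m *: (1 : 'L(H)) = half R *: (B1 * P + B2 * Q).
    rewrite /B1 /B2 /P /Q /W !halfE !mulrDl !mulNr !opZr !opZl !mulrDr !mulrN !mulr1 ?mul1r.
    by lincomb_with R[i] 'L(H); do ?split; field.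
  apply/invertibleP; exists (2 *: (V1 * P + V2 * Q)); rewrite WE.
  have cancel2 U : half R *: (2 *: U) = U by rewrite halfE scalerA mulVf ?scale1r// pnatr_eq0.
  have c1 := cP _ JV1; have c2 := cP _ JV2; have c3 := cQ _ JV1; have c4 := cQ _ JV2.
  split.
    rewrite -/(_ * _) opZl opZr cancel2.
    exact: (block_inverse PQ PQ0 QP0 PP QQ c1 c2 c3 c4 h1 h2).
  rewrite -/(_ * _) opZr opZl cancel2.
  exact: (block_inverse PQ PQ0 QP0 PP QQ (cP _ (JB _)) (cP _ (JB _)) (cQ _ (JB _)) (cQ _ (JB _)) k1 k2).
- move=> U US; have UJ := Jc U US.
  have US' : GRing.comm U S' by apply: commrB => //; rewrite /GRing.comm opZl opZr US.
  by rewrite /GRing.comm /W opZl opZr (commrD (W'c U US') UJ).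
Qed.

End Spectral.

(** * Unitary-valued discs through a contraction *)

Section Moebius.
Variables (R : realType) (H : hilbertType R) (A : powerAlgebra H).
Local Notation C := R[i].
Implicit Types (x y z : H) (S T U V W Z a b : 'L(H)).
Hypothesis wA : wot_closed A.
Local Notation inA := (pa_set A).

Section Pairs.
Variables Z Z' : 'L(H).
Hypotheses (ZA : inA Z) (Z'A : inA Z').

(** Pairs of the form [p (Z Z')], [p (Z' Z)] for a polynomial [p]. Neither component
    need belong to the algebra, but [a * W * b] does when [W] does. *)
Inductive poly_pair : 'L(H) -> 'L(H) -> Prop :=
  | poly_pair_pow m : poly_pair ((Z * Z') ^+ m) ((Z' * Z) ^+ m)
  | poly_pairD a b a' b' : poly_pair a b -> poly_pair a' b' -> poly_pair (a + a') (b + b')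
  | poly_pairZ (c : C) a b : poly_pair a b -> poly_pair (c *: a) (c *: b).

Lemma poly_pairM a b a' b' : poly_pair a b -> poly_pair a' b' -> poly_pair (a * a') (b * b').
Proof.
move=> ab; elim: ab a' b' => [m|a1 b1 a2 b2 _ h1 _ h2|c a1 b1 _ h1] a' b' ab'.
- elim: ab' => [k|a1 b1 a2 b2 _ h1 _ h2|c a1 b1 _ h1].
  + by rewrite -!exprD; exact: poly_pair_pow.
  + by rewrite !mulrDr; exact: poly_pairD.
  + by rewrite !opZr; exact: poly_pairZ.
- by rewrite !mulrDl; apply: poly_pairD; [exact: h1|exact: h2].
- by rewrite !opZl; apply: poly_pairZ; exact: h1.
Qed.

Lemma exp_swap (K : pzRingType) (a b : K) m : a * (b * a) ^+ m = (a * b) ^+ m * a.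
Proof.
elim: m => [|m ih]; first by rewrite !expr0 mul1r mulr1.
by rewrite exprSr mulrA ih exprSr !mulrA.
Qed.

(** An alternating product of odd length is a triple product [Z * Y * Z] with [Y] a
    shorter one. *)
Lemma inA_alternating m : inA ((Z * Z') ^+ m * Z) /\ inA ((Z' * Z) ^+ m * Z').
Proof.
elim: m => [|m [ih1 ih2]]; first by rewrite !expr0 !mul1r.
split.
  have -> : (Z * Z') ^+ m.+1 * Z = Z * ((Z' * Z) ^+ m * Z') * Z by rewrite -exp_swap exprSr !mulrA.
  exact: inA_triple.
have -> : (Z' * Z) ^+ m.+1 * Z' = Z' * ((Z * Z') ^+ m * Z) * Z' by rewrite -exp_swap exprSr !mulrA.
exact: inA_triple.
Qed.

(** For monomials this is the polarized triple product of [Z], an alternating product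
    and [W]. *)
Lemma inA_pair_sum a b W : poly_pair a b -> inA W -> inA (a * W + W * b).
Proof.
move=> ab WA; elim: ab => [[|m]|a1 b1 a2 b2 _ h1 _ h2|c a1 b1 _ h1].
- by rewrite !expr0 mul1r mulr1; apply: inAD.
- have [_ YA] := inA_alternating m.
  have -> : (Z * Z') ^+ m.+1 * W = Z * ((Z' * Z) ^+ m * Z') * W by rewrite mulrA exp_swap exprSr !mulrA.
  have -> : W * (Z' * Z) ^+ m.+1 = W * ((Z' * Z) ^+ m * Z') * Z by rewrite exprSr !mulrA.
  exact: inA_triple2.
- have -> : (a1 + a2) * W + W * (b1 + b2) = (a1 * W + W * b1) + (a2 * W + W * b2).
    by rewrite mulrDl mulrDr addrACA.
  exact: inAD.
- by rewrite opZl opZr -scalerDr; apply: inAZ.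
Qed.

(** Apply [inA_pair_sum] to the pairs [a, b] and [a * a, b * b]. *)
Lemma inA_pair_mul a b W : poly_pair a b -> inA W -> inA (a * W * b).
Proof.
move=> ab WA.
have -> : a * W * b = half R *: ((a * (a * W + W * b) + (a * W + W * b) * b) - ((a * a) * W + W * (b * b))).
  by rewrite halfE !mulrDl !mulrDr !mulrA; lincomb_with R[i] 'L(H); do ?split; field.
apply: inAZ; apply: inAB; apply: inA_pair_sum => //; first exact: inA_pair_sum.
exact: poly_pairM.
Qed.

Lemma poly_pair_bq n : poly_pair (bq (Z * Z') n) (bq (Z' * Z) n).
Proof.
elim: n => [|n ih] /=.
  by have := poly_pairZ 0 (poly_pair_pow 0); rewrite !scale0r.
apply: poly_pairZ; apply: poly_pairD; last exact: poly_pairM.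
exact: (poly_pair_pow 1).
Qed.

Lemma inA_defect_mul b' b W K : (forall n, nm (bq (Z * Z') n) <= K) ->
  strong_lim (bq (Z * Z')) b' -> strong_lim (bq (Z' * Z)) b -> inA W -> inA ((1 - b') * W * (1 - b)).
Proof.
move=> bK hb' hb WA.
have h1 := strong_limB (strong_lim_cst 1) hb'; have h2 := strong_limB (strong_lim_cst 1) hb.
have h3 := strong_limM (K := (1 + K) * nm W) _ (strong_limM (K := 1 + K) _ h1 (strong_lim_cst W)) h2.
apply: (inA_strong_lim wA _ (h3 _ _)) => n.
- apply: inA_pair_mul => //.
  have p1 := poly_pair_pow 0; have p2 := poly_pairZ (- 1) (poly_pair_bq n).
  by have := poly_pairD p1 p2; rewrite !scaleN1r.
- rewrite (le_trans (nm_mul _ _))// ler_wpM2r ?nm_ge0// (le_trans (nmD _ _))// nmN lerD//.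
  exact: nm_one_le.
- rewrite (le_trans (nmD _ _))// nmN lerD//; exact: nm_one_le.
Qed.

End Pairs.

(** Let [D] and [D'] be the defect operators [1 - b] and [1 - b'], the square roots of
    [1 - Z' Z] and of [1 - Z Z']. The relation [D' Z = Z D] implies Julia's identity:
    the norms of [Z x + D' w] and [D x - Z' w] have the same sum of squares as those of
    [x] and [w]. Take [w] to be [m] times [V (D x)]: the second vector is then
    [V (D x)], of the same norm as [w]. *)
Lemma julia Z Z' b b' V (m : C) x : radj Z Z' -> selfadj b -> selfadj b' ->
  (1 - b) * (1 - b) = 1 - Z' * Z -> (1 - b') * (1 - b') = 1 - Z * Z' ->
  b' * Z = Z * b -> (1 + m *: Z') * V = 1 -> nm m = 1 ->
  nm ((Z + m *: ((1 - b') * V * (1 - b))) x) = nm x.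
Proof.
move=> ZZ' bs bs' D2 D2' inter hV m1.
set D := 1 - b in D2 *; set D' := 1 - b' in D2' *.
have Ds : selfadj D by apply: radjD; [exact: radj1|exact: radjN].
have Ds' : selfadj D' by apply: radjD; [exact: radj1|exact: radjN].
have DZ : D' * Z = Z * D by rewrite mulrBl mulrBr mul1r mulr1 inter.
pose y := V (D x); pose w := m *: y.
have E1 : (Z + m *: (D' * V * D)) x = Z x + D' w.
  by rewrite op_addE op_scaleE !op_mulE boundedOpZ.
have E2 : D x - Z' w = y.
  have := congr1 (fun T : 'L(H) => T (D x)) hV.
  rewrite op_mulE -/y op_oneE op_addE op_scaleE op_oneE => <-.
  by rewrite /w boundedOpZ addrK.
have nw : nm w = nm y by rewrite nmZ m1 mul1r.
have sq (S T U : 'L(H)) u : radj T S -> selfadj U -> U * U = 1 - S * T -> nm (U u) ^+ 2 = nm u ^+ 2 - nm (T u) ^+ 2.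
  move=> ST Us UU; rewrite -!ripxx Us -op_mulE UU op_subE ripDr ripNr op_mulE.
  by rewrite -ST.
have e1 := sq _ _ _ x ZZ' Ds D2; have e2 := sq _ _ _ w (radj_sym ZZ') Ds' D2'.
have e3 : rip (Z x) (D' w) = rip (D x) (Z' w).
  by rewrite -Ds' -op_mulE DZ op_mulE ZZ'.
apply/eqP; rewrite -(@eqrXn2 _ 2) ?nm_ge0//; apply/eqP.
have e4 : nm (D x - Z' w) ^+ 2 = nm w ^+ 2 by rewrite E2 nw.
rewrite nm_sub_sqr -e3 in e4; rewrite E1 nm_add_sqr; lra.
Qed.

(** If [U] is isometric with adjoint [V], then [1 - V * U] has zero quadratic form. *)
Lemma unitary_invertible S T : radj S T -> (forall x, nm (S x) = nm x) ->
  (forall x, nm (T x) = nm x) -> invertible S.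
Proof.
have key (U V : 'L(H)) : radj U V -> (forall x, nm (U x) = nm x) -> V * U = 1.
  move=> UV iso; apply/eqP; rewrite eq_sym -subr_eq0; apply/eqP.
  have r0 x : qform (1 - V * U) x = 0.
    by rewrite /qform op_subE ripDl ripNl op_mulE op_oneE (radj_sym UV) !ripxx iso subrr.
  have cp : contr_pos (1 - V * U).
    split=> [|x|x]; rewrite ?r0 ?sqr_ge0//.
    by apply: radjD; [exact: radj1|apply: radjN; apply: radjM => //; exact: radj_sym].
  apply: boundedOpP => x; apply: nm_eq0; apply/eqP; rewrite -sqrf_eq0.
  by rewrite eq_le sqr_ge0 -(r0 x) contr_pos_sq.
move=> ST Si Ti; exists T; split; last exact: key.
exact: (key T S (radj_sym ST) Ti).
Qed.

Lemma neumann_shift T : nm T < 1 -> exists U, [/\ (1 + T) * U = 1, U * (1 + T) = 1,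
  nm U <= (1 - nm T)^-1 & inA T -> inA U].
Proof.
move=> T1; have [|U [h1 h2 h3 h4]] := @neumann R H (- T); first by rewrite nmN.
rewrite opprK nmN in h1 h2 h3; exists U; split=> // TA; apply: (inA_strong_lim wA _ h4) => n.
by apply: inA_sum => k; apply: inA_exp; exact: inAN.
Qed.

Section Family.
Variables (Z Z' : 'L(H)) (q r : R).
Hypotheses (ZA : inA Z) (Z'A : inA Z') (ZZ' : radj Z Z') (q0 : 0 <= q) (Zq : nm Z <= q).
Hypotheses (r1 : 1 < r) (qr : r * q < 1).

Lemma q_lt1 : q < 1.
Proof. by rewrite -(mul1r q) (le_lt_trans _ qr)// ler_wpM2r// ltW. Qed.

(** [b] is the limit of the iteration for [X], so that [1 - b] is the square root of
    [1 - X]. *)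
Definition is_defect X b := [/\ strong_lim (bq X) b, selfadj b, nm b <= q & b = half R *: (X + b * b)].

Lemma defect_exists S S' : radj S S' -> nm S <= q -> exists b, is_defect (S' * S) b.
Proof.
move=> SS' Sq; have S'q := le_trans (radj_nm SS') Sq; have q1 := q_lt1.
have [|x||//|b [h1 h2 h3 h4 _]] := @sqrt_exists_op R H (S' * S) q.
- by apply: radjM => //; exact: radj_sym.
- by rewrite /qform op_mulE (radj_sym SS') ripxx sqr_ge0.
- rewrite (le_trans (nm_mul _ _))//; have := nm_ge0 S; have := nm_ge0 S'; nra.
- by rewrite q0 ltW.
by exists b.
Qed.

Lemma defect_comm S S' b b' : is_defect (S' * S) b -> is_defect (S * S') b' -> nm S <= q -> nm S' <= q ->
  b' * S = S * b.
Proof.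
move=> [h1 _ _ _] [h2 _ _ _] Sq S'q; have q1 := q_lt1.
have bK n : nm (bq (S * S') n) <= q.
  apply: bq_nm; last by rewrite q0 ltW.
  rewrite (le_trans (nm_mul _ _))//; have := nm_ge0 S; have := nm_ge0 S'; nra.
apply: strong_lim_uniq (strong_limM bK h2 (strong_lim_cst S)) _.
apply: strong_lim_ext (strong_lim_comm_l S h1) => n.
elim: n => [|n ih] /=; first by rewrite mul0r mulr0.
rewrite opZl opZr mulrDl mulrDr; congr (_ *: (_ + _)); first by rewrite mulrA.
by rewrite mulrA ih -mulrA ih mulrA.
Qed.

(** Subtract the fixed point equations of [b] and [c], whose norms are at most
    [q < 1]. *)
Lemma defect_lip X Y b c : is_defect X b -> is_defect Y c ->
  nm (b - c) <= (1 - q)^-1 * nm (X - Y).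
Proof.
move=> [_ _ bq_ bE] [_ _ cq cE]; have q1 := q_lt1.
have E : b - c = half R *: ((X - Y) + (b * (b - c) + (b - c) * c)).
  rewrite {1}bE {1}cE mulrBl mulrBr; lincomb_with R[i] 'L(H); do ?split; ring.
rewrite ler_pdivlMl ?subr_gt0//.
have := nmD (X - Y) (b * (b - c) + (b - c) * c).
have := nmD (b * (b - c)) ((b - c) * c).
have := nm_mul b (b - c); have := nm_mul (b - c) c.
have k : nm (b - c) = nm ((X - Y) + (b * (b - c) + (b - c) * c)) / 2 by rewrite {1}E nm_half.
have := nm_ge0 (X - Y); have := nm_ge0 (b - c); have := nm_ge0 b; have := nm_ge0 c; nra.
Qed.

Let K := (1 - r * q)^-1.

Lemma K_gt0 : 0 < K. Proof. by rewrite invr_gt0 subr_gt0. Qed.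

Lemma resolvent_exists S : inA S -> nm S <= q -> exists V : C -> 'L(H), forall m : C, nm m < r ->
  [/\ (1 + m *: S) * V m = 1, V m * (1 + m *: S) = 1, nm (V m) <= K & inA (V m)].
Proof.
move=> SA Sq; suff h (m : C) : exists V : 'L(H), nm m < r ->
    [/\ (1 + m *: S) * V = 1, V * (1 + m *: S) = 1, nm V <= K & inA V].
  by have [V VP] := choice h; exists V.
have [mr|] := ltP (nm m) r; last by exists 0 => ?; exfalso; lra.
have mS : nm (m *: S) <= r * q.
  by rewrite nmZ; have := nm_ge0 m; have := nm_ge0 S; nra.
have [|V [h1 h2 h3 h4]] := @neumann_shift (m *: S); first exact: le_lt_trans mS qr.
exists V => _; split=> //; last by apply: h4; exact: inAZ.
apply: (le_trans h3); rewrite /K lef_pV2 ?posrE ?subr_gt0//; first by rewrite lerD2l lerN2.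
exact: le_lt_trans mS qr.
Qed.

Lemma resolvent_sub S V W (a c : C) : (1 + c *: S) * W = 1 -> V * (1 + a *: S) = 1 ->
  V - W = (c - a) *: (V * S * W).
Proof.
move=> h1 h2; have e1 : V * ((1 + c *: S) * W) = V by rewrite h1 mulr1.
have e2 : V * (1 + a *: S) * W = W by rewrite h2 mul1r.
rewrite -{1}e1 -{2}e2 mulrA !mulrDr !mulrDl !mulr1 !opZr !opZl.
by lincomb_with R[i] 'L(H); do ?split; ring.
Qed.

Lemma nm_mul3 (S T U : 'L(H)) (u v w : R) : nm S <= u -> nm T <= v -> nm U <= w ->
  nm (S * T * U) <= u * v * w.
Proof.
move=> Su Tv Uw; rewrite (le_trans (nm_mul _ _))// ler_pM ?nm_ge0//.
by rewrite (le_trans (nm_mul _ _))// ler_pM ?nm_ge0.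
Qed.

Lemma nm_sub3 (a b c a' b' c' : 'L(H)) (e d k : R) : nm c <= 2 -> nm a' <= 2 ->
  nm b <= k -> nm b' <= k -> nm (a - a') <= e -> nm (c - c') <= e -> nm (b - b') <= d ->
  nm (a * b * c - a' * b' * c') <= 4 * k * e + 4 * d.
Proof.
move=> h1 h2 h3 h4 h5 h6 h7.
have -> : a * b * c - a' * b' * c' = (a - a') * b * c + a' * (b - b') * c + a' * b' * (c - c').
  by rewrite !mulrBl !mulrBr ?mulrBl; lincomb_with R[i] 'L(H); do ?split; ring.
have := nmD ((a - a') * b * c + a' * (b - b') * c) (a' * b' * (c - c')).
have := nmD ((a - a') * b * c) (a' * (b - b') * c).
have := nm_mul3 h5 h3 h1; have := nm_mul3 h2 h7 h1; have := nm_mul3 h2 h4 h6; lra.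
Qed.

(** The parameter [t] deforms [Z] to [0]: for [nm m = 1] the path [T t m] joins
    [m *: 1] to the boundary value [T 1 m] through unitary operators. *)
Lemma moebius_family : exists T : R -> C -> 'L(H),
  [/\ T 1 0 = Z, forall m : C, nm m < r -> T 0 m = m *: (1 : 'L(H)),
    forall (t : R) (m : C), 0 <= t <= 1 -> nm m < r -> inA (T t m),
    forall m : C, nm m < r -> exists2 d, inA d & dif (T 1) m d &
    forall m : C, nm m = 1 ->
      (forall t : R, 0 <= t <= 1 -> nm (T t m) <= 1 /\ invertible (T t m)) /\
      exists L : R, forall s t : R, 0 <= s <= 1 -> 0 <= t <= 1 -> nm (T t m - T s m) <= L * `|t - s|].
Proof.
have q1 := q_lt1; have K0 := K_gt0.
have Z'q : nm Z' <= q by exact: le_trans (radj_nm ZZ') Zq.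
have nt S (t : R) : nm S <= q -> 0 <= t <= 1 -> nm (t%:C *: S) <= q.
  by move=> Sq /andP[t0 t1]; rewrite nmZ nmR ger0_norm//; have := nm_ge0 S; nra.
have adj t : radj (t%:C *: Z) (t%:C *: Z') by exact: radjZr.
have ex_b (t : R) : exists c : 'L(H), 0 <= t <= 1 -> is_defect ((t%:C *: Z') * (t%:C *: Z)) c.
  case: (boolP (0 <= t <= 1)) => [t01|_]; last by exists 0.
  by have [c cP] := defect_exists (adj t) (nt _ _ Zq t01); exists c.
have ex_b' (t : R) : exists c : 'L(H), 0 <= t <= 1 -> is_defect ((t%:C *: Z) * (t%:C *: Z')) c.
  case: (boolP (0 <= t <= 1)) => [t01|_]; last by exists 0.
  by have [c cP] := defect_exists (radj_sym (adj t)) (nt _ _ Z'q t01); exists c.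
have [b bP] := choice ex_b; have [b' b'P] := choice ex_b'.
have [V VP] := resolvent_exists Z'A Z'q; have [V' V'P] := resolvent_exists ZA Zq.
have tm (t : R) (m : C) : 0 <= t <= 1 -> nm m < r -> nm (m * t%:C) < r.
  by move=> /andP[t0 t1] mr; rewrite nmM nmR ger0_norm//; have := nm_ge0 m; nra.
pose T (t : R) (m : C) := t%:C *: Z + m *: ((1 - b' t) * V (m * t%:C) * (1 - b t)).
have t1 : 0 <= (1 : R) <= 1 by rewrite ler01 lexx.
have t0 : 0 <= (0 : R) <= 1 by rewrite ler01 lexx.
have nD (c : 'L(H)) : nm c <= q -> nm (1 - c) <= 2.
  by move=> cq; have := nmD (1 : 'L(H)) (- c); have := @nm_one_le R H; rewrite nmN; lra.
exists T; split.
- by rewrite /T scale0r addr0 scale1r.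
- move=> m mr; rewrite /T scale0r add0r mulr0.
  have r0 : 0 < r by exact: lt_trans ltr01 r1.
  have [|e1 _ _ _] := VP 0; first by rewrite nm0.
  rewrite scale0r addr0 mul1r in e1; rewrite e1 mulr1.
  have z0 c : is_defect 0 c -> c = 0.
    move=> [h _ _ _]; apply: strong_lim_uniq h _; apply: strong_lim_ext (strong_lim_cst 0).
    by elim=> [|n /= <-]//; rewrite mulr0 addr0 scaler0.
  have -> : b 0 = 0 by apply: z0; have := bP 0 t0; rewrite scale0r mul0r.
  have -> : b' 0 = 0 by apply: z0; have := b'P 0 t0; rewrite scale0r mul0r.
  by rewrite subr0 mulr1.
- move=> t m t01 mr; have [_ _ _ VA] := VP _ (tm _ _ t01 mr).
  have [h1 _ _ _] := bP t t01; have [h2 _ _ _] := b'P t t01.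
  apply: inAD; [exact: inAZ|apply: inAZ].
  apply: (inA_defect_mul (K := q) (inAZ t%:C ZA) (inAZ t%:C Z'A) _ h2 h1 VA) => n.
  apply: bq_nm; last by rewrite q0 ltW.
  rewrite (le_trans (nm_mul _ _))// expr2 ler_pM ?nm_ge0//; exact: nt.
- move=> z zr; set D := 1 - b 1; set D' := 1 - b' 1.
  have [e1 e2 nW WA] := VP z zr.
  have [h1 _ _ _] := bP 1 t1; have [h2 _ _ _] := b'P 1 t1.
  exists (D' * (V z * V z) * D).
    rewrite scale1r in h1 h2.
    apply: (inA_defect_mul (K := q) ZA Z'A _ _ _ (inA_sq WA)).
    + move=> n; apply: bq_nm; last by rewrite q0 ltW.
      by rewrite (le_trans (nm_mul _ _))// expr2 ler_pM ?nm_ge0.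
    + by rewrite scale1r in h2.
    + by rewrite scale1r in h1.
  move=> e e0; pose M := nm D' * (K * q * (K * K)) * nm D.
  have M0 : 0 <= M by rewrite /M !mulr_ge0 ?nm_ge0 ?(ltW K0).
  have M1 : 0 < M + 1 by lra.
  exists (Num.min (r - nm z) (e / (M + 1))); first by rewrite lt_min subr_gt0 zr divr_gt0.
  move=> h; rewrite lt_min ltr_pdivlMr// => /andP[hr he].
  have [|c1 c2 nV _] := VP (z + h); first by have := nmD z h; lra.
  rewrite /T !mulr1.
  have rs := resolvent_sub e1 c2.
  set W := V z in e1 e2 nW WA rs *; set Vc := V (z + h) in c1 c2 nV rs *.
  have zQ : z *: (Vc * Z' * W) = Vc - Vc * W.
    have zW : (z *: Z') * W = 1 - W.
      by apply/eqP; rewrite eq_sym subr_eq addrC -[X in _ == X + _]mul1r -mulrDl e1.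
    by rewrite -mulrA -opZr -opZl zW mulrBr mulr1.
  have hQ : h *: (Vc * Z' * W) = W - Vc.
    by rewrite -[RHS]opprB rs opprD addNKr scaleNr opprK.
  have a1 : z *: (W - Vc) = h *: (Vc - Vc * W) by rewrite -hQ -zQ !scalerA mulrC.
  have a2 : (- h ^+ 2) *: (Vc * Z' * (W * W)) = - (h *: ((W - Vc) * W)).
    by rewrite -hQ opZl scalerA scaleNr expr2 mulrA.
  have -> : (1%:C *: Z + (z + h) *: (D' * Vc * D)) - (1%:C *: Z + z *: (D' * W * D)) - h *: (D' * (W * W) * D)
    = (- h ^+ 2) *: (D' * (Vc * Z' * (W * W)) * D).
    rewrite (_ : - h ^+ 2 *: (D' * (Vc * Z' * (W * W)) * D) =
      D' * ((- h ^+ 2) *: (Vc * Z' * (W * W))) * D); last by rewrite opZr opZl.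
    rewrite a2.
    have -> : (z + h) *: (D' * Vc * D) = D' * ((z + h) *: Vc) * D by rewrite opZr opZl.
    have -> : z *: (D' * W * D) = D' * (z *: W) * D by rewrite opZr opZl.
    have -> : h *: (D' * (W * W) * D) = D' * (h *: (W * W)) * D by rewrite opZr opZl.
    rewrite opprD addrACA subrr add0r -!mulrBl -!mulrBr; congr (_ * _ * _).
    have -> : (z + h) *: Vc - z *: W = h *: Vc - z *: (W - Vc).
      by lincomb_with R[i] 'L(H); do ?split; ring.
    by rewrite a1 mulrBl; lincomb_with R[i] 'L(H); do ?split; ring.
  rewrite nmZ nmN nmX.
  have : nm (D' * (Vc * Z' * (W * W)) * D) <= M.
    apply: nm_mul3 => //; apply: nm_mul3 => //.
    by rewrite (le_trans (nm_mul _ _))// ler_pM ?nm_ge0.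
  by have := nm_ge0 h; move: he M0; clear; nra.
- move=> m m1; have mr : nm m < r by rewrite m1.
  split.
    move=> t t01; have mtr := tm t m t01 mr.
    have mc : nm ((m * t%:C)^*) = nm (m * t%:C) by rewrite /nm norm_conjC.
    have [c1 c2 _ _] := VP _ mtr.
    have [|k1 k2 _ _] := V'P (m * t%:C)^*; first by rewrite mc.
    have cm : (m * t%:C)^* = m^* * t%:C.
      by rewrite rmorphM; congr (_ * _); apply/eqP; rewrite eq_complex /= oppr0 !eqxx.
    have VV : radj (V (m * t%:C)) (V' (m * t%:C)^*).
      have h := radj_sym (radjD (@radj1 R H) (radjZ (m * t%:C) (radj_sym ZZ'))).
      move=> x y; have {1}-> : y = (1 + (m * t%:C)^* *: Z) (V' (m * t%:C)^* y).
        by rewrite -op_mulE k1.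
      by rewrite -(radj_sym h) -op_mulE c1.
    have [d1 d2 d3 d4] := bP t t01; have [d1' d2' d3' d4'] := b'P t t01.
    have i1 := defect_comm (bP t t01) (b'P t t01) (nt _ _ Zq t01) (nt _ _ Z'q t01).
    have i2 := defect_comm (b'P t t01) (bP t t01) (nt _ _ Z'q t01) (nt _ _ Zq t01).
    have s1 := sqr_one_sub d4; have s2 := sqr_one_sub d4'.
    have iso x : nm (T t m x) = nm x.
      by apply: (julia x (adj t) d2 d2' s1 s2 i1 _ m1); rewrite scalerA.
    have m1' : nm (m^*) = 1 by rewrite -m1 /nm norm_conjC.
    have iso' x : nm ((t%:C *: Z' + m^* *: ((1 - b t) * V' (m * t%:C)^* * (1 - b' t))) x) = nm x.
      by apply: (julia x (radj_sym (adj t)) d2' d2 s2 s1 i2 _ m1'); rewrite scalerA -cm.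
    split; first by apply: nm_op_le => // x; rewrite mul1r iso.
    apply: (unitary_invertible _ iso iso').
    apply: radjD; first exact: adj.
    apply: radjZ; rewrite -[X in radj _ X]mulrA; apply: radjM; [apply: radjM => //|].
      by apply: radjD; [exact: radj1|exact: radjN].
    by apply: radjD; [exact: radj1|exact: radjN].
  pose p := (1 - q)^-1 * 2.
  exists (1 + (4 * K * p + 4 * (K * K))) => s t s01 t01.
  have lipX (S S' : 'L(H)) : nm S <= q -> nm S' <= q ->
      nm ((t%:C *: S) * (t%:C *: S') - (s%:C *: S) * (s%:C *: S')) <= 2 * `|t - s|.
    move=> Sq S'q; have -> : (t%:C *: S) * (t%:C *: S') - (s%:C *: S) * (s%:C *: S') =
        ((t + s) * (t - s))%:C *: (S * S').
      rewrite !opZl !opZr; lincomb_with R[i] 'L(H).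
      by split=> //; rewrite rmorphM rmorphB rmorphD /=; ring.
    rewrite nmZ nmR normrM; have -> : `|t + s| = t + s by rewrite ger0_norm//; lra.
    have := nm_mul S S'; have := nm_ge0 (S * S'); have := nm_ge0 S; have := nm_ge0 S'; have := normr_ge0 (t - s).
    move: `|t - s| => w w0 h1 h2 h3 h4.
    have h5 : nm (S * S') <= 1 by nra.
    have : (t + s) * w <= 2 * w by rewrite ler_wpM2r//; lra.
    have : (t + s) * w * nm (S * S') <= (t + s) * w by rewrite ler_piMr// mulr_ge0//; lra.
    lra.
  have lipb := defect_lip (bP t t01) (bP s s01).
  have lipb' := defect_lip (b'P t t01) (b'P s s01).
  have q0' : 0 <= (1 - q)^-1 by rewrite invr_ge0; lra.
  have eb : nm ((1 - b t) - (1 - b s)) <= p * `|t - s|.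
    rewrite opprB addrC subrKA nmC (le_trans lipb)// /p -mulrA ler_wpM2l//; exact: lipX.
  have eb' : nm ((1 - b' t) - (1 - b' s)) <= p * `|t - s|.
    rewrite opprB addrC subrKA nmC (le_trans lipb')// /p -mulrA ler_wpM2l//; exact: lipX.
  have [c1 c2 nV _] := VP _ (tm t m t01 mr); have [k1 k2 nV' _] := VP _ (tm s m s01 mr).
  have eV : nm (V (m * t%:C) - V (m * s%:C)) <= K * K * `|t - s|.
    rewrite (resolvent_sub k1 c2) -mulrBr -rmorphB nmZ nmM m1 mul1r nmR distrC mulrC.
    rewrite ler_wpM2r// (le_trans (nm_mul3 nV Z'q nV'))//.
    by have := q1; nra.
  have [_ _ bt _] := bP t t01; have [_ _ bs' _] := b'P s s01.
  have := nm_sub3 (nD _ bt) (nD _ bs') nV nV' eb' eb eV.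
  rewrite /T; set Q1 := (_ * _ * _); set Q2 := (_ * _ * _) => hQ.
  have -> : t%:C *: Z + m *: Q1 - (s%:C *: Z + m *: Q2) = (t - s)%:C *: Z + m *: (Q1 - Q2).
    by rewrite rmorphB; lincomb_with R[i] 'L(H); do ?split; ring.
  rewrite (le_trans (nmD _ _))// !nmZ m1 mul1r nmR.
  have : `|t - s| * nm Z <= `|t - s| by rewrite ler_piMr// (le_trans Zq)// ltW.
  by move: `|t - s| hQ => w; clear; nra.
Qed.


End Family.
End Moebius.

(** * Metric descriptions of topological notions *)

Section Interface.
Variable R : realType.
Local Notation C := R[i].

Lemma pos_complex (e : C) : 0 < e -> exists2 t : R, 0 < t & e = t%:C.
Proof.
move=> e0; exists (complex.Re e); last by rewrite RRe_real// gtr0_real.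
by move: e0; case: e => a b; rewrite ltcE /= => /andP[].
Qed.

Lemma nbhs_nm (E : normedModType C) (x : E) (P : set E) :
  nbhs x P <-> exists2 t : R, 0 < t & forall y, nm (y - x) < t -> P y.
Proof.
split=> [/nbhs_normP[e /= /pos_complex[t t0 ->] h]|[t t0 h]].
  exists t => // y yx; apply: h => /=.
  by rewrite distrC nmE ltcR.
apply/nbhs_normP; exists t%:C => /=; first by rewrite ltcR.
by move=> y /=; rewrite distrC nmE ltcR; exact: h.
Qed.

Lemma open_nm (E : normedModType C) (U : set E) : opn U -> open U.
Proof. by move=> Uo; rewrite openE => x /Uo h; apply/nbhs_nm. Qed.

(** The linear part [L] is the derivative by uniqueness of differentials. *)
Lemma frechet_differentiable (E : normedModType C) (X : completeNormedModType C)
    (f : E -> X) x : frechet f x -> differentiable f x.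
Proof.
move=> [L [LD LZ [K LK]] Lo].
have Llin : linear L by move=> a u v; rewrite LD LZ.
pose l : {linear E -> X} := HB.pack L (GRing.isLinear.Build C E X *:%R L Llin).
have lc : continuous l.
  move=> u; apply/cvgrPdist_lt => e /pos_complex[t t0 ->].
  have K0 : 0 < `|K| + 1 by rewrite ltr_wpDl.
  apply/nbhs_nm; exists (t / (`|K| + 1)); first by rewrite divr_gt0.
  move=> v; rewrite ltr_pdivlMr// => h; rewrite nmE ltcR nmC.
  rewrite -linearB; have LK' w : nm (l w) <= K * nm w by exact: LK.
  have := LK' (v - u); have := nm_ge0 (v - u); have := ler_norm K; nra.
have fE : f \o shift x = cst (f x) + l +o_ 0 id.
  apply/eqaddoP => e /pos_complex[t t0 ->].
  have [s s0 hs] := Lo t t0; apply/nbhs_nm; exists s => // v; rewrite subr0 => /hs.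
  rewrite !nmE -rmorphM lecR; congr (nm _ <= _).
  rewrite -[RHS]/(f (v + x) - (f x + L v)).
  by rewrite opprD addrA (addrC v).
have dE := diff_unique lc fE.
apply/diff_locallyP; rewrite dE; split => //.
Qed.

Lemma differentiable_gat (E : normedModType C) (X : completeNormedModType C) (f : E -> X) (U : E -> Prop) :
  (forall x, U x -> differentiable f x) -> gat f U.
Proof.
move=> fd x v /fd/(@diff_derivable _ _ _ _ _ v)/cvg_ex[d /cvgrPdist_lt h].
exists d => e e0; have [|t t0 ht] := (nbhs_nm _ _).1 (h e%:C _); first by rewrite ltcR.
exists t => // s st; rewrite add0r scale0r addr0.
have [->|s0] := eqVneq s 0; first by rewrite !scale0r addr0 !subr0 subrr !nm0 mulr0.
have := ht s; rewrite subr0 => /(_ st s0); rewrite nmE ltcR nmC /= [_ + x]addrC => /ltW k.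
rewrite -(ler_pM2l (nm_gt0 s0)) in k.
rewrite mulrC (le_trans _ k)// -nmZ scalerBr scalerA divff// scale1r.
by [].
Qed.

(** A Lipschitz path is continuous, so its image is connected. *)
Lemma segment_component (E : normedModType C) (P : set E) (one : E) (g : R -> E) (L : R) :
  (forall s t : R, 0 <= s <= 1 -> 0 <= t <= 1 -> nm (g t - g s) <= L * `|t - s|) ->
  (forall t : R, 0 <= t <= 1 -> P (g t)) ->
  connected_component P one (g 0) -> connected_component P one (g 1).
Proof.
move=> gL gP g0.
have gc : {within `[(0 : R), 1], continuous g}.
  apply/subspace_continuousP => s /=; rewrite in_itv /= => s01.
  apply/cvgrPdist_lt => e /pos_complex[t t0 ->].
  have L0 : 0 < `|L| + 1 by rewrite ltr_wpDl.
  rewrite near_withinE; near=> u => /= u01; rewrite in_itv /= in u01.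
  rewrite nmE ltcR (le_lt_trans (gL _ _ u01 s01))//.
  have : `|s - u| < t / (`|L| + 1).
    by near: u; apply: cvgr_dist_lt; rewrite ?divr_gt0.
  rewrite ltr_pdivlMr//; have := ler_norm L; have := normr_ge0 (s - u); nra.
have gconn := connected_continuous_connected (@segment_connected R 0 1) gc.
apply: (connected_component_trans g0).
apply: (connected_component_max _ _ gconn).
- by exists 0 => //=; rewrite in_itv /= lexx ler01.
- by move=> _ [t /= + <-]; rewrite in_itv /=; exact: gP.
- by exists 1 => //=; rewrite in_itv /= lexx ler01.
Unshelve. all: by end_near.
Qed.

End Interface.

(** * The component of the identity *)

Section Component.
Variables (R : realType) (H : hilbertType R) (A : powerAlgebra H).
Local Notation C := R[i].
Local Notation E := (pa_elt A).
Hypothesis jA : jstar_algebra A.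
Hypothesis wA : wot_closed A.
Local Notation inA := (pa_set A).
Local Notation one := (pa_one A).
Implicit Types (S T U : 'L(H)) (W Y Z : E).

Lemma nm_val Z : nm Z = nm (pa_val Z). Proof. by []. Qed.

Lemma valA Z : inA (pa_val Z).
Proof. by case: Z => S /= /asboolP. Qed.

Definition lift S : E := insubd (0 : E) S.

Lemma liftK S : inA S -> pa_val (lift S) = S.
Proof. by move=> SA; apply: insubdK; apply/asboolP. Qed.

Lemma val_eq W Z : pa_val W = pa_val Z -> W = Z.
Proof. exact: val_inj. Qed.

Lemma invertibleM S T : invertible S -> invertible T -> invertible (S * T).
Proof.
move=> /invertibleP[S' [h1 h2]] /invertibleP[T' [k1 k2]].
apply/invertibleP; exists (T' * S'); split.
  by rewrite mulrA -(mulrA S) k1 mulr1.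
by rewrite mulrA -(mulrA T') h2 mulr1.
Qed.

Lemma invertible_scale (c : C) : c != 0 -> invertible (c *: (1 : 'L(H))).
Proof.
move=> c0; apply/invertibleP; exists (c^-1 *: (1 : 'L(H))).
by rewrite !opZl !mul1r !scalerA divff ?mulVf ?scale1r.
Qed.

Lemma invertibleZ (c : C) S : c != 0 -> invertible S -> invertible (c *: S).
Proof.
move=> c0 Si; have := invertibleM (invertible_scale c0) Si.
by rewrite opZl mul1r.
Qed.

Lemma invertible_near S S' T : S * S' = 1 -> S' * S = 1 -> nm S' * nm T < 1 -> invertible (S + T).
Proof.
move=> h1 h2 ST; have -> : S + T = S * (1 + S' * T) by rewrite mulrDr mulr1 mulrA h1 mul1r.
apply: invertibleM; first by exists S'.
have [|U [k1 k2 _ _]] := @neumann_shift R H A wA (S' * T); first exact: le_lt_trans (nm_mul _ _) ST.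
by exists U.
Qed.

Lemma G_invertible Z : G_I A Z -> invertible (pa_val Z).
Proof. exact: connected_component_sub. Qed.

Lemma G_one : G_I A one.
Proof. by apply: connected_component_refl; apply/invertibleP; exists 1; rewrite mulr1. Qed.

Lemma G_segment W Z : G_I A W ->
  (forall t : R, 0 <= t <= 1 -> invertible (pa_val (W + t%:C *: (Z - W)))) -> G_I A Z.
Proof.
move=> WG inv.
have := @segment_component R E [set Z | invertible (pa_val Z)] one (fun t => W + t%:C *: (Z - W)) (nm (Z - W)).
rewrite scale0r addr0 scale1r [W + _]addrC subrK; apply=> // s t _ _.
by rewrite opprD addrACA subrr add0r -scalerBl -rmorphB nmZ nmR mulrC.
Qed.

Lemma G_open : opn (G_I A : E -> Prop).
Proof.
move=> Z ZG; have [S [h1 h2]] := G_invertible ZG.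
have n0 : 0 < nm S + 1 by rewrite ltr_wpDl ?nm_ge0.
exists (nm S + 1)^-1; first by rewrite invr_gt0.
move=> Y YZ; apply: (G_segment ZG) => t /andP[t0 t1].
apply: (invertible_near (S' := S) (T := t%:C *: pa_val (Y - Z)) h1 h2).
rewrite nmZ nmR ger0_norm// -nm_val; move: YZ; rewrite -div1r ltr_pdivlMr//.
have := nm_ge0 S; have := nm_ge0 (Y - Z); move: (nm S) (nm (Y - Z)) => a b b0 a0 ab.
have : t * (a * b) <= a * b by rewrite ler_piMl// mulr_ge0.
by rewrite mulrCA; lra.
Qed.

(** The segment from [1] to [c] avoids [0]. *)
Lemma G_scale_half (c : C) Z : (complex.Im c != 0) || (0 < complex.Re c) -> G_I A Z -> G_I A (c *: Z).
Proof.
move=> cn ZG; apply: (G_segment ZG) => t /andP[t0 t1].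
have -> : Z + t%:C *: (c *: Z - Z) = (1 + t%:C * (c - 1)) *: Z.
  by lincomb_with R[i] (pa_elt A); split => //; ring.
apply: invertibleZ; last exact: G_invertible.
apply/eqP => /eqP; rewrite eq_complex; case: c cn => a b /= cn /andP[/eqP e1 /eqP e2].
have tb : t * b = 0 by rewrite -[RHS]e2; ring.
have e1' : 1 + t * (a - 1) = 0 by rewrite -[RHS]e1; ring.
case/orP: cn => [b0|a0]; last by nra.
by move/eqP: tb; rewrite mulf_eq0 (negbTE b0) orbF => /eqP t00; rewrite t00 in e1'; lra.
Qed.

(** A negative real number is the product of two numbers with nonzero imaginary
    part. *)
Lemma G_scale (c : C) Z : c != 0 -> G_I A Z -> G_I A (c *: Z).
Proof.
move=> c0 ZG; have [h|] := boolP ((complex.Im c != 0) || (0 < complex.Re c)).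
  exact: G_scale_half.
rewrite negb_or negbK -leNgt => /andP[/eqP c1 c2].
have -> : c *: Z = 'i *: ((- 'i * c) *: Z).
  by rewrite scalerA mulrA mulrN -expr2 sqr_i opprK mul1r.
apply: G_scale_half; first by rewrite /= oner_eq0.
apply: G_scale_half => //; apply/orP; left.
case: c c0 c1 {c2} => a b /= c0 b0; rewrite eq_complex b0 eqxx andbT in c0.
by rewrite oppr0 mul0r add0r mulN1r oppr_eq0.
Qed.

Lemma G_connected (K : E -> Prop) : K one ->
  (forall Z, G_I A Z -> K Z -> exists2 t : R, 0 < t & forall Y, nm (Y - Z) < t -> K Y) ->
  (forall Z, G_I A Z -> (forall t : R, 0 < t -> exists2 Y, nm (Y - Z) < t & K Y) -> K Z) ->
  forall Z, G_I A Z -> K Z.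
Proof.
move=> K1 Kop Kcl.
pose B : set E := G_I A `&` [set Z | K Z].
suff BG : B = G_I A by move=> Z; rewrite -BG => -[].
apply: (@component_connected _ [set Z | invertible (pa_val Z)] one).
- by exists one; split => //; exact: G_one.
- exists B; last by rewrite /B setIA setIid.
  apply: open_nm => Z [ZG ZK]; have [t t0 ht] := G_open ZG; have [s s0 hs] := Kop Z ZG ZK.
  exists (Num.min t s); first by rewrite lt_min t0.
  by move=> Y; rewrite lt_min => /andP[/ht ? /hs].
- exists (closure B); first exact: closed_closure.
  apply/seteqP; split=> [Z ZB|Z [ZG ZB]].
    by split; [case: ZB|exact: subset_closure].
  split => //; apply: Kcl => // t t0.
  have [|Y [[YG YK] Yt]] := ZB [set Y | nm (Y - Z) < t]; first by apply/nbhs_nm; exists t.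
  by exists Y.
Qed.

Definition selfadj_elt Z := selfadj (pa_val Z).

Lemma selfadj_elt_split W : exists S T : E, [/\ selfadj_elt S, selfadj_elt T & W = S + 'i *: T].
Proof.
have [W' W'A /radjP adj] := jA (valA W); have adj' := radj_sym adj.
exists (half R *: (W + lift W')), ((- 'i * half R) *: (W - lift W')); split.
- have -> : selfadj_elt (half R *: (W + lift W')) = selfadj (half R *: (pa_val W +
  W')) by rewrite -[in RHS](liftK W'A).
  by have := radjZr 2^-1 (radjD adj adj'); rewrite [W' + _]addrC.
- have -> : selfadj_elt ((- 'i * half R) *: (W - lift W')) = selfadj ((- 'i * half R) *: (pa_val W - W')).
    by rewrite -[in RHS](liftK W'A).
  have := radjZ (- 'i * half R) (radjD adj (radjN adj')).
  rewrite (_ : @Num.conj C (- 'i * half R) = 'i * half R); last first.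
    by apply/eqP; rewrite eq_complex /=; apply/andP; split; apply/eqP; ring.
  have -> : W' - pa_val W = - (pa_val W - W') by rewrite opprB.
  by rewrite scalerN -scaleNr -mulNr.
- rewrite scalerA mulrA mulrN -expr2 sqr_i opprK mul1r halfE.
  by lincomb_with R[i] (pa_elt A); do ?split; field.
Qed.

(** For [W] with finite real spectrum, [1 + m *: W] is invertible for all [m] outside of
    a finite set of real numbers. A nonreal [m] is reached from [0] along a segment of
    nonreal numbers, and a real [m] from [m + 'i]. *)
Lemma selfadj_elt_dense (S : E) : selfadj_elt S -> forall e : R, 0 < e ->
  exists2 W, nm (W - S) < e & exists F : seq C, forall m, m \notin F -> G_I A (one + m *: W).
Proof.
move=> Ss e e0; pose c := nm S + 1.
have c0 : 0 < c by rewrite ltr_wpDl ?nm_ge0.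
have cC : c%:C != 0 :> C by rewrite eq_complex /= eqxx andbT gt_eqF.
pose S1 := (c^-1)%:C *: pa_val S.
have S1A : inA S1 by apply: inAZ; exact: valA.
have S1s : selfadj S1 by exact: radjZr.
have S11 : nm S1 <= 1.
  by rewrite nmZ nmR ger0_norm ?invr_ge0 ?(ltW c0)// ler_pdivrMl// mulr1 -nm_val lerDl.
have [|//|n hn] := @geometric_small R 2^-1 c e.
  by rewrite invr_ge0 ler0n invf_lt1 ?ltr1n ?ltr0n.
have [W1 [F [W1A SW W1F _]]] := spectral_approx wA n S1s S11 S1A.
pose W0 := c%:C *: W1.
have W0A : inA W0 by exact: inAZ.
have SE : pa_val S = c%:C *: S1 by rewrite scalerA -rmorphM divff ?scale1r// gt_eqF.
exists (lift W0).
  rewrite nmC nm_val (_ : pa_val (S - lift W0) = c%:C *: (S1 - W1)); last first.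
    by rewrite scalerBr -SE -[X in _ = _ - X](liftK W0A).
  rewrite nmZ nmR ger0_norm ?(ltW c0)//; apply: le_lt_trans (hn n (leqnn n)).
  rewrite [_ * c]mulrC ler_wpM2l ?(ltW c0)// (le_trans SW)//.
  by rewrite ler_peMl ?ler1n// exprn_ge0// invr_ge0.
pose F' : seq C := [seq - ((c * r)^-1)%:C | r <- F].
have inv0 : invertible (pa_val (one + 0 *: lift W0)).
  by rewrite scale0r addr0; apply/invertibleP; exists 1; rewrite mulr1.
have inv m : m \notin F' -> invertible (pa_val (one + m *: lift W0)).
  move=> mF; have [->//|m0] := eqVneq m 0.
  have -> : pa_val (one + m *: lift W0) = 1 + m *: W0 by rewrite -[in RHS](liftK W0A).
  have mc : m * c%:C != 0 by rewrite mulf_neq0.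
  have -> : 1 + m *: W0 = (m * c%:C) *: (W1 - (- (m * c%:C)^-1) *: (1 : 'L(H))).
    by rewrite scalerBr !scalerA mulrN divff// scaleN1r opprK addrC.
  apply: invertibleZ => //; apply: W1F => r rF; apply/eqP => mr.
  case/negP: mF; apply/mapP; exists r => //.
  have -> : ((c * r)^-1)%:C = (c%:C * r%:C)^-1 by rewrite fmorphV rmorphM.
  by rewrite -mr mulrN invrN opprK invfM invrK mulrCA mulVf ?mulr1.
have F'r m : complex.Im m != 0 -> m \notin F'.
  by move=> mi; apply/mapP => -[r _ mr]; move: mi; rewrite mr /= oppr0 eqxx.
have ray (m : C) : complex.Im m != 0 -> G_I A (one + m *: lift W0).
  move=> mi; apply: (G_segment G_one) => t /andP[t0 t1].
  rewrite [_ - one]addrC addKr scalerA; have [->|tn] := eqVneq t 0.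
    by rewrite mul0r; exact: inv0.
  by apply: inv; apply: F'r; case: m mi => a b /= mi; rewrite mul0r addr0 mulf_neq0.
exists F' => m mF; have [mi|/ray//] := eqVneq (complex.Im m) 0.
have mi' : G_I A (one + (m + 'i) *: lift W0).
  by apply: ray; rewrite raddfD /= mi add0r oner_eq0.
apply: (G_segment mi') => t /andP[t0 t1].
have -> : one + (m + 'i) *: lift W0 + t%:C *: (one + m *: lift W0 - (one + (m + 'i) *: lift W0)) =
   one + (m + (1 - t)%:C * 'i) *: lift W0.
  by rewrite rmorphB rmorph1; lincomb_with R[i] (pa_elt A); do ?split => //; ring.
have [->|tn] := eqVneq t 1; first by rewrite subrr mul0r addr0; exact: inv.
apply: inv; apply: F'r; rewrite raddfD /= mi add0r mul0r addr0 mulr1.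
by rewrite subr_eq0 eq_sym.
Qed.

Lemma moebius_discs Z : nm Z < 1 -> exists T : C -> E,
  [/\ exists2 r : R, 1 < r & forall z, nm z < r -> exists d, dif T z d, T 0 = Z &
    forall z : C, nm z = 1 -> G_I A (T z) /\ nm (T z) <= 1].
Proof.
move=> Z1; have [Z' Z'A /radjP adj] := jA (valA Z).
pose q := nm Z; have q0 : 0 <= q by exact: nm_ge0.
pose r := 2 / (1 + q); have q1 : 0 < 1 + q by lra.
have r1 : 1 < r by rewrite ltr_pdivlMr// mul1r; rewrite -/q in Z1; lra.
have rq : r * q < 1 by rewrite mulrAC ltr_pdivrMr// mul1r; rewrite -/q in Z1; lra.
have [T [T1 T0 TA Td Tu]] := moebius_family wA (valA Z) Z'A adj q0 (lexx q) r1 rq.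
have o1 : 0 <= (1 : R) <= 1 by rewrite ler01 lexx.
exists (fun z => lift (T 1 z)); split.
- exists r => // z zr; have [d dA hd] := Td z zr; exists (lift d) => e e0.
  have [t t0 ht] := hd e e0; exists (Num.min t (r - nm z)); first by rewrite lt_min t0 subr_gt0.
  move=> h; rewrite lt_min => /andP[/ht hh hr].
  have zhr : nm (z + h) < r by have := nmD z h; lra.
  rewrite nm_val (_ : pa_val _ = T 1 (z + h) - T 1 z - h *: d)//.
  by rewrite -{2}(liftK dA) -{2}(liftK (TA _ _ o1 zhr)) -{2}(liftK (TA _ _ o1 zr)).
- by apply: val_eq; rewrite T1 liftK//; exact: valA.
- move=> z z1; have zr : nm z < r by rewrite z1.
  have [Tt [L TL]] := Tu z z1; split; last first.
    by rewrite nm_val liftK; [case: (Tt 1 o1)|exact: TA].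
  have st t : 0 <= t <= 1 -> pa_val (lift (T t z)) = T t z by move=> t01; rewrite liftK//; exact: TA.
  apply: (segment_component (g := fun t => lift (T t z)) (L := L)).
  + move=> s t s01 t01; rewrite nm_val (_ : pa_val _ = T t z - T s z); first exact: TL.
    by rewrite -{2}(st _ t01) -{2}(st _ s01).
  + by move=> t t01 /=; rewrite st//; case: (Tt t t01).
  + have -> : lift (T 0 z) = z *: one.
      by apply: val_eq; rewrite T0// liftK//; exact/inAZ/inA1.
    apply: G_scale; last exact: G_one.
    by apply/eqP => z0; move: z1; rewrite z0 nm0 => /eqP; rewrite eq_sym oner_eq0.
Qed.

End Component.

Theorem proposition8 (R : realType) (H : hilbertType R) (A : powerAlgebra H) :
  jstar_algebra A -> wot_closed A -> removable_singularity_property A.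
Proof.
move=> jA wA X h hh [M [Mr hM]].
have MR : (complex.Re M)%:C = M by rewrite RRe_real.
have ball (Z : pa_elt A) : open_unit_ball A Z <-> nm Z < 1.
  by rewrite /open_unit_ball /= nmE -[1]/(1%:C) ltcR.
have hb (Z : pa_elt A) : G_I A Z -> nm Z < 1 -> nm (h Z) <= complex.Re M + 1.
  move=> ZG Z1; rewrite -lecR -nmE rmorphD /= MR; apply: (hM (M + 1)); first by rewrite ltrDl.
  by split => //; apply/ball.
have hg : gat h (fun Z => G_I A Z /\ nm Z < 1).
  by apply: differentiable_gat => Z [ZG Z1]; apply: hh; split => //; apply/ball.
have Sa_line (S T : pa_elt A) : selfadj_elt S -> selfadj_elt T ->
    forall x : R, selfadj_elt (S + x%:C *: T).
  by move=> Ss Ts x; apply: radjD => //; exact: radjZr.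
have [g gf ge] := bounded_extension (G_open wA) (G_one A) (@nm_one_le R H) (@G_scale _ _ A)
  (G_connected wA) Sa_line (selfadj_elt_split jA) (selfadj_elt_dense wA) (moebius_discs jA wA) hg hb.
exists g => [Z /ball Z1|Z [ZG /ball Z1]]; last exact: ge.
exact: frechet_differentiable (gf Z Z1).
Qed.
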